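(* Let $(T_j)_{j\ge1}$, $N$, $m$ and $U$ be as in the context. Suppose that $N>0$ a.s. and that the following hold: (1) $\mathbb{E}[N]>1$; (2) $m(\alpha)=1$ for some $\alpha\in(1,2)$; (3) with $m'(\alpha):=\mathbb{E}\big[\sum_{j=1}^N|T_j|^\alpha\log|T_j|\big]$ and $W_1:=\sum_{j=1}^N|T_j|^\alpha$, one has $m'(\alpha)\in(-\infty,0)$ and $\mathbb{E}[W_1\log_+W_1]<\infty$; (4) with $Z_1:=\sum_{j=1}^N T_j$, one has $\mathbb{E}\big[|Z_1|^\alpha\log_+^{2+\epsilon}|Z_1|\big]<\infty$ for some $\epsilon>0$; (5) $\mathbb{E}[N^2]<\infty$ and $\mathbb{E}\big[N\sum_{j=1}^N\log_+|T_j|\big]<\infty$; (6) there is no $U$-invariant $\mathbb{R}$-linear subspace of $\mathbb{C}$ other than $\{0\}$ and $\mathbb{C}$. Let $X$ be a complex-valued random variable which is a nontrivial (i.e. not a.s. constant) solution of $$X\ \text{ has the same law as }\ \sum_{j=1}^N T_jX_j,$$ where $X_1,X_2,\dots$ are i.i.d. copies of $X$ independent of $(T_j)_{j\ge1}$. Then the law of $X$ is absolutely continuous with respect to Lebesgue measure on $\mathbb{C}\simeq\mathbb{R}^2$.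
   Context: $(T_j)_{j\ge1}$ is a sequence of complex-valued random variables on a common probability space (with arbitrary joint dependence) such that $$N:=\#\{j: T_j\neq 0\}=\max\{j: T_j\neq 0\}<\infty\quad\text{a.s.}$$ Set $m(s):=\mathbb{E}\big[\sum_{j=1}^N|T_j|^s\big]$, so $m(0)=\mathbb{E}[N]$. $U$ denotes the closed multiplicative subgroup of $\mathbb{C}\setminus\{0\}$ generated by the support of $(T_j)_{j\ge1}$, i.e. the smallest closed subgroup of $\mathbb{C}\setminus\{0\}$ such that a.s. $T_j\in U$ for all $1\le j\le N$. A subspace $V\subset\mathbb{C}$ is $U$-invariant if $uV\subset V$ for all $u\in U$. Finally, $\log_+x=\max(\log x,0)$. *)

(* Defs.v *)
From HB Require Import structures.
From mathcomp Require Import all_boot all_order all_algebra finmap.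
From mathcomp Require Import complex.
From mathcomp Require Import all_classical all_reals all_analysis.

Set Implicit Arguments.
Unset Strict Implicit.
Unset Printing Implicit Defensive.

Import Order.TTheory GRing.Theory Num.Theory.
Import numFieldNormedType.Exports.
Import ComplexField.Normc.

Local Open Scope classical_set_scope.
Local Open Scope ring_scope.

(** R[i] carries the sigma-algebra of R^2, transported along z |-> (Re z, Im z);
    measurable functions to R[i] are those with measurable real and imaginary
    parts. *)

Definition pair_of_complex (R : Type) (z : R[i]) : R * R :=
  (complex.Re z, complex.Im z).

Definition complex_of_pair (R : Type) (p : R * R) : R[i] := Complex p.1 p.2.

Section complex_measurable.
Variable R : realType.

HB.instance Definition _ := isPointed.Build R[i] 0.

Definition complex_measurable : set (set R[i]) :=
  g_sigma_algebra_preimage (@pair_of_complex R).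

Let complex_measurable0 : complex_measurable set0.
Proof. exact: (@measurable0 _ (g_sigma_algebra_preimageType (@pair_of_complex R))). Qed.

Let complex_measurableC A : complex_measurable A -> complex_measurable (~` A).
Proof. exact: (@measurableC _ (g_sigma_algebra_preimageType (@pair_of_complex R))). Qed.

Let complex_measurable_bigcup (F : (set R[i])^nat) :
  (forall i, complex_measurable (F i)) -> complex_measurable (\bigcup_i F i).
Proof.
exact: (@bigcupT_measurable _ (g_sigma_algebra_preimageType (@pair_of_complex R))).
Qed.

HB.instance Definition _ := @isMeasurable.Build
  (preimage_display (@pair_of_complex R)) R[i] complex_measurable
  complex_measurable0 complex_measurableC complex_measurable_bigcup.

Lemma measurable_pair_of_complex :
  measurable_fun setT (@pair_of_complex R).
Proof. by move=> _ B mB; exists B. Qed.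

Lemma measurable_complex_of_pair :
  measurable_fun setT (@complex_of_pair R).
Proof.
move=> _ _ [B mB <-]; rewrite !setTI -comp_preimage.
by rewrite (_ : _ \o _ = id) ?preimage_id//; apply/funext => -[].
Qed.

End complex_measurable.

Section complex_lebesgue.
Variable R : realType.
Local Open Scope ereal_scope.

Let lebesgue2 : {measure set (measurableTypeR R * measurableTypeR R) -> \bar R} :=
  (@lebesgue_measure R \x @lebesgue_measure R).

Definition complex_lebesgue : set R[i] -> \bar R :=
  pushforward (@lebesgue_measure R \x @lebesgue_measure R) (@complex_of_pair R).

Let mu : {measure set R[i] -> \bar R} :=
  measure_function_pushforward__canonical__measure_function_Measure
    lebesgue2 (@measurable_complex_of_pair R).

Let complex_lebesgue0 : complex_lebesgue set0 = 0.
Proof. exact: (measure0 mu). Qed.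

Let complex_lebesgue_ge0 A : 0 <= complex_lebesgue A.
Proof. exact: (measure_ge0 mu). Qed.

Let complex_lebesgue_sigma_additive : semi_sigma_additive complex_lebesgue.
Proof. exact: (@measure_semi_sigma_additive _ _ _ mu). Qed.

HB.instance Definition _ := isMeasure.Build _ _ _ complex_lebesgue
  complex_lebesgue0 complex_lebesgue_ge0 complex_lebesgue_sigma_additive.

End complex_lebesgue.
Arguments complex_lebesgue R _ : clear implicits.

Definition log_plus (R : realType) (x : R) : R := Num.max (ln x) 0.

(** Sequences of random variables are indexed from 0: the j-th term T_j of the
    informal sequence (j >= 1) is [T j.-1], and sums over 1 <= j <= N are sums
    over j < N. *)

Section weights.
Context (d : measure_display) (Omega : measurableType d) (R : realType).
Variables (P : probability Omega R) (T : nat -> {RV P >-> R[i]}).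

Definition nonzero_indices (w : Omega) : set nat := [set j | T j w != 0].

(** The cardinality is 0 when there are infinitely many nonzero terms, an event
    that [finite_initial] makes negligible. *)
Definition num_terms (w : Omega) : nat := #|` fset_set (nonzero_indices w)|.

Definition finite_initial : Prop :=
  {ae P, forall w, finite_set (nonzero_indices w) /\
    num_terms w = (\max_(j <- fset_set (nonzero_indices w)) j.+1)%N}.

Definition power_sum (s : R) (w : Omega) : R :=
  \sum_(j < num_terms w) normc (T j w) `^ s.

Definition moment (s : R) : \bar R := 'E_P[power_sum s].

(** In the integral +oo - +oo is -oo, so if this lies in ]-oo, 0[ then the sum
    is integrable. *)
Definition log_moment (s : R) : \bar R :=
  'E_P[fun w => \sum_(j < num_terms w)
                  normc (T j w) `^ s * ln (normc (T j w))].

Definition term_sum (w : Omega) : R[i] := \sum_(j < num_terms w) T j w.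

(** Closed subgroups of the multiplicative group of nonzero complex numbers,
    for the subspace topology; [R[i]^o] carries the topology of the modulus. *)
Definition closed_mul_subgroup (H : set R[i]) : Prop :=
  GRing.divr_closed (mem H) /\
  exists2 F : set R[i]^o, closed F & H = F `\ 0.

Definition support_group : set R[i] :=
  \bigcap_(H in [set H : set R[i] | closed_mul_subgroup H /\
    {ae P, forall w, forall j, (j < num_terms w)%N -> H (T j w)}]) H.

End weights.

Section subspaces.
Variable R : realType.

(** [Rcomplex R] is R[i] seen as a vector space over R. *)
Definition real_subspace (V : set R[i]) : Prop :=
  @GRing.submod_closed R (Rcomplex R) (mem V).

Definition invariant_under (G V : set R[i]) : Prop :=
  forall u v, G u -> V v -> V (u * v).

End subspaces.

Section independence.
Context (d : measure_display) (Omega : measurableType d) (R : realType).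
Variable P : probability Omega R.

Definition sigma_seq (X : nat -> {RV P >-> R[i]}) : set (set Omega) :=
  <<s \bigcup_j preimage_set_system setT (X j) measurable >>.

Definition independent_seqs (X Y : nat -> {RV P >-> R[i]}) : Prop :=
  forall A B, sigma_seq X A -> sigma_seq Y B -> P (A `&` B) = (P A * P B)%E.

Definition mutually_independent (X : nat -> {RV P >-> R[i]}) : Prop :=
  forall (J : {fset nat}) (A : nat -> set R[i]),
    (forall j, measurable (A j)) ->
    P (\bigcap_(j in [set` J]) (X j @^-1` A j)) =
    (\prod_(j <- J) P (X j @^-1` A j))%E.

End independence.

(** [X] may live on a probability space [Omega'] of its own, as only its law
    matters; the copies [Xs] live on the space of [T]. *)
Definition smoothing_solution (d d' : measure_display)
    (Omega : measurableType d) (Omega' : measurableType d') (R : realType)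
    (P : probability Omega R) (Q : probability Omega' R)
    (T Xs : nat -> {RV P >-> R[i]}) (X : {RV Q >-> R[i]}) : Prop :=
  [/\ forall j A, measurable A -> distribution P (Xs j) A = distribution Q X A,
      mutually_independent Xs,
      independent_seqs T Xs &
      forall A, measurable A ->
        distribution Q X A =
        pushforward P (fun w => \sum_(j < num_terms T w) T j w * Xs j w) A].

Definition nontrivial (d : measure_display) (Omega : measurableType d)
    (R : realType) (P : probability Omega R) (X : {RV P >-> R[i]}) : Prop :=
  ~ exists c : R[i], {ae P, forall w, X w = c}.

(* Main.v *)
Require Import Defs.
From HB Require Import structures.
From mathcomp Require Import all_boot all_order all_algebra finmap.
From mathcomp Require Import complex.
From mathcomp Require Import all_classical all_reals all_analysis.
From mathcomp Require Import measurable_realfun.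
From mathcomp Require Import ring lra.

(** Let [char t x = exp (i Re (t x))], let [mu] be the law of [X] and let [phi t] be
    the modulus of its Fourier transform. The fixed point equation, conditioned on
    the weights, gives [phi t <= E (phi (t T_i) phi (t T_j))] for [i <> j]
    ([phi_smoothing]). More generally, it controls the Fourier transform of the part
    of [mu] obtained by weighting the histories by functions of two of the copies
    ([cEx_pair_weight_le]); such a part has a density [h] with values in the unit
    interval with respect to [mu] ([weight_conditioning]), so that it can be fed
    back into the equation. Only the first two children are followed: [T_0] never
    vanishes, [T_1] is nonzero with positive probability, and
    [E (|T_0|^alpha + |T_1|^alpha) <= 1].

    Strictness ([phi_lt1]). The frequencies with [phi = 1] form a closed subgroup
    stable under the weights. If it is not trivial, the moment bound provides small
    nonzero weights, hence arbitrarily small elements of the subgroup; irreducibility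
    provides a non-real weight, which makes the subgroup dense. Then [phi = 1]
    everywhere and [X] is constant.

    Uniformity ([cramer_condition]). When [u = 1 - phi] is small, [u t] is nearly at
    least the expected sum of [u (t T_0)] and [u (t T_1)]. Keeping only weights larger
    than a small [eps] leaves more than one child on average, while [|t|^alpha] is
    contracted on average. A minimum principle for [u + eta |t|^alpha] then bounds [u]
    below at high frequencies by its values on an annulus.

    Decay ([quartic_decay_full]). Say that a child is kept if its weight is at least
    [eps]; the kept children form a supercritical branching process. In each
    generation, the part of [mu] that survives gains a factor less than 1 while
    frequencies shrink at most by [eps] ([geometric_decay_survival]): its Fourier
    transform decays at least like a small power. Requiring both children to survive
    doubles the power ([geometric_decay_square]), so some nonzero part of [mu] has a
    Fourier transform of order [|t|^-4]. This property is inherited by the part with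
    at least one child in the given part, whose mass is larger; so it holds for parts
    of mass arbitrarily close to 1.

    Conclusion ([quartic_decay_absolutely_continuous]). Testing such a part against a
    Fejer kernel at integer frequencies bounds its mass on a square by a constant
    times the area ([square_mass]), and approximation of measurable sets by unions of
    dyadic squares shows that null sets have mass at most [1 - m], for all [m < 1]. *)

Set Implicit Arguments.
Unset Strict Implicit.
Unset Printing Implicit Defensive.

Import Order.TTheory GRing.Theory Num.Theory.
Import numFieldNormedType.Exports.
Import ComplexField.Normc.

Local Open Scope classical_set_scope.
Local Open Scope ring_scope.

(** * Expectation of bounded real random variables *)

Definition bounded_mf (R : realType) (d : measure_display)
    (S : measurableType d) (f : S -> R) : Prop :=
  measurable_fun setT f /\ exists M, forall x, `|f x| <= M.

Definition Ex (R : realType) (d : measure_display) (S : measurableType d)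
  (P : probability S R) (f : S -> R) : R := \int[P]_x f x.

Section bounded_mf_theory.
Context (R : realType) (d : measure_display) (S : measurableType d).
Implicit Types f g : S -> R.

Lemma bounded_mf_cst (c : R) : bounded_mf (fun _ : S => c).
Proof. by split=> //; exists `|c|. Qed.

Lemma bounded_mfD f g : bounded_mf f -> bounded_mf g ->
  bounded_mf (fun x => f x + g x).
Proof.
move=> [mf [M Mf]] [mg [L Lg]]; split; first exact: measurable_funD.
by exists (M + L) => x; rewrite (le_trans (ler_normD _ _))// lerD.
Qed.

Lemma bounded_mfN f : bounded_mf f -> bounded_mf (fun x => - f x).
Proof.
move=> [mf [M Mf]]; split; first exact: measurableT_comp.
by exists M => x; rewrite normrN.
Qed.

Lemma bounded_mfB f g : bounded_mf f -> bounded_mf g ->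
  bounded_mf (fun x => f x - g x).
Proof. by move=> bf bg; apply: bounded_mfD => //; exact: bounded_mfN. Qed.

Lemma bounded_mfM f g : bounded_mf f -> bounded_mf g ->
  bounded_mf (fun x => f x * g x).
Proof.
move=> [mf [M Mf]] [mg [L Lg]]; split; first exact: measurable_funM.
by exists (M * L) => x; rewrite normrM ler_pM.
Qed.

Lemma bounded_mf_norm f : bounded_mf f -> bounded_mf (fun x => `|f x|).
Proof.
move=> [mf [M Mf]]; split; first exact: measurableT_comp.
by exists M => x; rewrite normr_id.
Qed.

Lemma bounded_mf_indic (A : set S) : measurable A ->
  bounded_mf (\1_A : S -> R).
Proof.
move=> mA; split; first exact: measurable_indic.
by exists 1 => x; rewrite indicE; case: (_ \in _); rewrite ?normr1 ?normr0.
Qed.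

Lemma bounded_mf_cos f : measurable_fun setT f ->
  bounded_mf (fun x => cos (f x)).
Proof.
move=> mf; split.
  by apply: measurableT_comp mf; apply: continuous_measurable_fun; exact: continuous_cos.
by exists 1 => x; rewrite ler_norml cos_geN1 cos_le1.
Qed.

Lemma bounded_mf_sin f : measurable_fun setT f ->
  bounded_mf (fun x => sin (f x)).
Proof.
move=> mf; split.
  by apply: measurableT_comp mf; apply: continuous_measurable_fun; exact: continuous_sin.
by exists 1 => x; rewrite ler_norml sin_geN1 sin_le1.
Qed.

Lemma bounded_mf_comp d' (S' : measurableType d') (u : S' -> S) f :
  measurable_fun setT u -> bounded_mf f -> bounded_mf (fun x => f (u x)).
Proof.
move=> mu [mf [M Mf]]; split; first exact: (measurableT_comp mf mu).
by exists M.
Qed.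

Variable P : probability S R.

Lemma bounded_mf_integrable f : bounded_mf f -> P.-integrable setT (EFin \o f).
Proof.
move=> [mf [M Mf]]; apply: measurable_bounded_integrable => //.
  by rewrite ltey_eq fin_num_measure.
exists M; split; first exact: num_real.
by move=> x Mx y _ /=; rewrite (le_trans (Mf y))// ltW.
Qed.

Lemma EFin_Ex f : bounded_mf f -> (Ex P f)%:E = (\int[P]_x (f x)%:E)%E.
Proof.
move=> /bounded_mf_integrable fi; rewrite /Ex /Rintegral fineK//.
exact: integrable_fin_num.
Qed.

Lemma ExD f g : bounded_mf f -> bounded_mf g ->
  Ex P (fun x => f x + g x) = Ex P f + Ex P g.
Proof. by move=> bf bg; rewrite /Ex RintegralD//; exact: bounded_mf_integrable. Qed.

Lemma ExB f g : bounded_mf f -> bounded_mf g ->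
  Ex P (fun x => f x - g x) = Ex P f - Ex P g.
Proof. by move=> bf bg; rewrite /Ex RintegralB//; exact: bounded_mf_integrable. Qed.

Lemma ExZ c f : bounded_mf f -> Ex P (fun x => c * f x) = c * Ex P f.
Proof. by move=> bf; rewrite /Ex RintegralZl//; exact: bounded_mf_integrable. Qed.

Lemma Ex_cst c : Ex P (fun _ => c) = c.
Proof. by rewrite /Ex Rintegral_cst//= probability_setT mulr1. Qed.

Lemma eq_Ex f g : f =1 g -> Ex P f = Ex P g.
Proof. by move=> /funext ->. Qed.

Lemma le_Ex f g : bounded_mf f -> bounded_mf g -> (forall x, f x <= g x) ->
  Ex P f <= Ex P g.
Proof.
by move=> bf bg fg; apply: le_Rintegral => //; exact: bounded_mf_integrable.
Qed.

Lemma Ex_ge0 f : (forall x, 0 <= f x) -> 0 <= Ex P f.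
Proof. by move=> f0; exact: Rintegral_ge0. Qed.

Lemma Ex_indic (A : set S) : measurable A -> Ex P \1_A = fine (P A).
Proof. by move=> mA; rewrite /Ex /Rintegral integral_indic// setIT. Qed.

Lemma ae_eq_Ex f g : bounded_mf f -> bounded_mf g ->
  {ae P, forall x, f x = g x} -> Ex P f = Ex P g.
Proof.
move=> [mf _] [mg _] fg; rewrite /Ex /Rintegral; congr fine.
apply: ae_eq_integral => //; [exact/measurable_EFinP..|].
by apply: filterS fg => x -> .
Qed.

(** The form in which the equality cases of inequalities between expectations
    are exploited below. *)
Lemma Ex_eq0_ae f : bounded_mf f -> (forall x, 0 <= f x) -> Ex P f = 0 ->
  {ae P, forall x, f x = 0}.
Proof.
move=> bf f0 Ef0; have If0 := EFin_Ex bf; rewrite Ef0 in If0.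
have mf : measurable_fun setT (EFin \o f) by apply/measurable_EFinP; case: bf.
have /(ae_eq_integral_abs _ measurableT mf) : (\int[P]_x `|(EFin \o f) x| = 0)%E.
  by rewrite [RHS]If0; apply: eq_integral => x _ /=; rewrite ger0_norm.
by apply: filterS => x /(_ I) [].
Qed.

End bounded_mf_theory.

Lemma ae_ex (R : realType) (d : measure_display) (S : measurableType d)
    (P : probability S R) (Q : S -> Prop) : {ae P, forall x, Q x} -> exists x, Q x.
Proof.
move=> [A [mA A0 QA]]; apply: contrapT => noQ.
have AT : A = setT by rewrite -subTset => x _; apply: QA => Qx; apply: noQ; exists x.
by have /eqP := @probability_setT _ _ _ P; rewrite -AT A0 eq_sym onee_eq0.
Qed.

(** * Complex random variables *)

Section complex_random_variables.
Context (R : realType).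
Implicit Types x y z t : R[i].

Lemma normc_sqrtE z : normc z = Num.sqrt (complex.Re z ^+ 2 + complex.Im z ^+ 2).
Proof. by case: z. Qed.

Lemma normc_ge0 z : 0 <= normc z.
Proof. by rewrite normc_sqrtE sqrtr_ge0. Qed.

Lemma normc_eq0 z : (normc z == 0) = (z == 0).
Proof. by apply/eqP/eqP => [/eq0_normc//|->]; rewrite normc0. Qed.

Lemma normc_sqr z : normc z ^+ 2 = complex.Re z ^+ 2 + complex.Im z ^+ 2.
Proof. by rewrite normc_sqrtE sqr_sqrtr// addr_ge0// sqr_ge0. Qed.

Lemma normr_Re_le z : `|complex.Re z| <= normc z.
Proof.
rewrite -(@ler_pXn2r _ 2)// ?nnegrE ?normc_ge0// normc_sqr real_normK ?num_real//.
by rewrite lerDl sqr_ge0.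
Qed.

Lemma normr_Im_le z : `|complex.Im z| <= normc z.
Proof.
rewrite -(@ler_pXn2r _ 2)// ?nnegrE ?normc_ge0// normc_sqr real_normK ?num_real//.
by rewrite lerDr sqr_ge0.
Qed.

Lemma normc_le_ReIm z : normc z <= `|complex.Re z| + `|complex.Im z|.
Proof.
rewrite -(@ler_pXn2r _ 2)// ?nnegrE ?normc_ge0 ?addr_ge0// normc_sqr.
rewrite sqrrD !real_normK ?num_real// -addrA lerD2l lerDr.
by rewrite mulrn_wge0// mulr_ge0.
Qed.

Lemma normc_real (a : R) : normc (Complex a 0) = `|a|.
Proof. by rewrite normc_sqrtE /= expr0n/= addr0 sqrtr_sqr. Qed.

Lemma normcD x y : normc (x + y) <= normc x + normc y.
Proof. exact: le_normcD. Qed.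

Lemma normcB x y : normc (x - y) <= normc x + normc y.
Proof. by rewrite (le_trans (normcD _ _))// [normc (- y)]normcN. Qed.

Lemma normc_distC x y : normc (x - y) = normc (y - x).
Proof. by rewrite -[x - y]opprB [LHS]normcN. Qed.

Lemma normc_inner_le x y :
  complex.Re x * complex.Re y + complex.Im x * complex.Im y <=
  normc x * normc y.
Proof.
rewrite (le_trans (ler_norm _))// -(@ler_pXn2r _ 2)// ?nnegrE ?mulr_ge0 ?normc_ge0//.
rewrite real_normK ?num_real// exprMn !normc_sqr -subr_ge0.
by rewrite [X in 0 <= X](_ : _ = (complex.Re x * complex.Im y -
  complex.Im x * complex.Re y) ^+ 2) ?sqr_ge0//; ring.
Qed.

Lemma complexReM x y : complex.Re (x * y) =
  complex.Re x * complex.Re y - complex.Im x * complex.Im y.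
Proof. by case: x; case: y. Qed.

Lemma complexImM x y : complex.Im (x * y) =
  complex.Re x * complex.Im y + complex.Im x * complex.Re y.
Proof. by case: x => a b; case: y => c e /=; rewrite [in RHS]addrC addrC. Qed.

Lemma complexReD x y : complex.Re (x + y) = complex.Re x + complex.Re y.
Proof. by case: x; case: y. Qed.

Lemma complexImD x y : complex.Im (x + y) = complex.Im x + complex.Im y.
Proof. by case: x; case: y. Qed.

Lemma eq_complexP x y : complex.Re x = complex.Re y ->
  complex.Im x = complex.Im y -> x = y.
Proof. by case: x => a b; case: y => c e /= -> ->. Qed.

Definition cis (a : R) : R[i] := Complex (cos a) (sin a).

Lemma cisD a b : cis (a + b) = cis a * cis b.
Proof. by apply: eq_complexP; rewrite ?complexReM ?complexImM /= ?cosD ?sinD//; ring. Qed.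

Lemma cis0 : cis 0 = 1.
Proof. by apply: eq_complexP; rewrite /= ?cos0 ?sin0. Qed.

Lemma normc_cis a : normc (cis a) = 1.
Proof. by rewrite normc_sqrtE /= cos2Dsin2 sqrtr1. Qed.

(** The characters of the additive group of complex numbers; pairing through
    the real part of the product turns multiplication by a weight into
    multiplication of the frequency by the same weight. *)
Definition char t x : R[i] := cis (complex.Re (t * x)).

Lemma charDr t x y : char t (x + y) = char t x * char t y.
Proof. by rewrite /char mulrDr complexReD cisD. Qed.

Lemma charDl s t x : char (s + t) x = char s x * char t x.
Proof. by rewrite /char mulrDl complexReD cisD. Qed.

Lemma charM t s x : char t (s * x) = char (t * s) x.
Proof. by rewrite /char mulrA. Qed.

Lemma char0 x : char 0 x = 1.
Proof. by rewrite /char mul0r /= cis0. Qed.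

Lemma normc_char t x : normc (char t x) = 1.
Proof. exact: normc_cis. Qed.

Section measurability.
Context (d : measure_display) (S : measurableType d).
Implicit Types f g : S -> R[i].

Lemma measurable_Re : measurable_fun setT (@complex.Re R).
Proof.
rewrite [X in measurable_fun _ X](_ : _ = fst \o @pair_of_complex R)//.
by apply: measurableT_comp => //; exact: measurable_pair_of_complex.
Qed.

Lemma measurable_Im : measurable_fun setT (@complex.Im R).
Proof.
rewrite [X in measurable_fun _ X](_ : _ = snd \o @pair_of_complex R)//.
by apply: measurableT_comp => //; exact: measurable_pair_of_complex.
Qed.

Lemma measurable_fun_Re f : measurable_fun setT f ->
  measurable_fun setT (fun w => complex.Re (f w)).
Proof. by move=> mf; exact: (measurableT_comp measurable_Re mf). Qed.

Lemma measurable_fun_Im f : measurable_fun setT f ->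
  measurable_fun setT (fun w => complex.Im (f w)).
Proof. by move=> mf; exact: (measurableT_comp measurable_Im mf). Qed.

Lemma measurable_fun_complex (a b : S -> R) :
  measurable_fun setT a -> measurable_fun setT b ->
  measurable_fun setT (fun w => Complex (a w) (b w)).
Proof.
move=> ma mb.
rewrite [X in measurable_fun _ X](_ : _ =
  @complex_of_pair R \o (fun w => (a w, b w)))//.
apply: measurableT_comp; first exact: measurable_complex_of_pair.
exact: measurable_fun_pair.
Qed.

Lemma measurable_fun_ReIm f :
  measurable_fun setT (fun w => complex.Re (f w)) ->
  measurable_fun setT (fun w => complex.Im (f w)) -> measurable_fun setT f.
Proof.
move=> mr mi; rewrite [f](_ : _ = fun w => Complex (complex.Re (f w)) (complex.Im (f w))).
  exact: measurable_fun_complex.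
by apply/funext => w; case: (f w).
Qed.

Lemma measurable_complexD f g : measurable_fun setT f -> measurable_fun setT g ->
  measurable_fun setT (fun w => f w + g w).
Proof.
move=> mf mg; apply: measurable_fun_ReIm.
  under eq_fun do rewrite complexReD.
  by apply: measurable_funD; exact: measurable_fun_Re.
under eq_fun do rewrite complexImD.
by apply: measurable_funD; exact: measurable_fun_Im.
Qed.

Lemma measurable_complexM f g : measurable_fun setT f -> measurable_fun setT g ->
  measurable_fun setT (fun w => f w * g w).
Proof.
move=> mf mg; apply: measurable_fun_ReIm.
  under eq_fun do rewrite complexReM.
  by apply: measurable_funB; apply: measurable_funM;
    solve [exact: measurable_fun_Re|exact: measurable_fun_Im].
under eq_fun do rewrite complexImM.
by apply: measurable_funD; apply: measurable_funM;
  solve [exact: measurable_fun_Re|exact: measurable_fun_Im].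
Qed.

Lemma measurable_complex_sum (I : Type) (r : seq I) (p : pred I) (f : I -> S -> R[i]) :
  (forall i, measurable_fun setT (f i)) ->
  measurable_fun setT (fun w => \sum_(i <- r | p i) f i w).
Proof.
move=> mf; elim: r => [|i r IH].
  by under eq_fun do rewrite big_nil; exact: measurable_cst.
under eq_fun do rewrite big_cons.
by case: (p i) => //; exact: measurable_complexD.
Qed.

Lemma measurable_normc f : measurable_fun setT f ->
  measurable_fun setT (fun w => normc (f w)).
Proof.
move=> mf; under eq_fun do rewrite normc_sqrtE.
apply: measurableT_comp; first by apply: continuous_measurable_fun; exact: sqrt_continuous.
apply: measurable_funD; apply: measurable_funX;
  solve [exact: measurable_fun_Re|exact: measurable_fun_Im].
Qed.

Lemma measurable_char f g : measurable_fun setT f -> measurable_fun setT g ->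
  measurable_fun setT (fun w => char (f w) (g w)).
Proof.
move=> mf mg; have mfg := measurable_fun_Re (measurable_complexM mf mg).
apply: measurable_fun_complex.
  exact: (bounded_mf_cos mfg).1.
exact: (bounded_mf_sin mfg).1.
Qed.

Definition bounded_cmf f : Prop :=
  measurable_fun setT f /\ exists M, forall w, normc (f w) <= M.

Lemma bounded_cmf_Re f : bounded_cmf f -> bounded_mf (fun w => complex.Re (f w)).
Proof.
move=> [mf [M fM]]; split; first exact: measurable_fun_Re.
by exists M => w; rewrite (le_trans (normr_Re_le _)).
Qed.

Lemma bounded_cmf_Im f : bounded_cmf f -> bounded_mf (fun w => complex.Im (f w)).
Proof.
move=> [mf [M fM]]; split; first exact: measurable_fun_Im.
by exists M => w; rewrite (le_trans (normr_Im_le _)).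
Qed.

Lemma bounded_cmf_normc f : bounded_cmf f -> bounded_mf (fun w => normc (f w)).
Proof.
move=> [mf [M fM]]; split; first exact: measurable_normc.
by exists M => w; rewrite ger0_norm// normc_ge0.
Qed.

Lemma bounded_cmf_cst c : bounded_cmf (fun _ => c).
Proof. by split=> //; exists (normc c). Qed.

Lemma bounded_cmf_real (a : S -> R) : bounded_mf a ->
  bounded_cmf (fun w => Complex (a w) 0).
Proof.
move=> [ma [M aM]]; split; first exact: measurable_fun_complex.
by exists M => w; rewrite normc_real.
Qed.

Lemma bounded_cmfD f g : bounded_cmf f -> bounded_cmf g ->
  bounded_cmf (fun w => f w + g w).
Proof.
move=> [mf [M fM]] [mg [L gL]]; split; first exact: measurable_complexD.
by exists (M + L) => w; rewrite (le_trans (normcD _ _))// lerD.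
Qed.

Lemma bounded_cmfM f g : bounded_cmf f -> bounded_cmf g ->
  bounded_cmf (fun w => f w * g w).
Proof.
move=> [mf [M fM]] [mg [L gL]]; split; first exact: measurable_complexM.
by exists (M * L) => w; rewrite normcM ler_pM// normc_ge0.
Qed.

Lemma bounded_cmf_char f g : measurable_fun setT f -> measurable_fun setT g ->
  bounded_cmf (fun w => char (f w) (g w)).
Proof.
by move=> mf mg; split; [exact: measurable_char|exists 1 => w; rewrite normc_char].
Qed.

End measurability.

Definition cEx (d : measure_display) (S : measurableType d)
    (P : probability S R) (f : S -> R[i]) : R[i] :=
  Complex (Ex P (fun w => complex.Re (f w))) (Ex P (fun w => complex.Im (f w))).

Section complex_expectation.
Context (d : measure_display) (S : measurableType d) (P : probability S R).
Implicit Types f g : S -> R[i].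

Lemma eq_cEx f g : f =1 g -> cEx P f = cEx P g.
Proof. by move=> /funext ->. Qed.

Lemma ae_eq_cEx f g : bounded_cmf f -> bounded_cmf g ->
  {ae P, forall w, f w = g w} -> cEx P f = cEx P g.
Proof.
move=> bf bg fg; apply: eq_complexP; apply: ae_eq_Ex;
  (try exact: bounded_cmf_Re); (try exact: bounded_cmf_Im);
  by apply: filterS fg => w ->.
Qed.

Lemma cExD f g : bounded_cmf f -> bounded_cmf g ->
  cEx P (fun w => f w + g w) = cEx P f + cEx P g.
Proof.
move=> bf bg; apply: eq_complexP; rewrite ?complexReD ?complexImD /= -ExD;
  (try exact: bounded_cmf_Re); (try exact: bounded_cmf_Im);
  by apply: eq_Ex => w; rewrite ?complexReD ?complexImD.
Qed.

Lemma cExZ c f : bounded_cmf f -> cEx P (fun w => c * f w) = c * cEx P f.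
Proof.
move=> bf; have br := bounded_cmf_Re bf; have bi := bounded_cmf_Im bf.
apply: eq_complexP; rewrite ?complexReM ?complexImM /=.
  rewrite -!ExZ// -ExB; [|apply: bounded_mfM => //; exact: bounded_mf_cst..].
  by apply: eq_Ex => w; rewrite complexReM.
rewrite -!ExZ// -ExD; [|apply: bounded_mfM => //; exact: bounded_mf_cst..].
by apply: eq_Ex => w; rewrite complexImM.
Qed.

Lemma cEx_cst c : cEx P (fun _ => c) = c.
Proof. by apply: eq_complexP; rewrite /= Ex_cst. Qed.

Lemma cEx_real (a : S -> R) : cEx P (fun w => Complex (a w) 0) = Complex (Ex P a) 0.
Proof. by rewrite /cEx /= Ex_cst. Qed.

(** The square of the modulus of [z = cEx P f] is the expectation of the real
    inner product of [z] and [f], which Cauchy-Schwarz bounds pointwise. *)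
Lemma normc_cEx f : bounded_cmf f ->
  normc (cEx P f) <= Ex P (fun w => normc (f w)).
Proof.
move=> bf; have br := bounded_cmf_Re bf; have bi := bounded_cmf_Im bf.
set z := cEx P f; have [->|z0] := eqVneq z 0.
  by rewrite normc0; apply: Ex_ge0 => w; exact: normc_ge0.
have zp : 0 < normc z by rewrite lt_def normc_ge0 normc_eq0 z0.
rewrite -(ler_pM2l zp) -expr2 normc_sqr !expr2 -(ExZ P (normc z)); last exact: bounded_cmf_normc.
rewrite -[X in X * _]/(complex.Re z) -[X in _ * X + _]/(Ex P _) -[X in _ + _ * X]/(Ex P _).
rewrite -(ExZ P (complex.Re z))// -(ExZ P (complex.Im z))// -ExD; [|apply: bounded_mfM => //; exact: bounded_mf_cst..].
apply: le_Ex.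
- by apply: bounded_mfD; apply: bounded_mfM => //; exact: bounded_mf_cst.
- by apply: bounded_mfM; [exact: bounded_mf_cst|exact: bounded_cmf_normc].
- by move=> w; exact: normc_inner_le.
Qed.

End complex_expectation.

End complex_random_variables.

(** * Independence *)

Section freezing.
Context (R : realType) (d d1 d2 : measure_display) (S : measurableType d)
  (S1 : measurableType d1) (S2 : measurableType d2).

Section product_of_probabilities.
Variables (m1 : probability S1 R) (m2 : probability S2 R) (F : S1 * S2 -> R).
Hypothesis bF : bounded_mf F.

Lemma bounded_mf_section u : bounded_mf (fun v => F (u, v)).
Proof. by apply: bounded_mf_comp bF => //; exact: measurable_pair1. Qed.

Lemma bounded_mf_integrable_prod : (m1 \x m2)%E.-integrable setT (EFin \o F).
Proof.
have [mF [M FM]] := bF.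
have mass1 : (m1 \x m2)%E setT = 1%E.
  rewrite -setXTT product_measure1E//.
  by rewrite [X in (X * _)%E]probability_setT [X in (_ * X)%E]probability_setT mul1e.
apply: measurable_bounded_integrable => //.
  by apply: (@le_lt_trans _ _ 1%E); [rewrite -mass1|rewrite ltry].
exists M; split; first exact: num_real.
by move=> x Mx y _ /=; rewrite (le_trans (FM y))// ltW.
Qed.

Lemma bounded_mf_Ex_section : bounded_mf (fun u => Ex m2 (fun v => F (u, v))).
Proof.
have [mF [M FM]] := bF.
split; last first.
  exists M => u; rewrite (le_trans (le_normr_Rintegral _
    (bounded_mf_integrable _ (bounded_mf_section u))))//.
  rewrite -[leRHS](Ex_cst m2) le_Ex//; last exact: bounded_mf_cst.
  exact/bounded_mf_norm/bounded_mf_section.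
exact: (measurableT_comp _ (measurable_fubini_F bounded_mf_integrable_prod)).
Qed.

Lemma Ex_product : (\int[m1 \x m2]_z (F z)%:E)%E =
  (Ex m1 (fun u => Ex m2 (fun v => F (u, v))))%:E.
Proof.
rewrite -(integral12_prod_meas1 bounded_mf_integrable_prod).
rewrite EFin_Ex; last exact: bounded_mf_Ex_section.
apply: eq_integral => u _; rewrite /fubini_F EFin_Ex//; exact: bounded_mf_section.
Qed.

End product_of_probabilities.

Variables (P : probability S R) (m2 : probability S2 R).
Variables (U : S -> S1) (V : S -> S2).
Hypotheses (mU : measurable_fun setT U) (mV : measurable_fun setT V).

(** Both sides integrate [F] against the joint law of [U] and [V], which
    independence identifies with the product of the marginals. *)
Lemma Ex_freeze (F : S1 * S2 -> R) :
  (forall A B, measurable A -> measurable B ->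
    P (U @^-1` A `&` V @^-1` B) = (P (U @^-1` A) * m2 B)%E) ->
  bounded_mf F ->
  Ex P (fun w => F (U w, V w)) = Ex P (fun w => Ex m2 (fun v => F (U w, v))).
Proof.
move=> indepUV bF.
pose UV w := (U w, V w).
have mUV : measurable_fun setT UV by exact: measurable_fun_pair.
pose U' : {mfun S >-> S1} := HB.pack_for {mfun S >-> S1} U (isMeasurableFun.Build _ _ _ _ U mU).
pose UV' : {mfun S >-> (S1 * S2)%type} :=
  HB.pack_for {mfun S >-> (S1 * S2)%type} UV (isMeasurableFun.Build _ _ _ _ UV mUV).
pose m1 : probability S1 R := distribution P U'.
have E12 : forall X, measurable X -> (m1 \x m2)%E X = distribution P UV' X.
  apply: product_measure_unique => A B mA mB.
  by rewrite -indepUV.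
have bG := bounded_mf_Ex_section m1 m2 bF.
apply: EFin_inj.
transitivity ((\int[distribution P UV']_z (F z)%:E)%E).
  rewrite integral_distribution /=.
  - rewrite EFin_Ex//; exact: (bounded_mf_comp mUV bF).
  - by apply/measurable_EFinP; case: bF.
  - exact: (bounded_mf_integrable _ (bounded_mf_comp mUV bF)).
rewrite -(eq_measure_integral _ (fun A mA _ => E12 A mA)) (Ex_product m1 m2 bF).
rewrite EFin_Ex// integral_distribution /=.
- by rewrite EFin_Ex//; exact: (bounded_mf_comp mU bG).
- by apply/measurable_EFinP; case: bG.
- exact: (bounded_mf_integrable _ (bounded_mf_comp mU bG)).
Qed.

Lemma cEx_freeze (F : S1 * S2 -> R[i]) :
  (forall A B, measurable A -> measurable B ->
    P (U @^-1` A `&` V @^-1` B) = (P (U @^-1` A) * m2 B)%E) ->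
  bounded_cmf F ->
  cEx P (fun w => F (U w, V w)) = cEx P (fun w => cEx m2 (fun v => F (U w, v))).
Proof.
move=> indepUV bF; apply: eq_complexP => /=.
  exact: (Ex_freeze indepUV (bounded_cmf_Re bF)).
exact: (Ex_freeze indepUV (bounded_cmf_Im bF)).
Qed.

End freezing.

(** * Reweighting a law *)

Section density.
Context (R : realType) (d : measure_display) (S : measurableType d).

(** By uniqueness of the Radon-Nikodym derivative, [h] agrees almost everywhere
    with the derivative for which the change of variables is known. *)
Lemma integral_density (nu : {finite_measure set S -> \bar R})
    (m : probability S R) (h f : S -> R) : bounded_mf h ->
  (forall A, measurable A -> nu A = (\int[m]_(x in A) (h x)%:E)%E) ->
  bounded_mf f ->
  (\int[nu]_x (f x)%:E)%E = (Ex m (fun x => f x * h x))%:E.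
Proof.
move=> bh nuE bf.
have num : nu `<< m.
  apply/null_content_dominatesP => A mA mA0.
  by rewrite nuE// null_set_integral//; apply/measurable_EFinP/measurable_funTS; case: bh.
have dh : ae_eq m setT (EFin \o h) (Radon_Nikodym (charge_of_finite_measure nu) m).
  apply: integral_ae_eq => //; first exact: bounded_mf_integrable.
  move=> A _ mA; rewrite -nuE// -Radon_Nikodym_integral//.
have fint : nu.-integrable setT (EFin \o f).
  have [mf [M fM]] := bf.
  apply: measurable_bounded_integrable => //.
    by rewrite ltey_eq fin_num_measure.
  exists M; split; first exact: num_real.
  by move=> x Mx y _ /=; rewrite (le_trans (fM y))// ltW.
rewrite -(Radon_Nikodym_change_of_variables num measurableT fint) EFin_Ex; last first.
  exact: bounded_mfM.
apply: ae_eq_integral => //.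
- by apply: emeasurable_funM => //; apply/measurable_EFinP; case: bf.
- by apply/measurable_EFinP; case: (bounded_mfM bf bh).
- by apply: filterS dh => x /(_ I) <- _ /=; rewrite EFinM.
Qed.

End density.

Section reweighting.
Context (R : realType) (d : measure_display) (S : measurableType d).
Variables (P : probability S R) (w : S -> R).
Hypotheses (bw : bounded_mf w) (w0 : forall x, 0 <= w x).

Definition weighted (A : set S) : \bar R := (\int[P]_(x in A) (w x)%:E)%E.

Let weighted0 : weighted set0 = 0%E.
Proof. exact: integral_set0. Qed.

Let weighted_ge0 A : (0 <= weighted A)%E.
Proof. by apply: integral_ge0 => x _; rewrite lee_fin. Qed.

Let weighted_sigma_additive : semi_sigma_additive weighted.
Proof.
move=> F mF tF mUF; rewrite /weighted integral_bigcup//; last first.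
  by apply: (integrableS measurableT) => //; exact: bounded_mf_integrable.
by apply: is_cvg_ereal_nneg_natsum => n _; exact: weighted_ge0.
Qed.

HB.instance Definition _ := isMeasure.Build _ _ _ weighted
  weighted0 weighted_ge0 weighted_sigma_additive.

Let weighted_fin : fin_num_fun weighted.
Proof.
move=> A mA; apply: integrable_fin_num => //.
by apply: (integrableS measurableT) => //; exact: bounded_mf_integrable.
Qed.

HB.instance Definition _ := Measure_isFinite.Build _ _ _ weighted weighted_fin.


Lemma integral_weighted (f : S -> R) : bounded_mf f ->
  (\int[weighted]_x (f x)%:E)%E = (Ex P (fun x => f x * w x))%:E.
Proof. exact: integral_density. Qed.

Context (d' : measure_display) (S' : measurableType d').
Variables (Y : S -> S') (mY : measurable_fun setT Y).

Definition weighted_law (A : set S') : \bar R := weighted (Y @^-1` A).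

Let weighted_law0 : weighted_law set0 = 0%E.
Proof. by rewrite /weighted_law preimage_set0 measure0. Qed.

Let weighted_law_ge0 A : (0 <= weighted_law A)%E.
Proof. exact: measure_ge0. Qed.

Let weighted_law_sigma_additive : semi_sigma_additive weighted_law.
Proof.
move=> F mF tF mUF; rewrite /weighted_law preimage_bigcup.
apply: measure_semi_sigma_additive.
- by move=> n; rewrite -[X in measurable X]setTI; exact: mY.
- apply/trivIsetP => /= i j _ _ ij; rewrite -preimage_setI.
  by move/trivIsetP : tF => ->//; rewrite preimage_set0.
- by rewrite -preimage_bigcup -[X in measurable X]setTI; exact: mY.
Qed.

HB.instance Definition _ := isMeasure.Build _ _ _ weighted_law
  weighted_law0 weighted_law_ge0 weighted_law_sigma_additive.

Let weighted_law_fin : fin_num_fun weighted_law.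
Proof.
by move=> A mA; apply: fin_num_measure; rewrite -[X in measurable X]setTI; exact: mY.
Qed.

HB.instance Definition _ := Measure_isFinite.Build _ _ _ weighted_law weighted_law_fin.

Lemma integral_weighted_law (f : S' -> R) : bounded_mf f ->
  (\int[weighted_law]_x (f x)%:E)%E = (Ex P (fun x => f (Y x) * w x))%:E.
Proof.
move=> bf; rewrite -integral_weighted; last exact: bounded_mf_comp bf.
have := @integral_pushforward _ _ S S' R Y mY weighted setT (EFin \o f).
rewrite preimage_setT; apply => //.
- by apply/measurable_EFinP; case: bf.
- have [mf [M fM]] := bounded_mf_comp mY bf.
  apply: measurable_bounded_integrable => //.
    by rewrite ltey_eq fin_num_measure.
  exists M; split; first exact: num_real.
  by move=> x Mx y _ /=; rewrite (le_trans (fM y))// ltW.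
Qed.

(** Reweighting [P] by [w] before taking the law of [Y] gives a measure below
    [m]; its Radon-Nikodym density, truncated to the unit interval, is [h]. So a
    weight on histories becomes a weight on the state space, and the fixed point
    equation can be iterated on weights of the state space. *)
Lemma weight_conditioning (m : probability S' R) :
  (forall x, w x <= 1) ->
  (forall A, measurable A -> P (Y @^-1` A) = m A) ->
  exists h : S' -> R, [/\ measurable_fun setT h, forall x, 0 <= h x <= 1 &
    forall f, bounded_mf f -> Ex P (fun x => f (Y x) * w x) = Ex m (fun x => f x * h x)].
Proof.
move=> w1 lawY.
have mYA A : measurable A -> measurable (Y @^-1` A).
  by move=> mA; rewrite -[X in measurable X]setTI; exact: mY.
have num : weighted_law `<< m.
  apply/null_content_dominatesP => A mA mA0.
  rewrite /weighted_law /weighted null_set_integral//; first exact: mYA.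
    by apply/measurable_EFinP/measurable_funTS; case: bw.
  exact: etrans (lawY _ mA) mA0.
have [g [g0 gfin gint gE]] := radon_nikodym_sigma_finite num.
have mg : measurable_fun setT g by case/integrableP: gint.
pose h x := Num.min 1 (fine (g x)).
have mh : measurable_fun setT h.
  apply: measurable_minr; first exact: measurable_cst.
  by apply: measurableT_comp mg; exact: fine_measurable.
have h01 x : 0 <= h x <= 1.
  by rewrite /h ge_min lexx /= le_min ler01 /= andbT fine_ge0.
have bh : bounded_mf h.
  split=> //; exists 1 => x; have /andP[? ?] := h01 x; by rewrite ger0_norm.
(* Truncating changes the density only on a null set: [w <= 1] forces the
     excess of the density over 1 to have zero integral. *)
have gh : ae_eq m setT g (EFin \o h).
  pose A := [set x | (1 < g x)%E].
  have mA : measurable A by rewrite -[A]setTI; exact: emeasurable_fun_o_infty.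
  have Age : (\int[m]_(x in A) (g x - 1) = 0)%E.
    apply/eqP; rewrite eq_le; apply/andP; split; last first.
      by apply: integral_ge0 => x /ltW; rewrite sube_ge0 ?gfin.
    rewrite integralB//; [|exact: integrableS gint|]; last first.
      by apply: finite_measure_integrable_cst.
    rewrite -gE// integral_cst// mul1e sube_le0 ?fin_num_measure//.
    apply: (@le_trans _ _ (\int[P]_(x in Y @^-1` A) 1)%E); last first.
      rewrite integral_cst ?mul1e; last exact: mYA.
      by rewrite le_eqVlt; apply/orP; left; apply/eqP; exact: lawY.
    rewrite /weighted_law /weighted.
    apply: ge0_le_integral => //; first exact: mYA.
    - by move=> x _; rewrite lee_fin.
    - by apply/measurable_EFinP/measurable_funTS; case: bw.
    - by move=> x _; rewrite lee_fin.
  have : (\int[m]_(x in A) `|g x - 1| = 0)%E.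
    rewrite -[RHS]Age; apply: eq_integral => x; rewrite inE => /ltW Ax.
    by rewrite gee0_abs// sube_ge0 ?gfin.
  move/ae_eq_integral_abs => /(_ mA).
  have mg1 : measurable_fun A (fun x => g x - 1)%E.
    by apply: emeasurable_funB => //; exact: measurable_funTS.
  move=> /(_ mg1); apply: filterS => x Ax _ /=.
  have [gx|] := leP (g x) 1%E.
    by rewrite /h min_r ?fineK ?gfin// -lee_fin fineK ?gfin.
  move=> gx; have := Ax gx; have := gfin x; case: (g x) gx => //= r.
  rewrite lte_fin -EFinB => r1 _ [] /eqP; rewrite subr_eq0 => /eqP r1'.
  by rewrite r1' ltxx in r1.
exists h; split=> // f bf.
apply: EFin_inj; rewrite -integral_weighted_law//.
apply: integral_density => // A mA.
rewrite gE//; apply: ae_eq_integral => //.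
- exact: measurable_funTS.
- by apply/measurable_EFinP; apply: measurable_funTS.
- by apply: filterS gh => x /(_ I) + _.
Qed.

End reweighting.

(** * Fourier transforms of weighted laws *)

Section fourier.
Context (R : realType) (mu : probability R[i] R).

(** Fourier transform of the measure with density [h] with respect to [mu]. *)
Definition ft (h : R[i] -> R) (t : R[i]) : R[i] :=
  cEx mu (fun x => Complex (h x) 0 * char t x).

Lemma bounded_cmf_ft_integrand h t : bounded_mf h ->
  @bounded_cmf R _ _ (fun x => Complex (h x) 0 * char t x).
Proof.
by move=> bh; apply: bounded_cmfM; [exact: bounded_cmf_real|exact: bounded_cmf_char].
Qed.

Lemma bounded_cmf_ft h : bounded_mf h -> bounded_cmf (ft h).
Proof.
move=> bh; pose F (p : R[i] * R[i]) : R[i] := Complex (h p.2) 0 * char p.1 p.2.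
have bF : bounded_cmf F.
  apply: bounded_cmfM; last by apply: bounded_cmf_char; [exact: measurable_fst|exact: measurable_snd].
  by apply: bounded_cmf_real; apply: bounded_mf_comp bh; exact: measurable_snd.
split.
  apply: measurable_fun_complex.
    exact: (bounded_mf_Ex_section mu mu (bounded_cmf_Re bF)).1.
  exact: (bounded_mf_Ex_section mu mu (bounded_cmf_Im bF)).1.
have [mh [M hM]] := bh; exists M => t.
apply: (le_trans (normc_cEx _ (bounded_cmf_ft_integrand _ bh))).
rewrite -[leRHS](Ex_cst mu) le_Ex//.
- exact/bounded_cmf_normc/bounded_cmf_ft_integrand.
- exact: bounded_mf_cst.
- by move=> x; rewrite normcM normc_char mulr1 normc_real.
Qed.

Lemma normc_ft_le h t : bounded_mf h -> (forall x, 0 <= h x) ->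
  normc (ft h t) <= Ex mu h.
Proof.
move=> bh h0; apply: (le_trans (normc_cEx _ (bounded_cmf_ft_integrand t bh))).
apply: le_Ex => //; first exact/bounded_cmf_normc/bounded_cmf_ft_integrand.
by move=> x; rewrite normcM normc_char mulr1 normc_real ger0_norm.
Qed.

Lemma ft0 h : ft h 0 = Complex (Ex mu h) 0.
Proof. by rewrite -cEx_real; apply: eq_cEx => x; rewrite char0 mulr1. Qed.

End fourier.

Lemma le_Ex_ae (R : realType) (d : measure_display) (S : measurableType d)
    (P : probability S R) (f g : S -> R) : bounded_mf f -> bounded_mf g ->
  {ae P, forall x, f x <= g x} -> Ex P f <= Ex P g.
Proof.
move=> bf bg fg; have [mf [M fM]] := bf; have [mg [L gL]] := bg.
have bm : bounded_mf (fun x => Num.min (f x) (g x)).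
  split; first exact: measurable_minr.
  exists (Num.max M L) => x; rewrite le_max.
  by rewrite /Num.min; case: ifP => _; rewrite ?fM ?gL ?orbT.
rewrite (@ae_eq_Ex _ _ _ _ _ (fun x => Num.min (f x) (g x)))//.
  by apply: le_Ex => // x; rewrite ge_min lexx orbT.
by apply: filterS fg => x fx; rewrite min_l.
Qed.

Lemma vanishing_tail (R : realType) (d : measure_display) (S : measurableType d)
    (P : probability S R) (F : nat -> set S) (e : R) :
  (forall n, measurable (F n)) -> (forall n m, (n <= m)%N -> F m `<=` F n) ->
  \bigcap_n F n = set0 -> 0 < e -> exists n, fine (P (F n)) <= e.
Proof.
move=> mF Fdec F0 e0.
have := @nonincreasing_cvg_mu _ _ _ P F; rewrite F0 measure0.
move=> /(_ _ mF measurable0).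
have -> : (P (F 0%N) < +oo)%E by rewrite ltey_eq fin_num_measure.
move=> /(_ isT); have Fdec' : {homo F : n m / (n <= m)%N >-> (m <= n)%O}.
  by move=> n m nm; apply/subsetPset; exact: Fdec.
move=> /(_ Fdec') /fine_cvgP[_ /cvgrPdist_le /(_ _ e0)[n _ /(_ n (leqnn n))]].
rewrite /= sub0r normrN => Pn; exists n.
by rewrite (le_trans _ Pn)// ler_norm.
Qed.

(** [Y] is a random sum over the indices below [N], reached almost surely by its
    partial sums; these involve finitely many weights and copies only. *)
Section branching.
Context (R : realType) (d : measure_display) (Omega : measurableType d).
Variables (P : probability Omega R) (mu : probability R[i] R).
Variables (T X : nat -> Omega -> R[i]) (Y : Omega -> R[i]) (N : Omega -> nat).
Hypotheses (mT : forall k, measurable_fun setT (T k))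
  (mX : forall k, measurable_fun setT (X k)) (mY : measurable_fun setT Y).
Hypothesis mN : forall n, measurable [set w | (n < N w)%N].
Hypothesis YE : {ae P, forall w, forall n, (N w <= n)%N ->
  Y w = \sum_(k < n) T k w * X k w}.

(** The events from which the copy of index [j] has to be independent so that it
    can be integrated out first: they may involve all the other copies. *)
Definition others (j : nat) : set (set Omega) :=
  [set E | (exists k A, measurable A /\ E = T k @^-1` A) \/
    (exists k A, [/\ k != j, measurable A & E = X k @^-1` A])].

Hypothesis indepX : forall j E B, <<s others j >> E -> measurable B ->
  P (E `&` X j @^-1` B) = (P E * mu B)%E.

Section one_index.
Variable j : nat.
Let Oj : measurableType _ := g_sigma_algebraType (others j).

Lemma measurable_T_others k : measurable_fun setT (T k : Oj -> R[i]).
Proof.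
by move=> _ A mA; rewrite setTI; apply: sub_sigma_algebra; left; exists k, A.
Qed.

Lemma measurable_X_others k : k != j -> measurable_fun setT (X k : Oj -> R[i]).
Proof.
by move=> kj _ A mA; rewrite setTI; apply: sub_sigma_algebra; right; exists k, A.
Qed.

Lemma cEx_freeze_copy d1 (S1 : measurableType d1) (U : Omega -> S1)
    (F : S1 * R[i] -> R[i]) :
  measurable_fun setT U -> measurable_fun setT (U : Oj -> S1) ->
  bounded_cmf F ->
  cEx P (fun w => F (U w, X j w)) = cEx P (fun w => cEx mu (fun x => F (U w, x))).
Proof.
move=> mU mUj bF; apply: cEx_freeze => // A B mA mB; apply: indepX => //.
by have := mUj measurableT A mA; rewrite setTI.
Qed.

End one_index.

Definition partial_sum (n : nat) (w : Omega) : R[i] := \sum_(k < n) T k w * X k w.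

Section two_copies.
Variables (i j : nat) (ij : i != j).
Variables (g : R[i] * R[i] -> R) (h0 h1 : R[i] -> R).
Hypotheses (bg : bounded_mf g) (b0 : bounded_mf h0) (b1 : bounded_mf h1).

Let rest n w := \sum_(k < n | (val k != i) && (val k != j)) T k w * X k w.

Lemma partial_sum_split n w : (i < n)%N -> (j < n)%N ->
  partial_sum n w = T i w * X i w + T j w * X j w + rest n w.
Proof.
move=> ni nj; rewrite /partial_sum (bigD1 (Ordinal ni))//=.
rewrite (bigD1 (Ordinal nj))//=; last by rewrite -val_eqE /= eq_sym.
by rewrite addrA; congr (_ + _); apply: eq_bigl => k; rewrite -!val_eqE.
Qed.

Let measurable_rest n : measurable_fun setT (rest n).
Proof. by apply: measurable_complex_sum => k; exact: measurable_complexM. Qed.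

Let measurable_rest_others l n : l = i \/ l = j ->
  measurable_fun setT (rest n : g_sigma_algebraType (others l) -> R[i]).
Proof.
move=> lij; rewrite /rest.
have E w : \sum_(k < n | (val k != i) && (val k != j)) T k w * X k w =
    \sum_(k < n | (val k != i) && (val k != j)) (if val k == l then 0 else T k w * X k w).
  by apply: eq_bigr => k /andP[ki kj]; case: lij => ->; rewrite ?(negbTE ki) ?(negbTE kj).
under eq_fun do rewrite E; apply: measurable_complex_sum => k.
have [kl|kl] := eqVneq (val k) l; first exact: measurable_cst.
by apply: measurable_complexM; [exact: measurable_T_others|exact: measurable_X_others].
Qed.

Definition pair_weight (w : Omega) : R := g (T i w, T j w) * h0 (X i w) * h1 (X j w).

Lemma bounded_mf_pair_weight : bounded_mf pair_weight.
Proof.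
apply: bounded_mfM; last exact: bounded_mf_comp b1.
apply: bounded_mfM; last exact: bounded_mf_comp b0.
by apply: (bounded_mf_comp _ bg); exact: measurable_fun_pair.
Qed.

(** Given the weights and the other copies, the selected copies are independent
    and the character splits: freezing them one after the other leaves the product
    of their Fourier transforms, at frequencies multiplied by their weights. *)
Lemma cEx_partial_sum t n : (i < n)%N -> (j < n)%N ->
  cEx P (fun w => Complex (pair_weight w) 0 * char t (partial_sum n w)) =
  cEx P (fun w => Complex (g (T i w, T j w)) 0 * char t (rest n w) *
    ft mu h0 (t * T i w) * ft mu h1 (t * T j w)).
Proof.
move=> ni nj.
pose G (p : (R[i] * R[i]) * R[i]) : R[i] := Complex (g p.1) 0 * char t p.2.
have bG : bounded_cmf G.
  apply: bounded_cmfM; last by apply: bounded_cmf_char.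
  by apply/bounded_cmf_real/(bounded_mf_comp _ bg).
pose U w := ((T i w, T j w), rest n w).
pose F1 (p : (((R[i] * R[i]) * R[i]) * R[i]) * R[i]) : R[i] :=
  G p.1.1 * (Complex (h0 p.1.2) 0 * char (t * p.1.1.1.1) p.1.2) *
   (Complex (h1 p.2) 0 * char (t * p.1.1.1.2) p.2).
pose F2 (p : ((R[i] * R[i]) * R[i]) * R[i]) : R[i] :=
  G p.1 * ft mu h1 (t * p.1.1.2) * (Complex (h0 p.2) 0 * char (t * p.1.1.1) p.2).
have mU : measurable_fun setT U.
  by do 2?apply: measurable_fun_pair.
have mUi l : l = i \/ l = j ->
    measurable_fun setT (U : g_sigma_algebraType (others l) -> _).
  move=> lij; apply: measurable_fun_pair; last exact: measurable_rest_others.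
  by apply: measurable_fun_pair; exact: measurable_T_others.
have mfst1 : measurable_fun setT (fun p : ((R[i] * R[i]) * R[i]) * R[i] => p.1.1.1).
  exact: (measurableT_comp measurable_fst (measurableT_comp measurable_fst measurable_fst)).
have mfst2 : measurable_fun setT (fun p : ((R[i] * R[i]) * R[i]) * R[i] => p.1.1.2).
  exact: (measurableT_comp measurable_snd (measurableT_comp measurable_fst measurable_fst)).
have bF2 : bounded_cmf F2.
  apply: bounded_cmfM; first apply: bounded_cmfM.
  - have [mG [M GM]] := bG; split; last by exists M.
    exact: (measurableT_comp mG measurable_fst).
  - have [mf [M fM]] := bounded_cmf_ft mu b1; split; last by exists M => p.
    by apply: (measurableT_comp mf); exact: measurable_complexM.
  - apply: bounded_cmfM.
      by apply: bounded_cmf_real; exact: (bounded_mf_comp measurable_snd b0).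
    by apply: bounded_cmf_char; [exact: measurable_complexM|exact: measurable_snd].
have bF1 : bounded_cmf F1.
  apply: bounded_cmfM; first apply: bounded_cmfM.
  - have [mG [M GM]] := bG; split; last by exists M.
    exact: (measurableT_comp mG (measurableT_comp measurable_fst measurable_fst)).
  - apply: bounded_cmfM.
      apply: bounded_cmf_real; apply: (bounded_mf_comp _ b0).
      exact: (measurableT_comp measurable_snd measurable_fst).
    apply: bounded_cmf_char.
      by apply: measurable_complexM => //; exact: (measurableT_comp mfst1 measurable_fst).
    exact: (measurableT_comp measurable_snd measurable_fst).
  - apply: bounded_cmfM.
      by apply: bounded_cmf_real; exact: (bounded_mf_comp measurable_snd b1).
    apply: bounded_cmf_char; last exact: measurable_snd.
    by apply: measurable_complexM => //; exact: (measurableT_comp mfst2 measurable_fst).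
transitivity (cEx P (fun w => F1 ((U w, X i w), X j w))).
  apply: eq_cEx => w; rewrite partial_sum_split// !charDr !charM /F1 /G /U /=.
  rewrite /pair_weight.
  have C2 (a b : R) : Complex (a * b) 0 = Complex a 0 * Complex b 0.
    by apply: eq_complexP; rewrite ?complexReM ?complexImM /=; ring.
  by rewrite !C2; ring.
rewrite (@cEx_freeze_copy j _ _ (fun w => (U w, X i w)) F1)//; last 2 first.
- exact: measurable_fun_pair.
- by apply: measurable_fun_pair; [apply: mUi; right|exact: measurable_X_others].
transitivity (cEx P (fun w => F2 (U w, X i w))).
  apply: eq_cEx => w; rewrite /F1 /F2 /=.
  rewrite cExZ; last exact: bounded_cmf_ft_integrand.
  by rewrite -/(ft _ _ _); ring.
rewrite (@cEx_freeze_copy i _ _ U F2)//; last by apply: mUi; left.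
apply: eq_cEx => w; rewrite /F2 /=.
rewrite cExZ; last exact: bounded_cmf_ft_integrand.
by rewrite -/(ft _ _ _) /G /=; ring.
Qed.

(** The frequency 0 case of the preceding identity. *)
Lemma Ex_pair_weight :
  Ex P pair_weight = Ex P (fun w => g (T i w, T j w)) * Ex mu h0 * Ex mu h1.
Proof.
pose n := (maxn i j).+1.
have := @cEx_partial_sum 0 n; rewrite !ltnS leq_maxl leq_maxr => /(_ isT isT).
under eq_cEx do rewrite char0 mulr1.
rewrite cEx_real.
under [X in _ = X -> _]eq_cEx do rewrite char0 mulr1 !mul0r !ft0.
under [X in _ = X -> _]eq_cEx => w.
  rewrite (_ : _ * _ = Complex (Ex mu h0 * Ex mu h1 * g (T i w, T j w)) 0); last first.
    by apply: eq_complexP; rewrite ?complexReM ?complexImM /=; ring.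
  over.
rewrite cEx_real => -[->]; rewrite ExZ; first by ring.
by apply: (bounded_mf_comp _ bg); exact: measurable_fun_pair.
Qed.

(** The identity for partial sums passes to [Y], which differs from a partial sum
    on an event of small probability; the remaining copies contribute a factor of
    modulus at most 1. *)
Lemma cEx_pair_weight_le t :
  normc (cEx P (fun w => Complex (pair_weight w) 0 * char t (Y w))) <=
  Ex P (fun w => `|g (T i w, T j w)| * normc (ft mu h0 (t * T i w)) *
                 normc (ft mu h1 (t * T j w))).
Proof.
set B := (leRHS).
have bpw := bounded_mf_pair_weight; have [_ [M pwM]] := bpw.
have M0 : 0 <= M by rewrite (le_trans _ (pwM point)).
have mps n : measurable_fun setT (partial_sum n).
  by apply: measurable_complex_sum => k; exact: measurable_complexM.
pose f (V : Omega -> R[i]) w : R[i] := Complex (pair_weight w) 0 * char t (V w).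
have bf V : measurable_fun setT V -> bounded_cmf (f V).
  by move=> mV; apply: bounded_cmfM; [exact: bounded_cmf_real|exact: bounded_cmf_char].
have mg : bounded_mf (fun w => g (T i w, T j w)).
  by apply: (bounded_mf_comp _ bg); exact: measurable_fun_pair.
have partial n : (i < n)%N -> (j < n)%N -> normc (cEx P (f (partial_sum n))) <= B.
  move=> ni nj; rewrite /f cEx_partial_sum//.
  have bfti k h : bounded_mf h -> bounded_cmf (fun w => ft mu h (t * T k w)).
    move=> bh; have [mf [L fL]] := bounded_cmf_ft mu bh; split; last by exists L.
    by apply: (measurableT_comp mf); exact: measurable_complexM.
  have bI : bounded_cmf (fun w => Complex (g (T i w, T j w)) 0 * char t (rest n w) *
      ft mu h0 (t * T i w) * ft mu h1 (t * T j w) : R[i]).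
    apply: bounded_cmfM; last exact: bfti.
    apply: bounded_cmfM; last exact: bfti.
    by apply: bounded_cmfM; [exact: bounded_cmf_real|exact: bounded_cmf_char].
  apply: (le_trans (normc_cEx _ bI)); rewrite le_eqVlt; apply/orP; left; apply/eqP.
  by apply: eq_Ex => w; rewrite !normcM normc_char mulr1 normc_real.
apply/ler_addgt0Pr => e e0.
have e'0 : 0 < e / (2 * M + 1) by rewrite divr_gt0// ltr_wpDl// mulr_ge0.
have [n0 n0e] : exists n, fine (P [set w | (n < N w)%N]) <= e / (2 * M + 1).
  apply: (@vanishing_tail _ _ _ P (fun n => [set w | (n < N w)%N])) => //.
    by move=> n m nm w; exact: leq_ltn_trans.
  by rewrite -subset0 => w /(_ (N w) I); rewrite /= ltnn.
pose n := maxn n0 (maxn i j).+1.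
have bfn := bf _ (mps n); have bfY := bf _ mY.
have n0n : fine (P [set w | (n < N w)%N]) <= e / (2 * M + 1).
  apply: le_trans n0e; rewrite fine_le ?fin_num_measure//; [exact: mN..|].
  apply: le_measure; rewrite ?inE; [exact: mN..|].
  by move=> w; apply: leq_ltn_trans; rewrite leq_maxl.
have -> : cEx P (f Y) = cEx P (f (partial_sum n)) + cEx P (fun w => f Y w + - 1 * f (partial_sum n) w).
  rewrite cExD//; last by apply: bounded_cmfM => //; exact: bounded_cmf_cst.
  by rewrite cExZ//; ring.
apply: (le_trans (normcD _ _)); apply: lerD.
  by apply: partial; rewrite /n leq_max ltnS ?leq_maxl ?leq_maxr orbT.
have bd : bounded_cmf (fun w => f Y w + - 1 * f (partial_sum n) w).
  by apply: bounded_cmfD => //; apply: bounded_cmfM => //; exact: bounded_cmf_cst.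
apply: (le_trans (normc_cEx _ bd)).
apply: (@le_trans _ _ (Ex P (fun w => (2 * M) * \1_[set w | (n < N w)%N] w))); last first.
  rewrite ExZ; last exact/bounded_mf_indic/mN.
  rewrite Ex_indic; last exact: mN.
  apply: (@le_trans _ _ ((2 * M + 1) * fine (P [set w | (n < N w)%N]))).
    by rewrite ler_wpM2r ?fine_ge0// lerDl.
  by rewrite mulrC -ler_pdivlMr// ltr_wpDl// mulr_ge0.
apply: le_Ex_ae; first exact: bounded_cmf_normc.
  by apply: bounded_mfM; [exact: bounded_mf_cst|exact/bounded_mf_indic/mN].
apply: filterS YE => w Yw; rewrite indicE.
have [Nn|nN] := leqP (N w) n.
  rewrite memNset; last by apply/negP; rewrite -leqNgt.
  rewrite mulr0.
  rewrite /f (Yw n Nn) -/(partial_sum n w) [X in normc X](_ : _ = 0) ?normc0//.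
  by rewrite mulN1r; exact: subrr.
rewrite mem_set// mulr1 (le_trans (normcD _ _))// mulN1r.
rewrite [normc (- _)]normcN /f !normcM !normc_char !mulr1 normc_real.
by rewrite mulr_natl mulr2n lerD.
Qed.

End two_copies.
End branching.

(** * The modulus of the Fourier transform *)

Section trigonometric_bounds.
Context (R : realType).
Implicit Types a b u : R.

Lemma norm_sin_le u : `|sin u| <= `|u|.
Proof.
wlog u0 : u / 0 <= u => [hw|].
  have [/hw//|/ltW u0] := leP 0 u.
  by rewrite -(normrN (sin u)) -sinN -(normrN u) hw// oppr_ge0.
have dsin (x : R) : x \in `]0, u[ -> is_derive x 1 (sin : R -> R) (cos x).
  by move=> _; exact: is_derive_sin.
have csin : {within `[0, u], continuous (sin : R -> R)}.
  by apply: continuous_subspaceT; exact: continuous_sin.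
have [c _] := MVT_segment u0 dsin csin.
rewrite sin0 !subr0 => ->; rewrite normrM ler_piMl//.
by rewrite ler_norml cos_geN1 cos_le1.
Qed.

Lemma cos_half_sin u : cos u = 1 - 2 * sin (u / 2) ^+ 2.
Proof.
rewrite [in LHS](_ : u = (u / 2) *+ 2); last by rewrite -[RHS]mulr_natr; field.
rewrite cos_mulr2n mulr2n; have := cos2Dsin2 (u / 2); lra.
Qed.

Lemma cos_ge_quadratic u : 1 - u ^+ 2 / 2 <= cos u.
Proof.
rewrite cos_half_sin lerD2l lerN2.
have : sin (u / 2) ^+ 2 <= (u / 2) ^+ 2.
  by rewrite -[leLHS]real_normK ?num_real// -[leRHS]real_normK ?num_real// ler_sqr ?nnegrE// norm_sin_le.
by move=> /(ler_wpM2l (ler0n R 2)) /le_trans; apply; rewrite le_eqVlt; apply/orP; left; apply/eqP; field.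
Qed.

Lemma normc_cis_sub1 u : normc (cis u - 1) <= `|u|.
Proof.
rewrite -(@ler_pXn2r _ 2)// ?nnegrE ?normc_ge0// normc_sqr real_normK ?num_real//.
rewrite [X in X <= _](_ : _ = 2 - 2 * cos u); last first.
  rewrite /= oppr0 addr0; have := cos2Dsin2 u; set c := cos u; set s := sin u => h.
  by rewrite (_ : 2 - 2 * c = 1 + (c ^+ 2 + s ^+ 2) - 2 * c); [ring|rewrite h; ring].
have := cos_ge_quadratic u; lra.
Qed.

Lemma normc_cisB a b : normc (cis a - cis b) <= `|a - b|.
Proof.
rewrite (_ : cis a - cis b = cis b * (cis (a - b) - 1)).
  by rewrite normcM normc_cis mul1r normc_cis_sub1.
by rewrite mulrBr mulr1 -cisD [b + _]addrC subrK.
Qed.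

(** [1] is less than [pi], where the cosine is injective. *)
Lemma cos_eq1_small u : `|u| <= 1 -> cos u = 1 -> u = 0.
Proof.
wlog u0 : u / 0 <= u => [hw|].
  have [/hw//|/ltW u0] := leP 0 u.
  move=> u1 cu; apply/eqP; rewrite -oppr_eq0; apply/eqP.
  by apply: hw; rewrite ?oppr_ge0 ?normrN ?cosN.
rewrite ger0_norm// => u1 cu.
have pi1 : 1 <= pi :> R by apply: le_trans (pi_ge2 R); rewrite ler1n.
apply: cos_inj; rewrite ?cos0//= in_itv/=.
  by rewrite u0 (le_trans u1).
by rewrite lexx (le_trans ler01).
Qed.

End trigonometric_bounds.

Section fourier_modulus.
Context (R : realType) (mu : probability R[i] R).

Definition phi (t : R[i]) : R := normc (ft mu (fun _ => 1) t).

Lemma phi_ge0 t : 0 <= phi t.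
Proof. exact: normc_ge0. Qed.

Lemma phi_le1 t : phi t <= 1.
Proof.
apply: (le_trans (normc_ft_le _ _ (bounded_mf_cst _ _) _)) => //.
by rewrite Ex_cst.
Qed.

Lemma bounded_mf_phi : bounded_mf phi.
Proof. exact/bounded_cmf_normc/bounded_cmf_ft/bounded_mf_cst. Qed.

(** Tightness of [mu]: outside an event of small probability the characters are
    Lipschitz in the frequency. *)
Lemma phi_uniformly_continuous e : 0 < e -> exists2 del, 0 < del &
  forall s t, normc (s - t) <= del -> `|phi s - phi t| <= e.
Proof.
move=> e0; have e40 : 0 < e / 4 by rewrite divr_gt0.
pose F (n : nat) := [set x : R[i] | n%:R < normc x].
have mF n : measurable (F n).
  rewrite -[F n]setTI; have := measurable_normc (@measurable_id _ R[i] setT).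
  move=> /(_ measurableT _ (@measurable_itv R `]n%:R, +oo[)).
  by congr measurable; apply/seteqP; split => x /=; rewrite in_itv/= andbT.
have [n Fn] : exists n, fine (mu (F n)) <= e / 4.
  apply: vanishing_tail => //.
    by move=> n m nm x; apply: le_lt_trans; rewrite ler_nat.
  rewrite -subset0 => x /(_ (Num.bound (normc x)) I) /=.
  by rewrite /F /= ltNge ltW// archi_boundP ?normc_ge0.
exists (e / 2 / (n%:R + 1)); first by rewrite !divr_gt0// ltr_wpDl.
move=> s t st.
have bf u : bounded_cmf (fun x : R[i] => Complex (1 : R) 0 * char u x : R[i]).
  by apply: bounded_cmf_ft_integrand; exact: bounded_mf_cst.
apply: (@le_trans _ _ (normc (ft mu (fun=> 1) s - ft mu (fun=> 1) t))).
  have tri (a b : R[i]) : `|normc a - normc b| <= normc (a - b).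
    rewrite ler_distl; apply/andP; split; last first.
      by rewrite -[X in normc X <= _](subrK b) addrC normcD.
    by rewrite lerBlDr -[X in normc X <= _](subrK a) addrC (le_trans (normcD _ _))// [normc (b - a)]normc_distC.
  exact: tri.
have -> : ft mu (fun=> 1) s - ft mu (fun=> 1) t =
    cEx mu (fun x => Complex 1 0 * char s x + - 1 * (Complex 1 0 * char t x)).
  rewrite cExD; [|exact: bf|apply: bounded_cmfM; [exact: bounded_cmf_cst|exact: bf]].
  by rewrite (cExZ mu (- 1)); [rewrite mulN1r|exact: bf].
have bd : bounded_cmf (fun x : R[i] => Complex (1 : R) 0 * char s x + - 1 * (Complex 1 0 * char t x) : R[i]).
  by apply: bounded_cmfD; [|apply: bounded_cmfM; [exact: bounded_cmf_cst|]]; exact: bf.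
apply: (le_trans (normc_cEx _ bd)).
apply: (@le_trans _ _ (Ex mu (fun x => e / 2 + 2 * \1_(F n) x))); last first.
  rewrite ExD; [|exact: bounded_mf_cst|apply: bounded_mfM; [exact: bounded_mf_cst|exact: bounded_mf_indic]].
  rewrite Ex_cst ExZ ?Ex_indic//; last exact: bounded_mf_indic.
  move: Fn; lra.
apply: le_Ex; first exact: bounded_cmf_normc.
  apply: bounded_mfD; first exact: bounded_mf_cst.
  by apply: bounded_mfM; [exact: bounded_mf_cst|exact: bounded_mf_indic].
move=> x; rewrite (_ : Complex 1 0 * char s x + - 1 * (Complex 1 0 * char t x) = char s x - char t x); last first.
  by rewrite mulN1r [X in X * char s x](_ : _ = 1)// !mul1r.
rewrite indicE; have [xF|xF] := boolP (x \in F n).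
  rewrite mulr1 (le_trans (normcB _ _))// !normc_char; move: e0; lra.
rewrite mulr0 addr0 (le_trans (normc_cisB _ _))//.
have -> : complex.Re (s * x) - complex.Re (t * x) = complex.Re ((s - t) * x).
  by rewrite mulrBl complexReD; congr (_ + _); case: (t * x).
apply: (le_trans (normr_Re_le _)); rewrite normcM.
have xn : normc x <= n%:R by move: xF; rewrite notin_setE /F /= => /negP; rewrite -leNgt.
apply: (@le_trans _ _ (e / 2 / (n%:R + 1) * n%:R)).
  by rewrite ler_pM ?normc_ge0.
rewrite -mulrA ler_piMr ?divr_ge0 ?(ltW e0)// mulrC ler_pdivrMr ?ltr_wpDl// mul1r lerDl//.
Qed.

End fourier_modulus.

(** * The modulus is smaller than one away from the origin *)

(** The part of the fixed point equation on which the argument rests. Two children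
    suffice: they are more than one on average because the first weight never
    vanishes and the second one has a chance not to, and their weights have total
    moment of order [alpha] at most 1. *)
Record branching_model (R : realType) (d : measure_display)
    (Omega : measurableType d) (P : probability Omega R)
    (mu : probability R[i] R) (alpha : R) (T X : nat -> Omega -> R[i])
    (Y : Omega -> R[i]) (N : Omega -> nat) : Prop := BranchingModel {
  weights_measurable : forall k, measurable_fun setT (T k) ;
  copies_measurable : forall k, measurable_fun setT (X k) ;
  sum_measurable : measurable_fun setT Y ;
  length_measurable : forall n, measurable [set w | (n < N w)%N] ;
  sum_eventually : {ae P, forall w, forall n, (N w <= n)%N ->
    Y w = \sum_(k < n) T k w * X k w} ;
  copies_independent : forall j E B, <<s others T X j >> E -> measurable B ->
    P (E `&` X j @^-1` B) = (P E * mu B)%E ;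
  sum_law : forall A, measurable A -> P (Y @^-1` A) = mu A ;
  first_weight_neq0 : {ae P, forall w, T 0 w != 0} ;
  second_weight_neq0 : 0 < fine (P [set w | T 1 w != 0]) ;
  exponent_gt0 : 0 < alpha ;
  two_weights_moment :
    (\int[P]_w (normc (T 0 w) `^ alpha + normc (T 1 w) `^ alpha)%:E <= 1)%E ;
  weights_not_real : exists j, ~ {ae P, forall w, complex.Im (T j w) = 0} ;
  law_not_dirac : ~ exists c, {ae mu, forall x, x = c} }.

Section model.
Context (R : realType) (d : measure_display) (Omega : measurableType d).
Variables (P : probability Omega R) (mu : probability R[i] R) (alpha : R).
Variables (T X : nat -> Omega -> R[i]) (Y : Omega -> R[i]) (N : Omega -> nat).
Hypothesis M : branching_model P mu alpha T X Y N.

Let mT := weights_measurable M.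

Lemma Ex_sum_law (f : R[i] -> R) : bounded_mf f ->
  Ex P (fun w => f (Y w)) = Ex mu f.
Proof.
move=> bf; have mY := sum_measurable M.
pose Y' : {mfun Omega >-> R[i]} := HB.pack_for {mfun Omega >-> R[i]} Y (isMeasurableFun.Build _ _ _ _ Y mY).
apply: EFin_inj; rewrite !EFin_Ex//; last exact: bounded_mf_comp bf.
transitivity (\int[distribution P Y']_y (f y)%:E)%E; last first.
  by apply: eq_measure_integral => A mA _; exact: (sum_law M mA).
rewrite integral_distribution//; first by apply/measurable_EFinP; case: bf.
exact: (bounded_mf_integrable _ (bounded_mf_comp mY bf)).
Qed.

Lemma bounded_mf_phi_weight k t : bounded_mf (fun w => phi mu (t * T k w)).
Proof.
have [mf [K fK]] := bounded_mf_phi mu; split; last by exists K.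
by apply: (measurableT_comp mf); exact: measurable_complexM.
Qed.

(** All children but two are estimated trivially, by the modulus 1. *)
Lemma phi_smoothing i j t : i != j ->
  phi mu t <= Ex P (fun w => phi mu (t * T i w) * phi mu (t * T j w)).
Proof.
move=> ij; have b1 := @bounded_mf_cst R _ R[i] 1.
have b11 := @bounded_mf_cst R _ (R[i] * R[i])%type 1.
have [mTk mXk mY mN YE ind _ _ _ _ _ _ _] := M.
have := cEx_pair_weight_le mTk mXk mY mN YE ind ij b11 b1 b1 t.
rewrite /pair_weight; under [X in normc X <= _ -> _]eq_cEx do rewrite !mulr1.
under [X in _ <= X -> _]eq_Ex do rewrite normr1 mul1r.
have -> : cEx P (fun w => Complex 1 0 * char t (Y w)) = ft mu (fun=> 1) t; last by [].
have bc := bounded_cmf_ft_integrand t b1.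
apply: eq_complexP => /=.
  exact: (Ex_sum_law (bounded_cmf_Re bc)).
exact: (Ex_sum_law (bounded_cmf_Im bc)).
Qed.

(** At such a frequency the character is almost surely constant: the law is carried
    by a family of parallel lines. *)
Definition unimodular (t : R[i]) : Prop := phi mu t = 1.

(** Equality case of the triangle inequality: the real inner product of the
    character with its mean is at most 1 and has expectation 1. *)
Lemma unimodular_char t : unimodular t ->
  {ae mu, forall x, char t x = ft mu (fun=> 1) t}.
Proof.
rewrite /unimodular /phi; set c := ft mu _ t => c1.
have bc := bounded_cmf_ft_integrand t (@bounded_mf_cst R _ R[i] 1).
have cxE x : Complex (1 : R) 0 * char t x = char t x.
  by rewrite [X in X * _](_ : _ = 1)// mul1r.
have bch : bounded_cmf (char t) by apply: bounded_cmf_char.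
have cE : c = cEx mu (char t) by apply: eq_cEx => x; exact: cxE.
have c2 : complex.Re c ^+ 2 + complex.Im c ^+ 2 = 1 by rewrite -normc_sqr c1 expr1n.
pose f x := 1 - (complex.Re c * complex.Re (char t x) + complex.Im c * complex.Im (char t x)).
have br := bounded_cmf_Re bch; have bi := bounded_cmf_Im bch.
have brc : bounded_mf (fun x => complex.Re c * complex.Re (char t x)).
  by apply: bounded_mfM => //; exact: bounded_mf_cst.
have bic : bounded_mf (fun x => complex.Im c * complex.Im (char t x)).
  by apply: bounded_mfM => //; exact: bounded_mf_cst.
have bf : bounded_mf f.
  by apply: bounded_mfB; [exact: bounded_mf_cst|exact: bounded_mfD].
have f0 x : 0 <= f x.
  by rewrite subr_ge0 (le_trans (normc_inner_le _ _))// c1 normc_char mulr1.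
have Ef : Ex mu f = 0.
  rewrite ExB; [|exact: bounded_mf_cst|exact: bounded_mfD].
  rewrite ExD// Ex_cst !ExZ//.
  have -> : Ex mu (fun x => complex.Re (char t x)) = complex.Re c by rewrite cE.
  have -> : Ex mu (fun x => complex.Im (char t x)) = complex.Im c by rewrite cE.
  by rewrite -!expr2 c2 subrr.
apply: filterS (Ex_eq0_ae bf f0 Ef) => x /eqP; rewrite subr_eq0 => /eqP fx.
have e2 := normc_sqr (char t x); rewrite normc_char expr1n in e2.
apply: eq_complexP.
  apply/eqP; rewrite -subr_eq0 -sqrf_eq0; apply/eqP.
  by move: fx e2 c2; set a := complex.Re c; set b := complex.Im c;
    set a' := complex.Re _; set b' := complex.Im _; nra.
apply/eqP; rewrite -subr_eq0 -sqrf_eq0; apply/eqP.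
by move: fx e2 c2; set a := complex.Re c; set b := complex.Im c;
  set a' := complex.Re _; set b' := complex.Im _; nra.
Qed.

Lemma unimodularB s t : unimodular s -> unimodular t -> unimodular (s - t).
Proof.
move=> us ut; have cs := unimodular_char us; have ct := unimodular_char ut.
have bch u : bounded_cmf (char u : R[i] -> R[i]) by apply: bounded_cmf_char.
have cxE u x : Complex (1 : R) 0 * char u x = char u x.
  by rewrite [X in X * _](_ : _ = 1)// mul1r.
have ftE u : ft mu (fun=> 1) u = cEx mu (char u) by apply: eq_cEx => x; exact: cxE.
have : ft mu (fun=> 1) t * ft mu (fun=> 1) (s - t) = ft mu (fun=> 1) s.
  rewrite [X in _ * X]ftE -cExZ// -[RHS](cEx_cst mu).
  apply: ae_eq_cEx; [|exact: bounded_cmf_cst|].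
    by apply: bounded_cmfM => //; exact: bounded_cmf_cst.
  apply: filterS2 cs ct => x <- <-.
  by rewrite -charDl addrC subrK.
move/(congr1 (@normc R)); rewrite normcM -!/(phi mu _) us ut mul1r.
exact.
Qed.

Lemma unimodular0 : unimodular 0.
Proof. by rewrite /unimodular /phi ft0 Ex_cst normc_real normr1. Qed.

Lemma unimodularD s t : unimodular s -> unimodular t -> unimodular (s + t).
Proof.
move=> us ut; rewrite -[t]opprK -(sub0r t); apply: unimodularB => //.
by apply: unimodularB => //; exact: unimodular0.
Qed.

Lemma unimodularMz (k : int) t : unimodular t -> unimodular (Complex k%:~R 0 * t).
Proof.
move=> ut; have un (n : nat) : unimodular (Complex n%:R 0 * t).
  elim: n => [|n IHn]; first by rewrite [X in X * _](_ : _ = 0)// mul0r; exact: unimodular0.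
  rewrite (_ : Complex _ _ * t = Complex n%:R 0 * t + t); first exact: unimodularD.
  rewrite -[X in _ + X]mul1r -mulrDl; congr (_ * _).
  by apply: eq_complexP => /=; rewrite ?addr0// -natr1.
case: k => n; first exact: un.
rewrite NegzE (_ : Complex _ _ * t = 0 - Complex n.+1%:R 0 * t).
  by apply: unimodularB => //; exact: unimodular0.
rewrite sub0r -mulNr; congr (_ * _).
by apply: eq_complexP => /=; rewrite ?oppr0// mulrNz.
Qed.

Lemma unimodular_closed t :
  (forall e, 0 < e -> exists2 s, unimodular s & normc (s - t) <= e) -> unimodular t.
Proof.
move=> near; apply/eqP; rewrite eq_le phi_le1 /=; apply/ler_addgt0Pr => e e0.
have [del del0 delP] := phi_uniformly_continuous mu e0.
have [s us st] := near _ del0; have := delP _ _ st.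
by rewrite us ler_norml => /andP[_]; rewrite lerBlDr addrC.
Qed.

(** Equality in [phi t <= E (phi (t T_j))], whose right-hand side is at most 1. *)
Lemma unimodular_weight t : unimodular t ->
  {ae P, forall w, forall j, unimodular (t * T j w)}.
Proof.
move=> ut; apply: ae_foralln => j.
have [i ij] : exists i, j != i by exists j.+1; rewrite neq_ltn ltnSn.
have bj := bounded_mf_phi_weight j t; have bi := bounded_mf_phi_weight i t.
have bf : bounded_mf (fun w => 1 - phi mu (t * T j w)).
  by apply: bounded_mfB => //; exact: bounded_mf_cst.
have f0 w : 0 <= 1 - phi mu (t * T j w) by rewrite subr_ge0 phi_le1.
have Ef : Ex P (fun w => 1 - phi mu (t * T j w)) = 0.
  apply/eqP; rewrite eq_le Ex_ge0// andbT ExB//; last exact: bounded_mf_cst.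
  rewrite Ex_cst subr_le0 -{1}ut (le_trans (phi_smoothing t ij))//.
  apply: le_Ex => //; first exact: bounded_mfM.
  by move=> w; rewrite ler_piMr ?phi_ge0 ?phi_le1.
by apply: filterS (Ex_eq0_ae bf f0 Ef) => w /eqP; rewrite subr_eq0 => /eqP.
Qed.

End model.

Section strict_modulus.
Context (R : realType) (d : measure_display) (Omega : measurableType d).
Variables (P : probability Omega R) (mu : probability R[i] R) (alpha : R).
Variables (T X : nat -> Omega -> R[i]) (Y : Omega -> R[i]) (N : Omega -> nat).
Hypothesis M : branching_model P mu alpha T X Y N.

Let mT := weights_measurable M.
Let p := fine (P [set w | T 1 w != 0]).
Let p0 : 0 < p := second_weight_neq0 M.

Lemma measurable_weight_neq0 k : measurable [set w | T k w != 0].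
Proof.
have := measurable_normc (mT k); move=> /(_ measurableT _ (@measurable_itv R `]0, +oo[)).
congr measurable; apply/seteqP; split => w /=; rewrite in_itv/= andbT.
  by move=> [_]; rewrite lt_def normc_eq0 => /andP[].
by move=> Tw; split=> //; rewrite lt_def normc_eq0 Tw normc_ge0.
Qed.

(** If all nonzero weights exceeded [theta], the moment of order [alpha] of the
    first two would exceed [theta ^ alpha (1 + p)], where [p] is the probability
    that the second one is nonzero. Being at most 1, it forbids this for the
    [theta < 1] chosen here, for which the product is [1 + p / 2]. *)
Lemma some_weight_small : exists2 theta, 0 < theta < 1 &
  ~ {ae P, forall w, forall k, (k < 2)%N -> T k w != 0 -> theta < normc (T k w)}.
Proof.
have a0 := exponent_gt0 M.
pose x := (1 + p / 2) / (1 + p).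
have x0 : 0 < x by rewrite divr_gt0//; move: p0; lra.
have x1 : x < 1 by rewrite ltr_pdivrMr; move: p0; lra.
have xa : (x `^ alpha^-1) `^ alpha = x.
  by rewrite -powRrM mulVf ?gt_eqF// powRr1// ltW.
exists (x `^ alpha^-1).
  rewrite powR_gt0//= (_ : 1 = 1 `^ alpha^-1); last by rewrite powR1.
  by apply: gt0_ltr_powR; rewrite ?invr_gt0// nnegrE ltW.
set theta := x `^ _ => big.
have t0 : 0 <= theta by exact: powR_ge0.
have bI : bounded_mf (fun w => x + x * \1_[set w | T 1 w != 0] w).
  apply: bounded_mfD; first exact: bounded_mf_cst.
  by apply: bounded_mfM; [exact: bounded_mf_cst|exact/bounded_mf_indic/measurable_weight_neq0].
have mpow k : measurable_fun setT (fun w => normc (T k w) `^ alpha).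
  by apply: (measurableT_comp (measurable_powR _)); exact: measurable_normc.
have low : (\int[P]_w (x + x * \1_[set w | T 1 w != 0] w)%:E <= 1)%E.
  apply: le_trans (two_weights_moment M); apply: ae_ge0_le_integral => //.
  - move=> w _; rewrite lee_fin addr_ge0 ?(ltW x0)// mulr_ge0 ?(ltW x0)//.
  - by apply/measurable_EFinP; case: bI.
  - by move=> w _; rewrite lee_fin addr_ge0 ?powR_ge0.
  - by apply/measurable_EFinP; exact: measurable_funD.
  - apply: filterS2 big (first_weight_neq0 M) => w bw Tw0 _; rewrite lee_fin.
    have pw k : (k < 2)%N -> T k w != 0 -> x <= normc (T k w) `^ alpha.
      move=> k2 Tk; rewrite -xa; apply: ge0_ler_powR; rewrite ?nnegrE ?normc_ge0//.
        exact: ltW.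
      exact/ltW/bw.
    apply: lerD; first exact: pw.
    rewrite indicE; have [T1|T1] := boolP (w \in _).
      by rewrite mulr1 pw//; move: T1; rewrite inE.
    by rewrite mulr0 powR_ge0.
move: low; rewrite -EFin_Ex// lee_fin ExD; last 2 first.
- exact: bounded_mf_cst.
- by apply: bounded_mfM; [exact: bounded_mf_cst|exact/bounded_mf_indic/measurable_weight_neq0].
rewrite Ex_cst ExZ ?Ex_indic//; last 2 first.
- exact: measurable_weight_neq0.
- exact/bounded_mf_indic/measurable_weight_neq0.
rewrite -/p => le1.
have : x * (1 + p) = 1 + p / 2 by rewrite /x -mulrA mulVf ?mulr1// gt_eqF//; move: p0; lra.
move: le1 p0; lra.
Qed.

Local Notation unimodular := (unimodular mu).

(** Multiplication by a small nonzero weight preserves unimodularity and shrinks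
    the frequency by the factor [theta]; the step can be repeated. *)
Lemma unimodular_arbitrarily_small t : t != 0 -> unimodular t ->
  forall e, 0 < e -> exists s, [/\ s != 0, unimodular s & normc s <= e].
Proof.
move=> t0 ut; have [theta /andP[th0 th1] nbig] := some_weight_small.
have step s : s != 0 -> unimodular s ->
    exists s', [/\ s' != 0, unimodular s' & normc s' <= theta * normc s].
  move=> s0 us; apply: contrapT => nos; apply: nbig.
  apply: filterS (unimodular_weight M us) => w uw k _ Tk.
  rewrite ltNge; apply/negP => Tth; apply: nos; exists (s * T k w).
  split; [by rewrite mulf_neq0|exact: uw|].
  by rewrite normcM mulrC ler_wpM2r// normc_ge0.
have iter n : exists s, [/\ s != 0, unimodular s & normc s <= theta ^+ n * normc t].
  elim: n => [|n [s [s0 us sn]]]; first by exists t; rewrite expr0 mul1r.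
  have [s' [s'0 us' s'n]] := step _ s0 us; exists s'; split=> //.
  by rewrite (le_trans s'n)// exprS -mulrA ler_wpM2l// ltW.
move=> e e0; have nt : 0 < normc t by rewrite lt_def normc_eq0 t0 normc_ge0.
have [n _ /(_ n (leqnn n)) thn] : \forall n \near \oo, theta ^+ n <= e / normc t.
  have := @cvg_expr R theta; rewrite ger0_norm ?ltW// => /(_ th1).
  move=> /cvgrPdist_le /(_ _ (divr_gt0 e0 nt)); apply: filterS => n.
  by rewrite sub0r normrN; apply: le_trans; rewrite ler_norm.
have [s [s0 us sn]] := iter n; exists s; split=> //.
by rewrite (le_trans sn)// -ler_pdivlMr.
Qed.

(** If [tau] is a non-real value of a weight and [s] a small unimodular frequency,
    then [s] and [s tau] span a fine lattice of unimodular frequencies, whence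
    density. The small frequencies form a sequence, so that one history serves
    them all. *)
Lemma unimodular_everywhere t : t != 0 -> unimodular t -> forall z, unimodular z.
Proof.
move=> t0 ut; have small := unimodular_arbitrarily_small t0 ut.
have smalln (n : nat) : exists s, [/\ s != 0, unimodular s & normc s <= n.+1%:R^-1].
  by apply: small; rewrite invr_gt0.
have [s /all_and3[s0 us sn]] := choice smalln.
have [j njr] := weights_not_real M.
have [w Tw uw] : exists2 w, complex.Im (T j w) != 0 & forall n, unimodular (s n * T j w).
  apply: contrapT => no; apply: njr.
  have := ae_foralln (fun n => unimodular_weight M (us n)).
  apply: filterS => w uw; apply/eqP/negP => Tw; apply: no; exists w; first exact/negP.
  by move=> n; exact: uw.
set tau := T j w in Tw uw.
move=> z; apply: unimodular_closed => e e0.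
have [n ne] : exists n, n.+1%:R^-1 * (1 + normc tau) <= e.
  exists (Num.bound ((1 + normc tau) / e)).
  rewrite mulrC ler_pdivrMr// -ler_pdivrMl// mulrC ltW//.
  apply: (lt_le_trans (archi_boundP _)); last by rewrite ler_nat.
  by rewrite divr_ge0 ?addr_ge0 ?normc_ge0// ltW.
pose u : R[i] := z / s n.
pose b : R := complex.Im u / complex.Im tau.
pose a : R := complex.Re u - b * complex.Re tau.
have uE : u = Complex a 0 + Complex b 0 * tau.
  apply: eq_complexP.
    by rewrite complexReD [X in _ = _ + X]complexReM /= mul0r subr0 subrK.
  by rewrite complexImD [X in _ = _ + X]complexImM /= mul0r addr0 add0r divfK.
pose m1 := Num.floor a; pose m2 := Num.floor b.
exists (Complex m1%:~R 0 * s n + Complex m2%:~R 0 * (s n * tau)).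
  by apply: unimodularD; exact: unimodularMz.
have zE : z = u * s n by rewrite /u divfK.
rewrite normc_distC [X in normc X](_ : _ = s n * (Complex (a - m1%:~R) 0 + Complex (b - m2%:~R) 0 * tau)); last first.
  rewrite [in LHS]zE uE.
  have CB (x y : R) : Complex (x - y) 0 = Complex x 0 - Complex y 0 :> R[i].
    by apply: eq_complexP => /=; rewrite ?subrr.
  by rewrite !CB; ring.
rewrite normcM; apply: le_trans ne; apply: ler_pM; rewrite ?normc_ge0 ?sn//.
apply: (le_trans (normcD _ _)); rewrite normcM !normc_real.
have frac x : `|x - (Num.floor x)%:~R| <= 1 :> R.
  have /andP[fx xf] := floor_itv x; rewrite ger0_norm ?subr_ge0//.
  by rewrite lerBlDr addrC ltW// (lt_le_trans xf)// intrD.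
by apply: lerD => //; rewrite ler_piMl ?normc_ge0.
Qed.

(** If every frequency is unimodular, so are those tending to 0 along the two axes,
    and these separate points: the law is a Dirac mass. *)
Lemma phi_lt1 t : t != 0 -> phi mu t < 1.
Proof.
move=> t0; rewrite lt_def phi_le1 andbT; apply/eqP => /esym ut.
have uall := unimodular_everywhere t0 ut; apply: (law_not_dirac M).
pose s1 (n : nat) : R[i] := Complex n.+1%:R^-1 0.
pose s2 (n : nat) : R[i] := Complex 0 n.+1%:R^-1.
have aeall : {ae mu, forall x, forall n, char (s1 n) x = ft mu (fun=> 1) (s1 n) /\
    char (s2 n) x = ft mu (fun=> 1) (s2 n)}.
  apply: ae_foralln => n.
  have c1 := unimodular_char (uall (s1 n)); have c2 := unimodular_char (uall (s2 n)).
  by apply: filterS2 c1 c2 => x.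
have [x0 x0P] : exists x0, forall n, char (s1 n) x0 = ft mu (fun=> 1) (s1 n) /\
    char (s2 n) x0 = ft mu (fun=> 1) (s2 n).
  exact: ae_ex aeall.
exists x0; apply: filterS aeall => x xP.
have zero (y : R) : (forall n : nat, cos (n.+1%:R^-1 * y) = 1) -> y = 0.
  move=> cy; pose n := Num.bound `|y|.
  have /eqP : n.+1%:R^-1 * y = 0.
    apply: cos_eq1_small => //; rewrite normrM ger0_norm// mulrC ler_pdivrMr// mul1r.
    by rewrite ltW// (lt_le_trans (archi_boundP _))// ler_nat.
  by rewrite mulf_eq0 invr_eq0 pnatr_eq0 /= => /eqP.
have charB s : char s x = char s x0 -> cos (complex.Re (s * (x - x0))) = 1.
  move=> e; have : char s (x - x0) * char s x0 = char s x0 by rewrite -charDr subrK e.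
  move/eqP; rewrite -subr_eq0 -[X in _ - X]mul1r -mulrBl mulf_eq0 -[_ == 0]normc_eq0.
  rewrite -[X in _ || X]normc_eq0 normc_char oner_eq0 orbF normc_eq0 subr_eq0 => /eqP.
  by move/(congr1 (@complex.Re R)).
apply/eqP; rewrite -subr_eq0; apply/eqP; apply: eq_complexP; apply: zero => n.
  have [h _] := xP n; have [h0 _] := x0P n.
  rewrite -h0 in h; have := charB _ h.
  by rewrite complexReM /= mul0r subr0.
have [_ h] := xP n; have [_ h0] := x0P n.
rewrite -h0 in h; have := charB _ h.
by rewrite complexReM /= mul0r sub0r cosN.
Qed.

End strict_modulus.

(** * Uniform bound at high frequencies *)

Section topology_of_pairs.
Context (R : realType).

Lemma continuous_normc_pair : continuous (fun p : R * R => normc (complex_of_pair p)).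
Proof.
move=> p; under eq_fun do rewrite normc_sqrtE /=.
apply: (@continuous_comp _ _ _ (fun q : R * R => q.1 ^+ 2 + q.2 ^+ 2) (@Num.sqrt R)).
  apply: cvgD.
    exact: (@continuous_comp _ _ _ fst (fun x : R => x ^+ 2) p (@cvg_fst _ _ _ _ _) (@exprn_continuous R 2 _)).
  exact: (@continuous_comp _ _ _ snd (fun x : R => x ^+ 2) p (@cvg_snd _ _ _ _ _) (@exprn_continuous R 2 _)).
exact: sqrt_continuous.
Qed.

Lemma continuous_phi_pair (mu : probability R[i] R) :
  continuous (fun p : R * R => phi mu (complex_of_pair p)).
Proof.
move=> p; apply/cvgrPdist_le => e e0.
have [del del0 delP] := phi_uniformly_continuous mu e0.
have d20 : 0 < del / 2 by rewrite divr_gt0.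
exists (ball p.1 (del / 2), ball p.2 (del / 2)).
  by split; exact: nbhsx_ballx.
move=> q [/= q1 q2].
apply: delP; rewrite (le_trans (normc_le_ReIm _))//= [leRHS](splitr del).
by rewrite lerD// ltW.
Qed.

Lemma compact_annulus (a b : R) : compact [set p : R * R | a <= normc (complex_of_pair p) <= b].
Proof.
apply: (subclosed_compact _ (compact_setX (@segment_compact R (- b) b) (@segment_compact R (- b) b))).
  rewrite (_ : [set p | _] = (fun p => normc (complex_of_pair p)) @^-1` [set x : R | a <= x] `&`
      (fun p => normc (complex_of_pair p)) @^-1` [set x : R | x <= b]); last first.
    by apply/seteqP; split => p /=; [move/andP|move=> [-> ->]].
  by apply: closedI; apply: preimage_closed; [move=> ? _; exact: continuous_normc_pair|exact: closed_ge|
    move=> ? _; exact: continuous_normc_pair|exact: closed_le].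
move=> p /= /andP[_ pb].
have /= re := normr_Re_le (complex_of_pair p); have /= im := normr_Im_le (complex_of_pair p).
by split; rewrite /= in_itv/= -ler_norml (le_trans _ pb).
Qed.

End topology_of_pairs.

Section high_frequencies.
Context (R : realType) (d : measure_display) (Omega : measurableType d).
Variables (P : probability Omega R) (mu : probability R[i] R) (alpha : R).
Variables (T X : nat -> Omega -> R[i]) (Y : Omega -> R[i]) (N : Omega -> nat).
Hypothesis M : branching_model P mu alpha T X Y N.

Let mT := weights_measurable M.
Let p := fine (P [set w | T 1 w != 0]).

(** The first two children, when their weights are not too small, form the
    pruned family to which the branching arguments apply. *)
Definition kept1 (eps : R) : set Omega := [set w | eps <= normc (T 0 w)].
Definition kept2 (eps : R) : set Omega :=
  [set w | eps <= normc (T 0 w) /\ eps <= normc (T 1 w)].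

Lemma measurable_weight_ge eps k : measurable [set w | eps <= normc (T k w)].
Proof.
have := measurable_normc (mT k); move=> /(_ measurableT _ (@measurable_itv R `[eps, +oo[)).
by congr measurable; apply/seteqP; split => w /=; rewrite in_itv/= andbT; [case|].
Qed.

Lemma measurable_kept1 eps : measurable (kept1 eps).
Proof. exact: measurable_weight_ge. Qed.

Lemma measurable_kept2 eps : measurable (kept2 eps).
Proof. exact: (measurableI _ _ (measurable_weight_ge eps 0) (measurable_weight_ge eps 1)). Qed.

Definition prob_kept1 eps : R := fine (P (kept1 eps)).
Definition prob_kept2 eps : R := fine (P (kept2 eps)).

Lemma prob_kept2_ge0 eps : 0 <= prob_kept2 eps.
Proof. exact: fine_ge0. Qed.

Lemma prob_kept2_le_kept1 eps : prob_kept2 eps <= prob_kept1 eps.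
Proof.
have m1 := measurable_kept1 eps; have m2 := measurable_kept2 eps.
by rewrite fine_le ?fin_num_measure// le_measure ?inE// => w [].
Qed.

Lemma prob_kept1_le1 eps : prob_kept1 eps <= 1.
Proof.
have m1 := measurable_kept1 eps; rewrite -[leRHS]/(fine 1%E) fine_le ?fin_num_measure//.
exact: probability_le1.
Qed.

Lemma small_weights_rare k e : 0 < e -> exists2 eps, 0 < eps < 1 &
  forall eps', 0 < eps' <= eps ->
  fine (P [set w | 0 < normc (T k w) < eps']) <= e.
Proof.
move=> e0; pose F n := [set w | 0 < normc (T k w) < (n : nat).+2%:R^-1].
have mF r : measurable [set w | 0 < normc (T k w) < r].
  have := measurable_normc (mT k); move=> /(_ measurableT _ (@measurable_itv R `]0, r[)).
  by congr measurable; apply/seteqP; split => w /=; rewrite in_itv/=; [case|].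
have [n Fn] : exists n, fine (P (F n)) <= e.
  apply: vanishing_tail => //; first by move=> n; exact: mF.
    move=> n m nm w /andP[Fw0 Fw]; apply/andP; split=> //; apply: (lt_le_trans Fw).
    by rewrite lef_pV2 ?posrE// ler_nat !ltnS.
  rewrite -subset0 => w Fw; have /andP[T0 _] := Fw 0 I.
  have /andP[_] := Fw (Num.bound (normc (T k w))^-1) I.
  apply/negP; rewrite -leNgt -[leRHS]invrK lef_pV2 ?posrE ?invr_gt0// ltW//.
  apply: (lt_le_trans (archi_boundP _)); first by rewrite invr_ge0 ltW.
  by rewrite ler_nat; exact: (leq_trans (leqnSn _)).
exists n.+2%:R^-1; first by rewrite invr_gt0 ltr0n /= invf_lt1 ?ltr1n.
move=> eps' /andP[_ le]; rewrite (le_trans _ Fn)// fine_le ?fin_num_measure//; [exact: mF..|].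
by rewrite le_measure ?inE; [|exact: mF..|move=> w /andP[w0 w1]; apply/andP; split=> //; exact: lt_le_trans w1 _].
Qed.

(** A weight in the interval from 0 to [eps] becomes improbable as [eps] tends to 0,
    and the first weight does not vanish. *)
Lemma pruning e : 0 < e -> exists2 eps, 0 < eps < 1 &
  1 - e <= prob_kept1 eps /\ p - 2 * e <= prob_kept2 eps.
Proof.
move=> e0; have [r /andP[r0 r1] rP] := small_weights_rare 0 e0.
have [s /andP[s0 s1] sP] := small_weights_rare 1 e0.
pose eps := Num.min r s; have eps0 : 0 < eps by rewrite lt_min r0.
have P0 := rP eps; rewrite eps0 /eps ge_min lexx /= in P0; have {}P0 := P0 isT.
have P1 := sP eps; rewrite eps0 /eps ge_min lexx orbT /= in P1; have {}P1 := P1 isT.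
have mF k : measurable [set w | 0 < normc (T k w) < eps].
  have := measurable_normc (mT k); move=> /(_ measurableT _ (@measurable_itv R `]0, eps[)).
  by congr measurable; apply/seteqP; split => w /=; rewrite in_itv/=; [case|].
have m1 := measurable_kept1 eps; have m2 := measurable_kept2 eps.
have mn := measurable_weight_neq0 M 1.
have bI A : measurable A -> bounded_mf (\1_A : Omega -> R) by exact: bounded_mf_indic.
exists eps; first by rewrite eps0 /eps gt_min r1.
have iE (A : set Omega) w : \1_A w = (if w \in A then 1 else 0) :> R.
  by rewrite indicE; case: (w \in A).
rewrite /prob_kept1 /prob_kept2 /p -!Ex_indic//; split.
  rewrite lerBlDr -(Ex_cst P 1).
  apply: (@le_trans _ _ (Ex P (fun w => \1_(kept1 eps) w + \1_[set w | 0 < normc (T 0 w) < eps] w))).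
    apply: le_Ex_ae; [exact: bounded_mf_cst|by apply: bounded_mfD; exact: bI|].
    apply: filterS (first_weight_neq0 M) => w Tw; rewrite !iE.
    have [h|h] := leP eps (normc (T 0 w)).
      by rewrite mem_set//; case: ifP => _; lra.
    rewrite [X in _ <= _ + X]ifT; first by case: ifP => _; lra.
    by rewrite inE /= h andbT lt_def normc_eq0 Tw normc_ge0.
  rewrite ExD; [|exact: bI..]; rewrite lerD2l Ex_indic//; exact: P0.
rewrite lerBlDr.
apply: (@le_trans _ _ (Ex P (fun w => \1_(kept2 eps) w + (\1_[set w | 0 < normc (T 0 w) < eps] w +
    \1_[set w | 0 < normc (T 1 w) < eps] w)))).
  apply: le_Ex_ae; [exact: bI|by apply: bounded_mfD; [|apply: bounded_mfD]; exact: bI|].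
  apply: filterS (first_weight_neq0 M) => w Tw; rewrite !iE.
  have [|_] := boolP (w \in [set w | T 1 w != 0]); last by do 3!case: ifP => _; lra.
  rewrite inE /= => T1w.
  have [h|h] := leP eps (normc (T 0 w)); last first.
    rewrite [X in _ <= _ + (X + _)]ifT; first by do 2!case: ifP => _; lra.
    by rewrite inE /= h andbT lt_def normc_eq0 Tw normc_ge0.
  have [h'|h'] := leP eps (normc (T 1 w)); last first.
    rewrite [X in _ <= _ + (_ + X)]ifT; first by do 2!case: ifP => _; lra.
    by rewrite inE /= h' andbT lt_def normc_eq0 T1w normc_ge0.
  by rewrite mem_set//; do 2!case: ifP => _; lra.
rewrite ExD; [|exact: bI|by apply: bounded_mfD; exact: bI].
rewrite ExD; [|exact: bI..]; rewrite lerD2l !Ex_indic//.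
have := lerD P0 P1; rewrite -/eps; lra.
Qed.

End high_frequencies.

(** Inclusion-exclusion with small terms: replacing [u0], [u1] by minorants at most
    [del], the product term costs at most the fraction [del / 2] of the sum. *)
Lemma union_bound (R : realType) (u0 u1 y0 y1 del : R) :
  0 <= u0 <= 1 -> 0 <= u1 <= 1 -> y0 <= u0 -> y1 <= u1 ->
  y0 <= del -> y1 <= del -> 0 <= del <= 1 ->
  (1 - del / 2) * (y0 + y1) <= 1 - (1 - u0) * (1 - u1).
Proof.
move=> /andP[u00 u01] /andP[u10 u11] yu0 yu1 yd0 yd1 /andP[d0 d1].
pose x0 := Num.max 0 y0; pose x1 := Num.max 0 y1.
have x00 : 0 <= x0 by rewrite le_max lexx.
have x10 : 0 <= x1 by rewrite le_max lexx.
have yx0 : y0 <= x0 by rewrite le_max lexx orbT.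
have yx1 : y1 <= x1 by rewrite le_max lexx orbT.
have xu0 : x0 <= u0 by rewrite ge_max u00.
have xu1 : x1 <= u1 by rewrite ge_max u10.
have xd0 : x0 <= del by rewrite ge_max d0.
have xd1 : x1 <= del by rewrite ge_max d0.
apply: (@le_trans _ _ ((1 - del / 2) * (x0 + x1))).
  by apply: ler_wpM2l; [lra|exact: lerD].
apply: (@le_trans _ _ (x0 + x1 - x0 * x1)).
  have h0 : x0 * x1 <= del * x1 by exact: ler_wpM2r.
  have h1 : x0 * x1 <= del * x0 by rewrite mulrC; exact: ler_wpM2r.
  nra.
have : (1 - u0) * (1 - u1) <= (1 - x0) * (1 - x1).
  by apply: ler_pM; rewrite ?subr_ge0// lerD2l lerN2.
nra.
Qed.

Lemma pair_of_complexK (R : realType) :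
  cancel (@pair_of_complex R) (@complex_of_pair R).
Proof. by case. Qed.

Section cramer.
Context (R : realType) (d : measure_display) (Omega : measurableType d).
Variables (P : probability Omega R) (mu : probability R[i] R) (alpha : R).
Variables (T X : nat -> Omega -> R[i]) (Y : Omega -> R[i]) (N : Omega -> nat).
Hypothesis M : branching_model P mu alpha T X Y N.

Let mT := weights_measurable M.
Let alpha0 := exponent_gt0 M.
Local Notation phi := (phi mu).
Local Notation V t := (normc t `^ alpha).

Lemma VM s t : V (s * t) = V s * V t :> R.
Proof. by rewrite normcM powRM// normc_ge0. Qed.

(** Perturbing by a positive multiple of the Lyapunov function [V], infinite at
    infinity, makes the infimum attained on a compact annulus. *)
Lemma perturbed_minimum (eps c eta : R) t0 : 0 < eps -> 0 < c -> 0 < eta ->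
  eps <= normc t0 -> 1 - phi t0 + eta * V t0 < c ->
  exists t, [/\ eps <= normc t, 1 - phi t + eta * V t < c &
    forall s, eps <= normc s -> 1 - phi t + eta * V t <= 1 - phi s + eta * V s].
Proof.
move=> eps0 c0 eta0 t0e t0c.
pose b := Num.max (normc t0) ((c / eta) `^ alpha^-1).
pose K := [set q : R * R | eps <= normc (complex_of_pair q) <= b].
pose f (q : R * R) := 1 - phi (complex_of_pair q) + eta * V (complex_of_pair q).
have cf q : q \in K -> {for q, continuous f}.
  rewrite inE /K /= => /andP[qe _].
  apply: cvgD; first by apply: cvgB; [exact: cvg_cst|exact: continuous_phi_pair].
  apply: cvgM; first exact: cvg_cst.
  apply: (@continuous_comp _ _ _ (fun p => normc (complex_of_pair p)) (fun x : R => x `^ alpha)).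
    exact: continuous_normc_pair.
  have q0 := lt_le_trans eps0 qe; have [dq _] := is_derive1_powR alpha q0.
  exact/differentiable_continuous/derivable1_diffP.
have t0K : K (pair_of_complex t0).
  by apply/andP; rewrite pair_of_complexK t0e le_max lexx.
have cK : compact K by exact: compact_annulus.
have [q qK qmin] := @compact_EVT_min _ _ f K (ex_intro _ _ t0K) cK (continuous_in_subspaceT cf).
have qt0 : f q <= 1 - phi t0 + eta * V t0.
  by have := qmin _ (mem_set t0K); rewrite {2}/f pair_of_complexK.
exists (complex_of_pair q); split.
- by move: qK; rewrite inE /K /= => /andP[].
- exact: le_lt_trans qt0 t0c.
- move=> s se; have [sb|bs] := leP (normc s) b.
    have sK : K (pair_of_complex s).
      by apply/andP; rewrite pair_of_complexK se.
    by have := qmin _ (mem_set sK); rewrite {2}/f pair_of_complexK.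
  apply: (le_trans qt0); apply: (le_trans (ltW t0c)).
  rewrite ler_wpDl ?subr_ge0 ?phi_le1// -ler_pdivrMl// mulrC.
  have ce : 0 <= c / eta by rewrite divr_ge0// ltW.
  have -> : c / eta = ((c / eta) `^ alpha^-1) `^ alpha.
    by rewrite -powRrM mulVf ?gt_eqF// powRr1.
  apply: ge0_ler_powR; rewrite ?nnegrE ?powR_ge0 ?normc_ge0//; first exact: ltW.
  by rewrite (le_trans _ (ltW bs))// le_max lexx orbT.
Qed.

(** At a minimum [t] all kept children satisfy the same lower bound. Their mean
    number exceeds 1, which multiplies the minimum by at least 1 after the loss
    [del / 2], whereas the perturbation [eta V] is multiplied by at most
    [1 - del / 2 < 1], as [V] is multiplicative and [|T_0|^alpha + |T_1|^alpha] has
    mean at most 1. So [1 - phi t] would exceed its own value. *)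
Lemma no_high_minimum (eps eta del : R) t : 0 < eps -> 0 < eta -> 0 < del <= 1 ->
  1 <= (1 - del / 2) * (prob_kept1 P T eps + prob_kept2 P T eps) ->
  1 <= normc t -> 1 - phi t + eta * V t <= del ->
  ~ forall s, eps <= normc s -> 1 - phi t + eta * V t <= 1 - phi s + eta * V s.
Proof.
move=> eps0 eta0 /andP[del0 del1] gain t1 mdel tmin.
set m := 1 - phi t + eta * V t in mdel tmin.
pose K := eta * V t.
have K0 : 0 < K by rewrite mulr_gt0// powR_gt0// (lt_le_trans _ t1).
have m0 : 0 <= m by rewrite addr_ge0 ?subr_ge0 ?phi_le1// ltW.
pose f w := 1 - phi (t * T 0 w) * phi (t * T 1 w).
have b0 := bounded_mf_phi_weight M 0 t; have b1 := bounded_mf_phi_weight M 1 t.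
have bf : bounded_mf f by apply: bounded_mfB; [exact: bounded_mf_cst|exact: bounded_mfM].
have Ef : Ex P f <= m - K.
  rewrite ExB; [|exact: bounded_mf_cst|exact: bounded_mfM].
  rewrite Ex_cst /m /K addrK lerD2l lerN2.
  exact: (phi_smoothing M).
have m1 := measurable_kept1 M eps; have m2 := measurable_kept2 M eps.
have bI A : measurable A -> bounded_mf (\1_A : Omega -> R) by exact: bounded_mf_indic.
pose c := 1 - del / 2; have c0 : 0 < c by rewrite /c; lra.
pose g w := c * m * (\1_(kept1 T eps) w + \1_(kept2 T eps) w).
have bg : bounded_mf g.
  by apply: bounded_mfM; [exact: bounded_mf_cst|apply: bounded_mfD; exact: bI].
have Eg : Ex P g = c * m * (prob_kept1 P T eps + prob_kept2 P T eps).
  by rewrite ExZ ?ExD ?Ex_indic//; [exact: bI..|apply: bounded_mfD; exact: bI].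
have pt w : g w <= f w + c * K * (V (T 0 w) + V (T 1 w)).
  have V0 : 0 <= V (T 0 w) by exact: powR_ge0.
  have V1 : 0 <= V (T 1 w) by exact: powR_ge0.
  have f0 := phi_le1 mu (t * T 0 w); have f1 := phi_le1 mu (t * T 1 w).
  have g0 := phi_ge0 mu (t * T 0 w); have g1 := phi_ge0 mu (t * T 1 w).
  have y k : eps <= normc (T k w) -> m - K * V (T k w) <= 1 - phi (t * T k w).
    move=> Tk; rewrite lerBlDr /K -mulrA -VM; apply: tmin.
    by rewrite normcM (le_trans Tk)// ler_peMl ?normc_ge0.
  have cK : 0 <= c * K by rewrite mulr_ge0// ltW.
  have ub := @union_bound _ (1 - phi (t * T 0 w)) (1 - phi (t * T 1 w)).
  have fE : f w = 1 - (1 - (1 - phi (t * T 0 w))) * (1 - (1 - phi (t * T 1 w))).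
    by rewrite /f; ring.
  have mKV k : 0 <= V (T k w) -> m - K * V (T k w) <= del.
    by move=> Vk; rewrite lerBlDr (le_trans mdel)// lerDl mulr_ge0// ltW.
  have iE (A : set Omega) : \1_A w = (if w \in A then 1 else 0) :> R.
    by rewrite indicE; case: (w \in A).
  have u01 : 0 <= 1 - phi (t * T 0 w) <= 1 by rewrite subr_ge0 f0 gerBl g0.
  have u11 : 0 <= 1 - phi (t * T 1 w) <= 1 by rewrite subr_ge0 f1 gerBl g1.
  have d01 : 0 <= del <= 1 by rewrite ltW.
  rewrite /g !iE fE; have [h0|h0] := boolP (w \in kept1 T eps); last first.
    rewrite ifF; last first.
      apply/negP; rewrite inE => -[h _]; move/negP: h0; apply; by rewrite inE.
    rewrite addr0 mulr0 addr_ge0//; last by rewrite mulr_ge0// addr_ge0.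
    have := ub 0 0 del u01 u11; rewrite addr0 mulr0; apply; by rewrite ?subr_ge0// ltW.
  move: h0; rewrite inE => h0; have yk0 := y 0 h0.
  have [h1|h1] := boolP (w \in kept2 T eps).
    move: h1; rewrite inE => -[_ h1]; have yk1 := y 1 h1.
    have := ub _ _ del u01 u11 yk0 yk1 (mKV 0 V0) (mKV 1 V1) d01; rewrite -/c.
    set F := 1 - _ * _; nra.
  have := ub _ 0 del u01 u11 yk0 _ (mKV 0 V0) _ d01; rewrite -/c.
  rewrite subr_ge0 => /(_ f1 (ltW del0)).
  have : 0 <= c * K * V (T 1 w) by rewrite mulr_ge0.
  set F := 1 - _ * _; nra.
have mV k : measurable_fun setT (fun w => V (T k w)).
  by apply: (measurableT_comp (measurable_powR _)); exact: measurable_normc.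
have mVV : measurable_fun setT (fun w => V (T 0 w) + V (T 1 w)) by exact: measurable_funD.
have mVVE : measurable_fun setT (EFin \o (fun w => V (T 0 w) + V (T 1 w))).
  exact/measurable_EFinP.
have f0 w : 0 <= f w.
  by rewrite subr_ge0 mulr_ile1 ?phi_ge0 ?phi_le1.
have g0 w : 0 <= g w.
  by rewrite mulr_ge0 ?addr_ge0// mulr_ge0// ltW.
have cK : 0 <= c * K by rewrite mulr_ge0// ltW.
have : ((Ex P g)%:E <= (Ex P f)%:E + (c * K)%:E)%E.
  rewrite !EFin_Ex//.
  apply: (@le_trans _ _ (\int[P]_w ((f w)%:E + (c * K)%:E * (V (T 0 w) + V (T 1 w))%:E))%E).
    apply: ge0_le_integral => //.
    - by move=> w _; rewrite lee_fin.
    - by apply/measurable_EFinP; case: bg.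
    - apply: emeasurable_funD; first by apply/measurable_EFinP; case: bf.
      by apply: emeasurable_funM => //; exact: mVVE.
    - by move=> w _; rewrite -EFinM -EFinD lee_fin.
  rewrite ge0_integralD//.
  - rewrite ge0_integralZl//.
    + by rewrite leeD2l// -[leRHS]mule1 lee_wpmul2l// (two_weights_moment M).
    + by move=> w _; rewrite lee_fin addr_ge0 ?powR_ge0.
  - by move=> w _; rewrite lee_fin.
  - by apply/measurable_EFinP; case: bf.
  - by move=> w _; rewrite mule_ge0// lee_fin addr_ge0 ?powR_ge0.
  - by apply: emeasurable_funM => //; exact: mVVE.
rewrite -EFinD lee_fin Eg => le1.
have : m <= c * m * (prob_kept1 P T eps + prob_kept2 P T eps).
  by rewrite mulrAC -[leLHS]mul1r ler_wpM2r.
have : c * K < K by rewrite -[ltRHS]mul1r ltr_pM2r// /c; lra.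
move: le1 Ef; lra.
Qed.

(** Hence the minimum of the perturbed function is at low frequencies, where
    compactness and [phi < 1] bound [1 - phi] below; the bound persists as the
    perturbation vanishes. *)
Lemma cramer_condition eps : 0 < eps -> 1 < prob_kept1 P T eps + prob_kept2 P T eps ->
  exists2 eta, 0 <= eta < 1 & forall t, eps <= normc t -> phi t <= eta.
Proof.
move=> eps0; set m := prob_kept1 _ _ _ + _ => m1.
pose del := (m - 1) / m; have m0 : 0 < m by rewrite (lt_trans ltr01).
have delE : del * m = m - 1 by rewrite /del divfK// gt_eqF.
have del0 : 0 < del by rewrite divr_gt0// subr_gt0.
have del1 : del <= 1 by rewrite ler_pdivrMr// mul1r lerBlDr lerDl ler01.
have gain : 1 <= (1 - del / 2) * m by move: delE; nra.
have [c /andP[c0 c1] cP] : exists2 c, 0 < c <= 1 & forall t, eps <= normc t <= 1 -> c <= 1 - phi t.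
  have [eps1|eps1] := leP eps 1; last first.
    by exists 1; [rewrite ltr01 lexx|move=> t /andP[h1 h2]; have := le_trans h1 h2; rewrite leNgt eps1].
  pose K := [set q : R * R | eps <= normc (complex_of_pair q) <= 1].
  pose f (q : R * R) := 1 - phi (complex_of_pair q).
  have cf : {within K, continuous f}.
    apply: continuous_subspaceT => q.
    by apply: cvgB; [exact: cvg_cst|exact: continuous_phi_pair].
  have K1 : K (1, 0).
    by rewrite /K /= /complex_of_pair /= -[X in _ <= X <= _]/(normc (1 : R[i])) normc1 eps1 lexx.
  have cK : compact K by exact: compact_annulus.
  have [q qK qmin] := @compact_EVT_min _ _ f K (ex_intro _ _ K1) cK cf.
  exists (f q).
    rewrite subr_gt0 gerBl phi_ge0 andbT; apply: (phi_lt1 M).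
    by apply/eqP => q0; move: qK; rewrite inE => /andP[]; rewrite q0 normc0 leNgt eps0.
  move=> t te; have tK : K (pair_of_complex t) by rewrite /K /mkset pair_of_complexK.
  by have := qmin _ (mem_set tK); rewrite {2}/f pair_of_complexK.
pose c' := Num.min c del; have c'0 : 0 < c' by rewrite lt_min c0.
exists (1 - c').
  by rewrite subr_ge0 gtrBl c'0 andbT /c' ge_min c1.
move=> t te; rewrite lerBrDr addrC -lerBrDr leNgt; apply/negP => tc.
have t0 : 0 < normc t by exact: lt_le_trans te.
have Vt : 0 < V t by exact: powR_gt0.
pose eta := (c' - (1 - phi t)) / (2 * V t).
have eta0 : 0 < eta by rewrite divr_gt0 ?subr_gt0// mulr_gt0.
have tc' : 1 - phi t + eta * V t < c'.
  have -> : eta * V t = (c' - (1 - phi t)) / 2 by rewrite /eta; field; rewrite gt_eqF.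
  move: tc; lra.
have [s [se sc smin]] := perturbed_minimum eps0 c'0 eta0 te tc'.
have Vs : 0 <= eta * V s by rewrite mulr_ge0 ?powR_ge0// ltW.
have [s1|s1] := leP (normc s) 1.
  have := cP s; rewrite se s1 => /(_ isT) cs.
  have : c' <= c by rewrite ge_min lexx.
  move: cs sc Vs; lra.
have sdel : 1 - phi s + eta * V s <= del.
  by rewrite (le_trans (ltW sc))// ge_min lexx orbT.
apply: (no_high_minimum eps0 eta0 _ gain (ltW s1) sdel smin).
by rewrite del0.
Qed.

End cramer.

(** * Parts of the law with a decaying Fourier transform *)

Definition weight (R : realType) (h : R[i] -> R) : Prop :=
  measurable_fun setT h /\ forall x, 0 <= h x <= 1.

Section weights_theory.
Context (R : realType).
Implicit Types h : R[i] -> R.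

Lemma weight_bounded h : weight h -> bounded_mf h.
Proof.
move=> [mh h01]; split=> //; exists 1 => x; have /andP[h0 h1] := h01 x.
by rewrite ger0_norm.
Qed.

Lemma weight_compl h : weight h -> weight (fun x => 1 - h x).
Proof.
move=> [mh h01]; split; first exact: measurable_funB.
by move=> x; have /andP[h0 h1] := h01 x; rewrite subr_ge0 h1 gerBl h0.
Qed.

Lemma weight1 : weight (fun _ : R[i] => 1 : R).
Proof. by split=> // x; rewrite lexx ler01. Qed.

Lemma weight_mean (mu : probability R[i] R) h : weight h -> 0 <= Ex mu h <= 1.
Proof.
move=> wh; have [mh h01] := wh.
rewrite Ex_ge0 => [|x]; last by have /andP[] := h01 x.
rewrite -[leRHS](Ex_cst mu) le_Ex//; [exact: weight_bounded|exact: bounded_mf_cst|].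
by move=> x; have /andP[] := h01 x.
Qed.

Lemma normc_ft_weight_le1 (mu : probability R[i] R) h t : weight h ->
  normc (ft mu h t) <= 1.
Proof.
move=> wh; have /andP[_ h1] := weight_mean mu wh; apply: le_trans h1.
apply: normc_ft_le; first exact: weight_bounded.
by have [_ h01] := wh; move=> x; have /andP[] := h01 x.
Qed.

End weights_theory.

Section branching_operations.
Context (R : realType) (d : measure_display) (Omega : measurableType d).
Variables (P : probability Omega R) (mu : probability R[i] R) (alpha : R).
Variables (T X : nat -> Omega -> R[i]) (Y : Omega -> R[i]) (N : Omega -> nat).
Hypothesis M : branching_model P mu alpha T X Y N.

Let mT := weights_measurable M.
Let mX := copies_measurable M.
Local Notation phi := (phi mu).
Local Notation prob_kept1 := (prob_kept1 P T).
Local Notation prob_kept2 := (prob_kept2 P T).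

Lemma reweighted_part (w : Omega -> R) : bounded_mf w -> (forall x, 0 <= w x <= 1) ->
  exists h, [/\ weight h, Ex mu h = Ex P w &
    forall t, ft mu h t = cEx P (fun x => Complex (w x) 0 * char t (Y x))].
Proof.
move=> bw w01; have w0 x : 0 <= w x by have /andP[] := w01 x.
have w1 x : w x <= 1 by have /andP[] := w01 x.
have [h [mh h01 hE]] := weight_conditioning bw w0 (sum_measurable M) w1 (sum_law M).
exists h; split=> //.
  transitivity (Ex mu (fun x => 1 * h x)); first by apply: eq_Ex => x; rewrite mul1r.
  rewrite -(hE (fun=> 1) (bounded_mf_cst _ _)).
  by apply: eq_Ex => x; rewrite mul1r.
move=> t; have bc : bounded_cmf (char t : R[i] -> R[i]) by apply: bounded_cmf_char.
have reE (a : R) x : complex.Re (Complex a 0 * char t x) = complex.Re (char t x) * a.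
  by rewrite complexReM [X in _ - X]mul0r subr0 mulrC.
have imE (a : R) x : complex.Im (Complex a 0 * char t x) = complex.Im (char t x) * a.
  by rewrite complexImM [X in _ + X]mul0r addr0 mulrC.
rewrite /ft /cEx; congr Complex.
  under eq_Ex do rewrite reE; under [RHS]eq_Ex do rewrite reE.
  by rewrite -(hE _ (bounded_cmf_Re bc)).
under eq_Ex do rewrite imE; under [RHS]eq_Ex do rewrite imE.
by rewrite -(hE _ (bounded_cmf_Im bc)).
Qed.

Section selected_pairs.
Variables (A : set (R[i] * R[i])) (mA : measurable A) (h0 h1 : R[i] -> R).
Hypotheses (b0 : bounded_mf h0) (b1 : bounded_mf h1).

Let selected := [set w | A (T 0 w, T 1 w)].

Local Notation pairw := (pair_weight T X 0 1 (\1_A) h0 h1).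

Lemma measurable_selected : measurable selected.
Proof.
have m01 : measurable_fun setT (fun w => (T 0 w, T 1 w)) by exact: measurable_fun_pair.
by have := m01 measurableT A mA; rewrite setTI.
Qed.

Lemma Ex_selected : Ex P pairw = fine (P selected) * Ex mu h0 * Ex mu h1.
Proof.
have bA : bounded_mf (\1_A : R[i] * R[i] -> R) by exact: bounded_mf_indic.
have [mTk mXk mY mN YE ind _ _ _ _ _ _ _] := M.
rewrite (Ex_pair_weight mTk mXk ind (isT : (0%N != 1%N)) bA b0 b1) -Ex_indic//; exact: measurable_selected.
Qed.

Lemma bounded_mf_selected : bounded_mf pairw.
Proof.
by apply: bounded_mf_pair_weight => //; exact: bounded_mf_indic.
Qed.

Lemma ft_selected_le t (B0 B1 : R) :
  (forall a b, A (a, b) -> normc (ft mu h0 (t * a)) <= B0 /\ normc (ft mu h1 (t * b)) <= B1) ->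
  normc (cEx P (fun w => Complex (pairw w) 0 * char t (Y w))) <=
  fine (P selected) * (B0 * B1).
Proof.
move=> AB.
have bA : bounded_mf (\1_A : R[i] * R[i] -> R) by exact: bounded_mf_indic.
have [mTk mXk mY mN YE ind _ _ _ _ _ _ _] := M.
apply: (le_trans (cEx_pair_weight_le mTk mXk mY mN YE ind (isT : (0%N != 1%N)) bA b0 b1 t)).
have ms := measurable_selected; have bs : bounded_mf (\1_selected : Omega -> R) by exact: bounded_mf_indic.
rewrite mulrC -Ex_indic// -ExZ//.
have bft k h : bounded_mf h -> bounded_mf (fun w => normc (ft mu h (t * T k w))).
  move=> bh; have [mf [L fL]] := bounded_cmf_normc (bounded_cmf_ft mu bh); split; last by exists L.
  by apply: (measurableT_comp mf); exact: measurable_complexM.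
apply: le_Ex.
- apply: bounded_mfM; last exact: bft.
  apply: bounded_mfM; last exact: bft.
  apply: bounded_mf_norm; apply: (bounded_mf_comp _ bA); exact: measurable_fun_pair.
- by apply: bounded_mfM => //; exact: bounded_mf_cst.
move=> w; rewrite !indicE; have [wA|wA] := boolP ((T 0 w, T 1 w) \in A).
  have [B0w B1w] : normc (ft mu h0 (t * T 0 w)) <= B0 /\ normc (ft mu h1 (t * T 1 w)) <= B1.
    by apply: AB; rewrite inE in wA.
  rewrite mem_set ?normr1 ?mul1r ?mulr1//; last by rewrite inE in wA.
  by rewrite ler_pM ?normc_ge0.
rewrite memNset ?normr0 ?mul0r ?mulr0//.
by rewrite notin_setE in wA.
Qed.

End selected_pairs.

Section threshold.
Variables (eps : R) (eps0 : 0 < eps).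

Let both : set (R[i] * R[i]) := [set q | eps <= normc q.1 /\ eps <= normc q.2].
Let first_only : set (R[i] * R[i]) := [set q | eps <= normc q.1 /\ normc q.2 < eps].

Let mnorm : measurable [set z : R[i] | eps <= normc z].
Proof.
have := measurable_normc (@measurable_id _ R[i] setT).
move=> /(_ measurableT _ (@measurable_itv R `[eps, +oo[)).
by congr measurable; apply/seteqP; split => z /=; rewrite in_itv/= andbT; [case|].
Qed.

Let mboth : measurable both.
Proof. exact: (measurableX mnorm mnorm). Qed.

Let mfirst : measurable first_only.
Proof.
have := measurableX mnorm (measurableC mnorm); congr measurable.
apply/seteqP; split => q [/= q1 q2]; split=> //=.
  by rewrite ltNge; exact/negP.
by move=> h; move: q2; rewrite ltNge h.
Qed.

Let bothE : fine (P [set w | both (T 0 w, T 1 w)]) = prob_kept2 eps.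
Proof. by []. Qed.

Let firstE : fine (P [set w | first_only (T 0 w, T 1 w)]) = prob_kept1 eps - prob_kept2 eps.
Proof.
have m1 := measurable_kept1 M eps; have m2 := measurable_kept2 M eps.
have D : P (kept1 T eps `\` kept2 T eps) = (P (kept1 T eps) - P (kept2 T eps))%E.
  rewrite measureD//; last by rewrite ltey_eq fin_num_measure.
  by congr (_ - P _)%E; apply/setIidr => w [].
rewrite /prob_kept1 /prob_kept2 -fineB ?fin_num_measure// -D.
congr (fine (P _)); apply/seteqP; split => w /=.
  by move=> [w0 w1]; split=> // -[_]; rewrite leNgt w1.
move=> [w0 w1]; split=> //; rewrite ltNge; apply/negP => w2; exact: w1.
Qed.

(** The part carried by the histories in which some kept child belongs to the part
    [h], the complement of the extinction step. When two children are kept, either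
    the first belongs to [h], which leaves a factor [phi <= c] for the second, or
    the first belongs to the complement, of mass [1 - Ex mu h], and the second to
    [h]. *)
Lemma or_operation h : weight h ->
  exists h', [/\ weight h',
    Ex mu h' = Ex mu h * (prob_kept1 eps + prob_kept2 eps * (1 - Ex mu h)) &
    forall t b c,
      (forall s, eps * normc t <= normc s -> normc (ft mu h s) <= b /\ phi s <= c) ->
      normc (ft mu h' t) <= b * (prob_kept1 eps - prob_kept2 eps + prob_kept2 eps * (c + (1 - Ex mu h)))].
Proof.
move=> wh; have bh := weight_bounded wh; have wk := weight_compl wh.
have bk := weight_bounded wk; have b1 := @bounded_mf_cst R _ R[i] 1.
pose wA := pair_weight T X 0 1 (\1_first_only) h (fun=> 1).
pose wB := pair_weight T X 0 1 (\1_both) h (fun=> 1).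
pose wC := pair_weight T X 0 1 (\1_both) (fun x => 1 - h x) h.
have bA : bounded_mf wA by exact: bounded_mf_selected.
have bB : bounded_mf wB by exact: bounded_mf_selected.
have bC : bounded_mf wC by exact: bounded_mf_selected.
pose w x := wA x + wB x + wC x.
have bw : bounded_mf w by apply: bounded_mfD => //; exact: bounded_mfD.
have w01 x : 0 <= w x <= 1.
  rewrite /w /wA /wB /wC /pair_weight.
  have [_ h01] := wh; have /andP[h00 h01'] := h01 (X 0 x); have /andP[h10 h11] := h01 (X 1 x).
  move: h00 h01' h10 h11; set u := h (X 0 x); set v := h (X 1 x) => u0 u1 v0 v1.
  rewrite !indicE.
  have [xb|xb] := boolP ((T 0 x, T 1 x) \in both).
    rewrite memNset ?mul0r ?mul1r ?mulr1 ?add0r; last first.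
      by move=> [_ /=]; move: xb; rewrite inE => -[_ /=]; rewrite leNgt => /negP.
    by apply/andP; split; nra.
  rewrite !mul0r !addr0; case: (_ \in _); rewrite ?mul0r ?mul1r ?mulr1 ?lexx ?ler01 ?u0 ?u1//.
have [h' [wh' mh' fh']] := reweighted_part bw w01.
exists h'; split=> //.
  rewrite mh' /w !ExD//; last exact: bounded_mfD.
  rewrite !Ex_selected// bothE firstE ExB//.
  by rewrite !Ex_cst; ring.
move=> t b c bc.
have pc (u : Omega -> R) : bounded_mf u -> bounded_cmf (fun x => Complex (u x) 0 * char t (Y x) : R[i]).
  move=> bu; apply: bounded_cmfM; first exact: bounded_cmf_real.
  by apply: bounded_cmf_char => //; exact: (sum_measurable M).
have -> : ft mu h' t = cEx P (fun x => Complex (wA x) 0 * char t (Y x)) +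
    cEx P (fun x => Complex (wB x) 0 * char t (Y x)) +
    cEx P (fun x => Complex (wC x) 0 * char t (Y x)).
  rewrite fh' -!cExD; try exact: pc; last by apply: bounded_cmfD; exact: pc.
  apply: eq_cEx => x; rewrite -!mulrDl; congr (_ * _).
  by apply: eq_complexP => /=; rewrite ?addr0.
have ge1 a (q : R) : q <= normc a -> q * normc t <= normc (t * a).
  by move=> qa; rewrite normcM mulrC ler_wpM2l ?normc_ge0.
have bth s : eps * normc t <= normc s -> normc (ft mu h s) <= b by move=> /bc[].
have cth s : eps * normc t <= normc s -> phi s <= c by move=> /bc[].
have p2q : 0 <= prob_kept2 eps := prob_kept2_ge0 P T eps.
have lA : normc (cEx P (fun x => Complex (wA x) 0 * char t (Y x))) <= (prob_kept1 eps - prob_kept2 eps) * (b * 1).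
  rewrite -firstE; apply: ft_selected_le => // a z [/= ae _].
  by split; [exact/bth/ge1|exact: phi_le1].
have lB : normc (cEx P (fun x => Complex (wB x) 0 * char t (Y x))) <= prob_kept2 eps * (b * c).
  rewrite -bothE; apply: ft_selected_le => // a z [/= ae ze].
  by split; [exact/bth/ge1|exact/cth/ge1].
have lC : normc (cEx P (fun x => Complex (wC x) 0 * char t (Y x))) <= prob_kept2 eps * ((1 - Ex mu h) * b).
  rewrite -bothE; apply: ft_selected_le => // a z [/= ae ze].
  split; last exact/bth/ge1.
  rewrite -[X in X - _](Ex_cst mu) -ExB//; apply: normc_ft_le => // x.
  by have [_ k01] := wk; have /andP[] := k01 x.
apply: (le_trans (normcD _ _)); apply: (le_trans (lerD (normcD _ _) (lexx _))).
apply: (le_trans (lerD (lerD lA lB) lC)).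
by rewrite le_eqVlt; apply/orP; left; apply/eqP; ring.
Qed.

(** Both kept children belong to the part [h], and each contributes the same bound:
    hence the square. *)
Lemma and_operation h : weight h ->
  exists h', [/\ weight h', Ex mu h' = prob_kept2 eps * Ex mu h ^+ 2 &
    forall t b, (forall s, eps * normc t <= normc s -> normc (ft mu h s) <= b) ->
      normc (ft mu h' t) <= b ^+ 2].
Proof.
move=> wh; have bh := weight_bounded wh.
pose w := pair_weight T X 0 1 (\1_both) h h.
have bw : bounded_mf w by exact: bounded_mf_selected.
have w01 x : 0 <= w x <= 1.
  rewrite /w /pair_weight.
  have [_ h01] := wh; have /andP[h00 h01'] := h01 (X 0 x); have /andP[h10 h11] := h01 (X 1 x).
  rewrite indicE; case: (_ \in _); rewrite ?mul0r ?mul1r ?lexx ?ler01//.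
  by rewrite mulr_ge0// mulr_ile1.
have [h' [wh' mh' fh']] := reweighted_part bw w01.
exists h'; split=> //; first by rewrite mh' Ex_selected// bothE expr2 mulrA.
move=> t b bth.
have ge1 a (q : R) : q <= normc a -> q * normc t <= normc (t * a).
  by move=> qa; rewrite normcM mulrC ler_wpM2l ?normc_ge0.
rewrite fh'; apply: (@le_trans _ _ (prob_kept2 eps * (b * b))).
  rewrite -bothE; apply: ft_selected_le => // a z [/= ae ze].
  by split; exact/bth/ge1.
by rewrite -expr2 ler_piMl ?sqr_ge0// (le_trans (prob_kept2_le_kept1 M eps))// (prob_kept1_le1 M).
Qed.

End threshold.

End branching_operations.

Section decay.
Context (R : realType) (d : measure_display) (Omega : measurableType d).
Variables (P : probability Omega R) (mu : probability R[i] R) (alpha : R).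
Variables (T X : nat -> Omega -> R[i]) (Y : Omega -> R[i]) (N : Omega -> nat).
Hypothesis M : branching_model P mu alpha T X Y N.

Local Notation phi := (phi mu).
Local Notation prob_kept1 := (prob_kept1 P T).
Local Notation prob_kept2 := (prob_kept2 P T).
Let p := fine (P [set w | T 1 w != 0]).
Let p0 : 0 < p := second_weight_neq0 M.

(** The ratio [rho] per scale encodes a power of [1 / |t|], without real exponents.
    Only finitely many scales are asked for at a time, so that finitely many
    branching operations produce the part [h]. *)
Definition geometric_decay (eps rho r m : R) : Prop :=
  forall n, exists h, [/\ weight h, m <= Ex mu h &
    forall k t, (k <= n)%N -> r / eps ^+ k <= normc t -> normc (ft mu h t) <= rho ^+ k].

(** Iterating the complement of the extinction step from the whole law. The masses
    stay above the survival probability [m] of the pruned family, the fixed point of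
    the step, and each generation contributes the factor
    [rho = 1 - prob_kept2 eps (1 - eta)], less than 1 by the Cramer bound [eta]. *)
Lemma geometric_decay_survival : exists eps rho m,
  [/\ 0 < eps < 1, 0 <= rho < 1, 0 < m, 0 < prob_kept2 eps & geometric_decay eps rho 1 m].
Proof.
have p40 : 0 < p / 4 by rewrite divr_gt0.
have [eps /andP[eps0 eps1] [p1e p2e]] := pruning M p40; rewrite -/p in p2e.
have p2pos : 0 < prob_kept2 eps by move: p2e p0; lra.
have mean : 1 < prob_kept1 eps + prob_kept2 eps by move: p1e p2e p0; lra.
have [eta /andP[eta0 eta1] phieta] := cramer_condition M eps0 mean.
have p1le := prob_kept1_le1 M eps; have p21 := prob_kept2_le_kept1 M eps.
pose m := 1 - (1 - prob_kept1 eps) / prob_kept2 eps.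
have mE : prob_kept2 eps * (1 - m) = 1 - prob_kept1 eps.
  by rewrite /m opprB addrCA subrr addr0 mulrC divfK// gt_eqF.
have m0 : 0 < m by rewrite subr_gt0 ltr_pdivrMr// mul1r; move: mean; lra.
pose rho := prob_kept1 eps - prob_kept2 eps + prob_kept2 eps * (eta + (1 - m)).
have rhoE : rho = 1 - prob_kept2 eps * (1 - eta) by rewrite /rho mulrDr mE; ring.
have rho1 : rho < 1 by rewrite rhoE gtrBl mulr_gt0// subr_gt0.
have rho0 : 0 <= rho.
  by rewrite rhoE subr_ge0 mulr_ile1 ?subr_ge0 ?(ltW p2pos) ?(ltW eta1)// ?(le_trans p21)// gerBl.
exists eps, rho, m; split; rewrite ?eps0 ?rho0//.
elim=> [|n [h [wh hm hk]]].
  exists (fun=> 1); split; first exact: weight1.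
    by rewrite Ex_cst /m gerBl divr_ge0 ?subr_ge0// ltW.
  by move=> k t; rewrite leqn0 => /eqP-> _; rewrite expr0; exact: phi_le1.
have [h' [wh' mh' fh']] := or_operation M eps wh.
have /andP[hm0 hm1] := weight_mean mu wh.
exists h'; split=> //.
  rewrite mh'; have := hm; set x := Ex mu h in hm0 hm1 * => mx.
  have -> : m = m * (prob_kept1 eps + prob_kept2 eps * (1 - m)) by rewrite mE; ring.
  have : 0 <= (x - m) * (prob_kept1 eps + prob_kept2 eps - prob_kept2 eps * (x + m)).
    rewrite mulr_ge0 ?subr_ge0//.
    have m1 : m <= 1 by rewrite (le_trans mx).
    have : prob_kept2 eps * (x + m) <= prob_kept2 eps * 2 by rewrite ler_wpM2l ?(ltW p2pos)//; lra.
    by move: p21; lra.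
  by lra.
move=> [|k] t kn tk; first by rewrite expr0; exact: normc_ft_weight_le1.
have tk' : 1 / eps ^+ k <= eps * normc t.
  rewrite -ler_pdivrMl// (le_trans _ tk)// !div1r exprS invfM.
  by rewrite le_eqVlt; apply/orP; left; apply/eqP; rewrite mulrC.
have bc s : eps * normc t <= normc s -> normc (ft mu h s) <= rho ^+ k /\ phi s <= eta.
  move=> st; split; first by apply: hk => //; exact: le_trans st.
  apply: phieta; rewrite (le_trans _ st)// (le_trans _ tk')// (le_trans (ltW eps1))//.
  by rewrite div1r invf_ge1 ?exprn_gt0// exprn_ile1// ltW.
apply: (le_trans (fh' t _ _ bc)); rewrite exprSr ler_wpM2l ?exprn_ge0//.
rewrite /rho lerD2l ler_wpM2l ?(ltW p2pos)// lerD2l lerD2l lerN2//.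
Qed.

(** Two surviving children: the price is in the mass and in the initial scale. *)
Lemma geometric_decay_square eps rho r m : 0 < eps -> 0 <= rho ->
  0 <= m -> geometric_decay eps rho r m ->
  geometric_decay eps (rho ^+ 2) (r / eps) (prob_kept2 eps * m ^+ 2).
Proof.
move=> eps0 rho0 m0 gd n; have [h [wh hm hk]] := gd n.
have [h' [wh' mh' fh']] := and_operation M eps wh.
exists h'; split=> //.
  rewrite mh' ler_wpM2l ?prob_kept2_ge0// ler_pXn2r// nnegrE// (le_trans m0)//.
move=> k t kn tk; rewrite -exprM mulnC exprM; apply: fh' => s st; apply: hk => //.
rewrite (le_trans _ st)// -ler_pdivrMl// (le_trans _ tk)// mulrA [_^-1 * _]mulrC.
by rewrite le_eqVlt eqxx.
Qed.

(** The order 4 makes the bound summable over the integer lattice. The part [h] may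
    depend on the error [kappa], which stands for the frequencies beyond the finitely
    many scales under control; the constant [C] may not. *)
Definition quartic_decay (m : R) : Prop :=
  exists2 C, 1 <= C & forall kappa, 0 < kappa ->
    exists h, [/\ weight h, m <= Ex mu h &
      forall t, t != 0 -> normc (ft mu h t) <= C / normc t ^+ 4 + kappa].

(** Once the ratio is at most [eps ^ 4], decay along the scales [r / eps ^ k] is
    decay of order 4; the error term accounts for the scales beyond the last one. *)
Lemma geometric_to_quartic eps rho r m : 0 < eps < 1 -> 0 <= rho -> 0 < r ->
  rho <= eps ^+ 4 -> geometric_decay eps rho r m -> quartic_decay m.
Proof.
move=> /andP[eps0 eps1] rho0 r0 rhoeps gd.
have e40 : 0 < eps ^+ 4 by exact: exprn_gt0.
have r40 : 0 < r ^+ 4 by exact: exprn_gt0.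
pose C := Num.max 1 (r ^+ 4 / eps ^+ 4).
exists C; first by rewrite le_max lexx.
have Cr : r ^+ 4 / eps ^+ 4 <= C by rewrite le_max lexx orbT.
have e41 : eps ^+ 4 < 1 by rewrite exprn_ilt1// ltW.
move=> kappa kappa0.
have [n _ /(_ n (leqnn n)) en] : \forall n \near \oo, (eps ^+ 4) ^+ n <= kappa.
  have := @cvg_expr R (eps ^+ 4); rewrite ger0_norm ?(ltW e40)// => /(_ e41).
  move=> /cvgrPdist_le /(_ _ kappa0); apply: filterS => n.
  by rewrite sub0r normrN; apply: le_trans; rewrite ler_norm.
have [h [wh hm hk]] := gd n; exists h; split=> // t t0.
have nt : 0 < normc t by rewrite lt_def normc_eq0 t0 normc_ge0.
have nt4 : 0 < normc t ^+ 4 by exact: exprn_gt0.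
have hb k : (k <= n)%N -> r / eps ^+ k <= normc t -> normc (ft mu h t) <= (eps ^+ 4) ^+ k.
  move=> kn tk; rewrite (le_trans (hk k t kn tk))// lerXn2r ?nnegrE//; exact: ltW.
have [tr|rt] := ltP (normc t) r.
  apply: (le_trans (normc_ft_weight_le1 mu t wh)); rewrite ler_wpDr ?(ltW kappa0)//.
  rewrite ler_pdivlMr// mul1r (le_trans _ Cr)//.
  apply: (@le_trans _ _ (r ^+ 4)); first by rewrite lerXn2r ?nnegrE ?ltW.
  by rewrite ler_pdivlMr// ler_piMr// ltW.
have [k [kn tk kmax]] : exists k, [/\ (k <= n)%N, r / eps ^+ k <= normc t &
    (k = n \/ normc t < r / eps ^+ k.+1)].
  elim: n {gd en hm hk hb} => [|n [k [kn tk kmax]]].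
    by exists 0%N; rewrite expr0 divr1; split=> //; left.
  have [tn|tn] := leP (r / eps ^+ n.+1) (normc t); first by exists n.+1; split=> //; left.
  exists k; split=> //; first exact: leqW.
  by right; case: kmax => [->|].
apply: (le_trans (hb k kn tk)); case: kmax => [->|tk1].
  by rewrite ler_wpDl// divr_ge0 ?(ltW nt4)// (le_trans _ Cr)// divr_ge0// ltW.
rewrite ler_wpDr ?(ltW kappa0)// ler_pdivlMr// (le_trans _ Cr)//.
rewrite -exprM mulnC exprM -exprMn -exprVn -exprMn lerXn2r ?nnegrE//.
- by rewrite mulr_ge0 ?exprn_ge0 ?(ltW eps0)// ltW.
- by rewrite divr_ge0// ltW.
have := ltW tk1; rewrite exprS invfM mulrA => le1.
apply: (le_trans (ler_wpM2l (exprn_ge0 k (ltW eps0)) le1)).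
by rewrite mulrCA mulfV ?mulr1// expf_neq0// gt_eqF.
Qed.

(** Squaring finitely often brings the ratio below [eps ^ 4], for the same [eps]. *)
Lemma quartic_decay_exists : exists2 m, 0 < m & quartic_decay m.
Proof.
have [eps [rho [m [/andP[eps0 eps1] /andP[rho0 rho1] m0 p20 gd]]]] := geometric_decay_survival.
have gdj j : exists r m, [/\ 0 < r, 0 < m & geometric_decay eps (rho ^+ (2 ^ j)) r m].
  elim: j => [|j [r [m' [r0 m'0 gd']]]]; first by exists 1, m.
  exists (r / eps), (prob_kept2 eps * m' ^+ 2); split; first by rewrite divr_gt0.
    by rewrite mulr_gt0// exprn_gt0.
  rewrite expnS mulnC exprM; apply: geometric_decay_square => //; last exact: ltW.
  exact: exprn_ge0.
have [n _ /(_ n (leqnn n)) rhon] : \forall n \near \oo, rho ^+ n <= eps ^+ 4.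
  have := @cvg_expr R rho; rewrite ger0_norm// => /(_ rho1).
  move=> /cvgrPdist_le /(_ _ (exprn_gt0 4 eps0)); apply: filterS => n.
  by rewrite sub0r normrN; apply: le_trans; rewrite ler_norm.
have [r [m' [r0 m'0 gd']]] := gdj n; exists m' => //.
apply: (geometric_to_quartic _ _ r0 _ gd'); rewrite ?eps0//; first exact: exprn_ge0.
apply: le_trans rhon; rewrite ler_wiXn2l//; first exact: ltW.
by rewrite ltnW// ltn_expl.
Qed.

(** One generation of reproduction only multiplies the constant and the error. *)
Lemma quartic_decay_grow eps m : 0 < eps -> quartic_decay m -> 0 <= m <= 1 ->
  quartic_decay (m * (prob_kept1 eps + prob_kept2 eps * (1 - m))).
Proof.
move=> eps0 [C C1 Ch] /andP[m0 m1].
have p1le := prob_kept1_le1 M eps; have p21 := prob_kept2_le_kept1 M eps; have p20 := prob_kept2_ge0 P T eps.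
have e40 : 0 < eps ^+ 4 by exact: exprn_gt0.
exists (Num.max 1 (2 * C / eps ^+ 4)); first by rewrite le_max lexx.
move=> kappa kappa0; have k20 : 0 < kappa / 2 by rewrite divr_gt0.
have [h [wh hm ht]] := Ch _ k20.
have [h' [wh' mh' fh']] := or_operation M eps wh.
have /andP[hm0 hm1] := weight_mean mu wh.
exists h'; split=> //.
  rewrite mh'; set x := Ex mu h in hm hm0 hm1 *.
  have : 0 <= (x - m) * (prob_kept1 eps + prob_kept2 eps - prob_kept2 eps * (x + m)).
    rewrite mulr_ge0 ?subr_ge0//.
    have : prob_kept2 eps * (x + m) <= prob_kept2 eps * 2 by rewrite ler_wpM2l//; lra.
    by move: p21; lra.
  by lra.
move=> t t0; have nt : 0 < normc t by rewrite lt_def normc_eq0 t0 normc_ge0.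
pose b := C / (eps * normc t) ^+ 4 + kappa / 2.
have b0 : 0 <= b.
  by rewrite addr_ge0 ?(ltW k20)// divr_ge0 ?exprn_ge0 ?mulr_ge0 ?(ltW eps0) ?(ltW nt)// (le_trans ler01).
have bc s : eps * normc t <= normc s -> normc (ft mu h s) <= b /\ phi s <= 1.
  move=> st; split; last exact: phi_le1.
  have ent : 0 < eps * normc t by rewrite mulr_gt0.
  have ns : 0 < normc s by exact: lt_le_trans st.
  have s0 : s != 0 by rewrite -normc_eq0 gt_eqF.
  apply: (le_trans (ht s s0)); rewrite lerD2r ler_wpM2l ?(le_trans ler01)//.
  by rewrite lef_pV2 ?posrE ?exprn_gt0// lerXn2r ?nnegrE// ltW.
apply: (le_trans (fh' t _ _ bc)).
apply: (@le_trans _ _ (b * 2)).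
  rewrite ler_wpM2l//.
  have : prob_kept2 eps * (1 + (1 - Ex mu h)) <= prob_kept2 eps * 2 by rewrite ler_wpM2l//; lra.
  by move: p21 p1le; lra.
rewrite /b mulrDl divfK ?pnatr_eq0// lerD2r exprMn invfM.
rewrite mulrAC mulrA [C * 2]mulrC ler_wpM2r ?invr_ge0 ?exprn_ge0 ?(ltW nt)//.
by rewrite le_max lexx orbT.
Qed.

(** For [m < 1] and a small threshold, masses below [m] are enlarged by a factor
    [lam > 1] at each generation. *)
Lemma quartic_decay_full m : 0 <= m < 1 -> quartic_decay m.
Proof.
move=> /andP[m0 m1].
have [m' m'0 qm'] := quartic_decay_exists.
have e0 : 0 < p * (1 - m) / 4 by rewrite divr_gt0// mulr_gt0// subr_gt0.
have [eps /andP[eps0 eps1] [p1e p2e]] := pruning M e0; rewrite -/p in p2e.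
pose lam := prob_kept1 eps + prob_kept2 eps * (1 - m).
have p1le := prob_kept1_le1 M eps; have p20 := prob_kept2_ge0 P T eps.
have lam1 : 1 < lam.
  rewrite /lam.
  have : (p - 2 * (p * (1 - m) / 4)) * (1 - m) <= prob_kept2 eps * (1 - m).
    by rewrite ler_wpM2r// subr_ge0 ltW.
  have : p * (1 - m) * m >= 0 by rewrite !mulr_ge0 ?subr_ge0// ltW.
  have : 0 < p * (1 - m) by rewrite mulr_gt0// subr_gt0.
  move: p1e; nra.
have mono x y : y <= x -> quartic_decay x -> quartic_decay y.
  move=> yx [C C1 Ch]; exists C => // kappa /Ch[h [wh hm ht]].
  by exists h; split=> //; exact: le_trans hm.
have grow n : quartic_decay (Num.min m (lam ^+ n * m')).
  elim: n => [|n IHn].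
    by apply: mono qm'; rewrite expr0 mul1r ge_min lexx orbT.
  set x := Num.min _ _ in IHn.
  have x0 : 0 <= x by rewrite le_min m0 mulr_ge0 ?exprn_ge0 ?(le_trans ler01 (ltW lam1)) ?(ltW m'0).
  have xm : x <= m by rewrite ge_min lexx.
  have x01 : 0 <= x <= 1 by rewrite x0 (le_trans xm)// ltW.
  apply: mono (quartic_decay_grow eps0 IHn x01).
  have lx : lam <= prob_kept1 eps + prob_kept2 eps * (1 - x) by rewrite lerD2l ler_wpM2l// lerD2l lerN2.
  apply: (@le_trans _ _ (x * lam)); last exact: ler_wpM2l.
  have [mn|nm] := leP m (lam ^+ n * m').
    have -> : x = m by rewrite /x min_l.
    by rewrite ge_min ler_peMr// ltW.
  have -> : x = lam ^+ n * m' by rewrite /x min_r// ltW.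
  by rewrite ge_min exprSr -mulrA mulrCA [_ * lam]mulrC lexx orbT.
have [n mn] : exists n, m <= lam ^+ n * m'.
  have lin n : 1 + n%:R * (lam - 1) <= lam ^+ n.
    elim: n => [|n IHn]; first by rewrite mul0r addr0 expr0.
    rewrite exprS; apply: (@le_trans _ _ (lam * (1 + n%:R * (lam - 1)))); last first.
      by rewrite ler_wpM2l// (le_trans ler01)// ltW.
    have n0 : 0 <= n%:R :> R by [].
    have : 0 <= n%:R * (lam - 1) * (lam - 1) by rewrite !mulr_ge0 ?subr_ge0 ?(ltW lam1).
    rewrite -natr1; nra.
  pose n := Num.bound (m / m' / (lam - 1)).
  exists n; rewrite -ler_pdivrMr// (le_trans _ (lin n))// ler_wpDl//.
  rewrite -ler_pdivrMr ?subr_gt0// ltW// archi_boundP//.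
  by rewrite !divr_ge0 ?subr_ge0 ?(ltW lam1) ?(ltW m'0).
by have := grow n; rewrite min_l.
Qed.

End decay.

(** * Mass of squares *)

Section sums.
Context (R : realType).

Lemma bounded_mf_sum (d : measure_display) (S : measurableType d)
    (I : Type) (r : seq I) (f : I -> S -> R) : (forall i, bounded_mf (f i)) ->
  bounded_mf (fun x => \sum_(i <- r) f i x).
Proof.
move=> bf; elim: r => [|i r IH].
  by under eq_fun do rewrite big_nil; exact: bounded_mf_cst.
by under eq_fun do rewrite big_cons; exact: bounded_mfD.
Qed.

Lemma Ex_sum (d : measure_display) (S : measurableType d) (P : probability S R)
    (I : Type) (r : seq I) (f : I -> S -> R) : (forall i, bounded_mf (f i)) ->
  Ex P (fun x => \sum_(i <- r) f i x) = \sum_(i <- r) Ex P (f i).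
Proof.
move=> bf; elim: r => [|i r IH].
  by under eq_Ex do rewrite big_nil; rewrite Ex_cst big_nil.
under eq_Ex do rewrite big_cons; rewrite ExD// ?IH ?big_cons//.
exact: bounded_mf_sum.
Qed.

(** Telescoping against [2 / (i (i + 1))]. *)
Lemma sum_inv_sqr_le (n : nat) : \sum_(0 <= i < n) (1 + i%:R ^+ 2)^-1 <= 3 :> R.
Proof.
suff h m : \sum_(0 <= i < m.+1) (1 + i%:R ^+ 2)^-1 <= 3 - 2 / m.+1%:R :> R.
  case: n => [|n]; first by rewrite big_geq.
  by rewrite (le_trans (h n))// gerBl divr_ge0.
elim: m => [|m IHm]; first by rewrite big_nat1 expr0n /= addr0 invr1; lra.
rewrite big_nat_recr//=; apply: (le_trans (lerD IHm (lexx _))).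
set x : R := m.+1%:R; have x1 : 1 <= x by rewrite ler1n.
have -> : m.+2%:R = x + 1 :> R by rewrite -natr1.
have x0 : 0 < x by rewrite (lt_le_trans ltr01).
have h : (1 + x ^+ 2)^-1 <= 2 / x - 2 / (x + 1).
  have -> : 2 / x - 2 / (x + 1) = ((x * (x + 1)) / 2)^-1.
    by field; rewrite !gt_eqF// ltr_wpDl// ltW.
  rewrite lef_pV2 ?posrE; first by nra.
    by rewrite ltr_wpDr// sqr_ge0.
  by rewrite divr_gt0// mulr_gt0// ltr_wpDl// ltW.
by move: h; set u := (1 + _)^-1; set v := 2 / x; set w := 2 / (x + 1); lra.
Qed.

Lemma sum_inv_dist_le (n a : nat) : (a < n)%N ->
  \sum_(b < n) (1 + (a%:R - b%:R) ^+ 2)^-1 <= 6 :> R.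
Proof.
move=> an; rewrite -(big_mkord xpredT (fun b => (1 + (a%:R - b%:R) ^+ 2)^-1 : R)).
rewrite (big_cat_nat _ (n := a.+1))//= [leRHS](_ : _ = 3 + 3); last by lra.
apply: lerD.
  rewrite big_nat_rev /=.
  apply: le_trans (sum_inv_sqr_le a.+1); rewrite le_eqVlt; apply/orP; left; apply/eqP.
  apply: eq_big_nat => i /andP[_ ia]; congr (_ + _ ^+ 2)^-1.
  by rewrite add0n subSS natrB// opprB addrCA subrr addr0.
rewrite -{1}[a.+1]add0n big_addn.
apply: (@le_trans _ _ (\sum_(0 <= i < n - a.+1) (1 + i%:R ^+ 2)^-1)); last exact: sum_inv_sqr_le.
apply: ler_sum_nat => i _; rewrite lef_pV2 ?posrE ?ltr_wpDr ?sqr_ge0// lerD2l.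
have i0 : 0 <= i%:R :> R by [].
have -> : a%:R - (i + a.+1)%:R = - (i%:R + 1) :> R by rewrite natrD -[a.+1%:R]natr1; ring.
nra.
Qed.

End sums.

Section square.
Context (R : realType) (mu : probability R[i] R).
Variables (h : R[i] -> R) (C kappa : R).
Hypotheses (wh : weight h) (C1 : 1 <= C) (kappa0 : 0 <= kappa).
Hypothesis decay : forall t, t != 0 -> normc (ft mu h t) <= C / normc t ^+ 4 + kappa.

Variables (n : nat) (n0 : (0 < n)%N) (z0 : R[i]).

Let I : Type := ('I_n * 'I_n)%type.
Let freq (s : I) : R[i] := Complex s.1%:R s.2%:R.

Definition square : set R[i] :=
  [set z | `|complex.Re z - complex.Re z0| <= (2 * n%:R)^-1 /\
           `|complex.Im z - complex.Im z0| <= (2 * n%:R)^-1].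

Lemma measurable_square : measurable square.
Proof.
have mc (f : R[i] -> R) (c : R) : measurable_fun setT f ->
    measurable [set z | `|f z - c| <= (2 * n%:R)^-1].
  move=> mf; have mg : measurable_fun setT (fun z => `|f z - c|).
    by apply: measurableT_comp => //; exact: measurable_funB.
  have := mg measurableT _ (@measurable_itv R `]-oo, (2 * n%:R)^-1]).
  by congr measurable; apply/seteqP; split => z /=; rewrite in_itv/=; [case|].
by apply: measurableI; apply: mc; [exact: measurable_Re|exact: measurable_Im].
Qed.

Let angle s z := complex.Re (freq s * (z - z0)).

(** The double sum is the Fejer kernel [|sum_s exp (i angle s)| ^ 2], hence
    nonnegative; on the square all angles are at most 1, so each of the [n ^ 2]
    cosines is at least 1/2. *)
Lemma fejer_kernel z :
  n%:R ^+ 4 / 4 * \1_square z <= \sum_(s : I) \sum_(s' : I) cos (angle s z - angle s' z) :> R.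
Proof.
have -> : \sum_(s : I) \sum_(s' : I) cos (angle s z - angle s' z) =
    (\sum_(s : I) cos (angle s z)) ^+ 2 + (\sum_(s : I) sin (angle s z)) ^+ 2 :> R.
  rewrite !expr2 !big_distrlr -big_split /=; apply: eq_bigr => s _.
  by rewrite -big_split /=; apply: eq_bigr => s' _; rewrite cosB.
rewrite indicE; have [zQ|_] := boolP (z \in square); last first.
  by rewrite mulr0 addr_ge0 ?sqr_ge0.
rewrite mulr1 -[leLHS]addr0 lerD ?sqr_ge0//.
have nR : 0 < n%:R :> R by rewrite ltr0n.
have an (s : I) : `|angle s z| <= 1.
  move: zQ; rewrite inE => -[zr zi].
  rewrite /angle complexReM /= complexReD complexImD.
  have ReN (u : R[i]) : complex.Re (- u) = - complex.Re u by case: u.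
  have ImN (u : R[i]) : complex.Im (- u) = - complex.Im u by case: u.
  have s1 : `|s.1%:R| <= n%:R :> R by rewrite normr_nat ler_nat ltnW.
  have s2 : `|s.2%:R| <= n%:R :> R by rewrite normr_nat ler_nat ltnW.
  rewrite ReN ImN (le_trans (ler_normB _ _))// !normrM.
  apply: (@le_trans _ _ (n%:R * (2 * n%:R)^-1 + n%:R * (2 * n%:R)^-1)).
    by apply: lerD; apply: ler_pM.
  by rewrite le_eqVlt; apply/orP; left; apply/eqP; field; rewrite gt_eqF.
have half (s : I) : 1 / 2 <= cos (angle s z).
  apply: le_trans (cos_ge_quadratic _).
  have : angle s z ^+ 2 <= 1 by rewrite -[leLHS]real_normK ?num_real// exprn_ile1.
  lra.
have : n%:R ^+ 2 / 2 <= \sum_(s : I) cos (angle s z).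
  apply: (@le_trans _ _ (\sum_(s : I) (1 / 2 : R))); last by apply: ler_sum => s _; exact: half.
  rewrite sumr_const card_prod card_ord -[leRHS]mulr_natr natrM.
  by rewrite le_eqVlt; apply/orP; left; apply/eqP; field.
move=> /(lerXn2r 2) h2.
have -> : n%:R ^+ 4 / 4 = (n%:R ^+ 2 / 2) ^+ 2 :> R by field.
by apply: h2; rewrite nnegrE ?divr_ge0 ?sqr_ge0// sumr_ge0// => s _; rewrite (le_trans _ (half s)).
Qed.

Let bh := weight_bounded wh.

(** Up to a phase, the left-hand side is the real part of the Fourier transform at
    the difference of the two frequencies. *)
Lemma Ex_cos_le s s' : Ex mu (fun z => cos (angle s z - angle s' z) * h z) <=
  normc (ft mu h (freq s - freq s')).
Proof.
set u := freq s - freq s'.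
have aE z : angle s z - angle s' z = complex.Re (u * (z - z0)).
  by rewrite /angle /u mulrBl complexReD; congr (_ + _); case: (freq s' * _).
have bf := bounded_cmf_ft_integrand u bh.
apply: (@le_trans _ _ (complex.Re (char u (- z0) * ft mu h u))).
  rewrite -cExZ// le_eqVlt; apply/orP; left; apply/eqP.
  change (Ex mu (fun z => cos (angle s z - angle s' z) * h z) = Ex mu (fun z =>
    complex.Re (char u (- z0) * (Complex (h z) 0 * char u z)))).
  apply: eq_Ex => z.
  rewrite aE mulrCA -charDr [RHS]complexReM [X in _ = _ - X]mul0r subr0 mulrC.
  by rewrite [- z0 + z]addrC.
by rewrite (le_trans (ler_norm _))// (le_trans (normr_Re_le _))// normcM normc_char mul1r.
Qed.

(** A bound of product form, summable over the grid: differences of distinct grid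
    points have modulus at least 1, which is where decay of order 4 enters. *)
Lemma decay_product (s s' : I) : normc (ft mu h (freq s - freq s')) <=
  4 * C * ((1 + (s.1%:R - s'.1%:R) ^+ 2)^-1 * (1 + (s.2%:R - s'.2%:R) ^+ 2)^-1) + kappa.
Proof.
set a : R := s.1%:R - s'.1%:R; set b : R := s.2%:R - s'.2%:R.
have uE : freq s - freq s' = Complex a b by [].
have a20 := sqr_ge0 a; have b20 := sqr_ge0 b.
have C0 : 0 <= C by rewrite (le_trans ler01).
have [/eqP|u0] := eqVneq (freq s - freq s') 0.
  rewrite uE eq_complex /= => /andP[/eqP-> /eqP->].
  rewrite expr0n /= addr0 invr1 mulr1 mulr1 ler_wpDr//.
  by rewrite (le_trans (normc_ft_weight_le1 _ _ wh))//; move: C1; lra.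
apply: (le_trans (decay u0)); rewrite lerD2r uE.
have u2 : normc (Complex a b) ^+ 2 = a ^+ 2 + b ^+ 2 by rewrite normc_sqr.
have ab1 : 1 <= a ^+ 2 + b ^+ 2.
  have int1 (i j : nat) : (i%:R - j%:R : R) = 0 \/ 1 <= (i%:R - j%:R : R) ^+ 2.
    have [->|ij] := eqVneq i j; first by left; rewrite subrr.
    right; rewrite -[leRHS]real_normK ?num_real// expr_ge1//.
    have [ij'|ij'] := ltnP i j.
      rewrite ler0_norm ?subr_le0 ?ler_nat ?(ltnW ij')// opprB -natrB ?(ltnW ij')//.
      by rewrite ler1n subn_gt0.
    rewrite ger0_norm ?subr_ge0 ?ler_nat// -natrB// ler1n subn_gt0.
    by rewrite ltn_neqAle eq_sym ij.
  have [a0|a1] := int1 s.1 s'.1; last by rewrite -/a in a1; move: a1 b20; lra.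
  have [b0|b1] := int1 s.2 s'.2; last by rewrite -/b in b1; move: b1 a20; lra.
  by move: u0; rewrite uE /a /b a0 b0 eqxx.
rewrite -mulrA mulrCA ler_wpM2l// -invfM -[4]invrK -invfM lef_pV2 ?posrE; last 2 first.
- by rewrite (_ : 4%N = (2 * 2)%N)// exprM u2 exprn_gt0// (lt_le_trans ltr01).
- by rewrite mulr_gt0 ?invr_gt0// mulr_gt0// ltr_wpDr.
rewrite (_ : 4%N = (2 * 2)%N)// exprM u2.
set x := a ^+ 2 in a20 ab1 *; set y := b ^+ 2 in b20 ab1 *.
nra.
Qed.

(** Integrate the Fejer kernel. The double sum has [n ^ 2] rows, each at most
    [4 C * 6 * 6], against [n ^ 4 / 4]: this is of the order of the area. *)
Lemma square_mass : Ex mu (fun z => \1_square z * h z) <= 576 * C / n%:R ^+ 2 + 4 * kappa.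
Proof.
have nR : 0 < n%:R :> R by rewrite ltr0n.
have n4 : 0 < n%:R ^+ 4 / 4 :> R by rewrite divr_gt0// exprn_gt0.
have C0 : 0 <= C by rewrite (le_trans ler01).
have bQ : bounded_mf (\1_square : R[i] -> R) by exact/bounded_mf_indic/measurable_square.
have bQh : bounded_mf (fun z => \1_square z * h z) by exact: bounded_mfM.
rewrite -(ler_pM2l n4) -ExZ//.
have bc s s' : bounded_mf (fun z => cos (angle s z - angle s' z) * h z).
  apply: bounded_mfM => //; apply: bounded_mf_cos.
  have ma t : measurable_fun setT (angle t).
    apply: measurable_fun_Re; apply: measurable_complexM => //.
    exact: measurable_complexD.
  exact: measurable_funB.
apply: (@le_trans _ _ (Ex mu (fun z => \sum_(s : I) \sum_(s' : I) cos (angle s z - angle s' z) * h z))).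
  apply: le_Ex => //.
  - by apply: bounded_mfM => //; exact: bounded_mf_cst.
  - by apply: bounded_mf_sum => s; apply: bounded_mf_sum => s'.
  move=> z; rewrite mulrA; have [_ h01] := wh; have /andP[h0 _] := h01 z.
  apply: (le_trans (ler_wpM2r h0 (fejer_kernel z))).
  rewrite mulr_suml; apply: ler_sum => s _; by rewrite mulr_suml.
rewrite Ex_sum; last by move=> s; apply: bounded_mf_sum.
apply: (@le_trans _ _ (\sum_(s : I) (144 * C + n%:R ^+ 2 * kappa))).
  apply: ler_sum => s _; rewrite Ex_sum//.
  apply: (@le_trans _ _ (\sum_(s' : I) (4 * C * ((1 + (s.1%:R - s'.1%:R) ^+ 2)^-1 *
      (1 + (s.2%:R - s'.2%:R) ^+ 2)^-1) + kappa))).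
    by apply: ler_sum => s' _; exact: le_trans (Ex_cos_le s s') (decay_product s s').
  rewrite big_split /= -mulr_sumr sumr_const card_prod card_ord -[kappa *+ _]mulr_natl natrM -expr2 lerD2r.
  rewrite (_ : 144 * C = 4 * C * (6 * 6)); last by ring.
  apply: ler_wpM2l; first by rewrite mulr_ge0.
  rewrite -(pair_bigA _ (fun i j : 'I_n => (1 + (s.1%:R - i%:R) ^+ 2)^-1 *
      (1 + (s.2%:R - j%:R) ^+ 2)^-1 : R)) /= -big_distrlr /=.
  have pos (a : R) : 0 <= \sum_(i < n) (1 + (a - i%:R) ^+ 2)^-1.
    by apply: sumr_ge0 => i _; rewrite invr_ge0 addr_ge0 ?sqr_ge0.
  by apply: ler_pM => //; exact: sum_inv_dist_le.
rewrite sumr_const card_prod card_ord -[leLHS]mulr_natl natrM.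
by rewrite le_eqVlt; apply/orP; left; apply/eqP; field; rewrite gt_eqF.
Qed.

End square.

(** * From squares to measurable sets *)

Section approximation.
Context (R : realType) (d : measure_display) (S : measurableType d).
Variables (rho : {measure set S -> \bar R}) (C : set (set S)).
Hypotheses (rho_fin : (rho setT < +oo)%E) (Cm : C `<=` measurable).
Hypotheses (C0 : C set0) (CC : forall A, C A -> C (~` A))
  (CU : forall A B, C A -> C B -> C (A `|` B)).

Definition symdiff (A B : set S) := (A `\` B) `|` (B `\` A).

Definition approximable (A : set S) : Prop := measurable A /\
  forall e : R, 0 < e -> exists2 B, C B & (rho (symdiff A B) <= e%:E)%E.

Lemma measurable_symdiff A B : measurable A -> measurable B -> measurable (symdiff A B).
Proof. by move=> mA mB; apply: measurableU; exact: measurableD. Qed.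

Let leU A B D : measurable A -> measurable B -> measurable D -> A `<=` B `|` D ->
  (rho A <= rho B + rho D)%E.
Proof.
move=> mA mB mD AB; apply: (@le_trans _ _ (rho (B `|` D))).
  by apply: le_measure; rewrite ?inE//; exact: measurableU.
exact: measureU2.
Qed.

Lemma approximable_sub A : C A -> approximable A.
Proof.
move=> CA; split; first exact: Cm.
move=> e e0; exists A => //; rewrite /symdiff setDv setU0 measure0 lee_fin ltW//.
Qed.

Lemma approximableC A : approximable A -> approximable (~` A).
Proof.
move=> [mA hA]; split; first exact: measurableC.
move=> e /hA[B CB AB]; exists (~` B); first exact: CC.
rewrite (_ : symdiff _ _ = symdiff A B)//.
by rewrite /symdiff !setDE !setCK setUC; congr (_ `|` _); rewrite setIC.
Qed.

Lemma approximableU A B : approximable A -> approximable B -> approximable (A `|` B).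
Proof.
move=> [mA hA] [mB hB]; split; first exact: measurableU.
move=> e e0; have e20 : 0 < e / 2 by rewrite divr_gt0.
have [A' CA' AA'] := hA _ e20; have [B' CB' BB'] := hB _ e20.
exists (A' `|` B'); first exact: CU.
have mA' := Cm CA'; have mB' := Cm CB'.
apply: (@le_trans _ _ (rho (symdiff A A') + rho (symdiff B B'))%E).
  apply: leU; [apply: measurable_symdiff; exact: measurableU|exact: measurable_symdiff..|].
  move=> x [[[Ax|Bx] /not_orP[nA nB]]|[[Ax|Bx] /not_orP[nA nB]]].
  - by left; left.
  - by right; left.
  - by left; right.
  - by right; right.
by rewrite [e in leRHS]splitr EFinD leeD.
Qed.

Lemma approximable_bigcup (F : nat -> set S) :
  (forall i, approximable (F i)) -> approximable (\bigcup_i F i).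
Proof.
move=> aF; have mF i : measurable (F i) by have [] := aF i.
have mU : measurable (\bigcup_i F i) by exact: bigcupT_measurable.
split=> // e e0; have e20 : 0 < e / 2 by rewrite divr_gt0.
pose G n := \big[setU/set0]_(i < n) F i.
have aG n : approximable (G n).
  rewrite /G; elim: n => [|n IHn]; first by rewrite big_ord0; exact: approximable_sub.
  by rewrite big_ord_recr /=; exact: approximableU.
have mG n : measurable (G n) by have [] := aG n.
have [n Gn] : exists n, (rho (\bigcup_i F i `\` G n) <= (e / 2)%:E)%E.
  pose D n := \bigcup_i F i `\` G n.
  have mD n : measurable (D n) by exact: measurableD.
  have D0 : \bigcap_n D n = set0.
    rewrite -subset0 => x Dx; have [[i _ Fx] _] := Dx 0%N I.
    have [_] := Dx i.+1 I; apply; rewrite /G -bigcup_mkord; exists i => //=.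
  have := @nonincreasing_cvg_mu _ _ _ rho D; rewrite D0 measure0.
  move=> /(_ _ mD measurable0).
  have -> : (rho (D 0%N) < +oo)%E.
    by apply: le_lt_trans rho_fin; apply: le_measure; rewrite ?inE.
  move=> /(_ isT); have Ddec : {homo D : n m / (n <= m)%N >-> (m <= n)%O}.
    move=> n m nm; apply/subsetPset => x [Ux nG]; split=> // Gx; apply: nG.
    move: Gx; rewrite /G -!bigcup_mkord => -[i /= ilt Fx].
    by exists i => //=; exact: leq_trans nm.
  move=> /(_ Ddec) /fine_cvgP[Dfin /cvgrPdist_le /(_ _ e20) De].
  have [n _ /(_ n (leqnn n))[Dn1 Dn2]] := filterI Dfin De.
  exists n; move: Dn2; rewrite /= sub0r normrN => Dn2.
  rewrite -[leLHS]/((rho \o D) n) -(fineK Dn1) lee_fin.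
  by apply: (le_trans _ Dn2); exact: ler_norm.
have [_ /(_ _ e20)[B CB GB]] := aG n.
exists B => //; have mB := Cm CB.
apply: (@le_trans _ _ (rho (\bigcup_i F i `\` G n) + rho (symdiff (G n) B))%E).
  apply: leU; [exact: measurable_symdiff|exact: measurableD|exact: measurable_symdiff|].
  move=> x [[Ux nB]|[Bx nU]].
    have [Gx|nG] := pselect (G n x); first by right; left.
    by left.
  right; right; split=> // Gx; apply: nU; move: Gx; rewrite /G -bigcup_mkord => -[i _ Fx].
  by exists i.
by rewrite [e in leRHS]splitr EFinD leeD.
Qed.

(** The approximable sets form a sigma-algebra: a countable union is, up to a set of
    small measure, a finite one. *)
Lemma generated_approximable A : <<s C >> A -> approximable A.
Proof.
apply: smallest_sub; last exact: approximable_sub.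
split.
- exact: approximable_sub.
- by move=> B aB; rewrite setTD; exact: approximableC.
- exact: approximable_bigcup.
Qed.

End approximation.

Section dyadic.
Context (R : realType).

Definition dyadic_floor (l : nat) (x : R) : int := Num.floor (2 ^+ l * x).

Definition dyadic_index (l : nat) (z : R[i]) : int * int :=
  (dyadic_floor l (complex.Re z), dyadic_floor l (complex.Im z)).

(** Being saturated for the index of some level is being a union of cells of that
    level; levels are nested, so these sets form an algebra. *)
Definition dyadic_set (B : set R[i]) : Prop :=
  measurable B /\ exists l, forall z z', dyadic_index l z = dyadic_index l z' -> B z -> B z'.

Lemma dyadic_floorS l x x' : dyadic_floor l.+1 x = dyadic_floor l.+1 x' ->
  dyadic_floor l x = dyadic_floor l x'.
Proof.
suff H (y y' : R) : Num.floor (2 * y) = Num.floor (2 * y') -> (Num.floor y <= Num.floor y')%R.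
  rewrite /dyadic_floor !exprS -!mulrA => h.
  by apply/eqP; rewrite eq_le !H.
move=> h; rewrite floor_ge_int.
have /andP[fy _] := floor_itv y.
have : ((2 * Num.floor y)%R <= Num.floor (2 * y)).
  by rewrite floor_ge_int intrM ler_wpM2l.
rewrite h floor_ge_int intrM ler_pM2l//.
Qed.

Lemma dyadic_index_le l m z z' : (l <= m)%N ->
  dyadic_index m z = dyadic_index m z' -> dyadic_index l z = dyadic_index l z'.
Proof.
move=> lm; rewrite -(subnKC lm); elim: (m - l)%N => [|k IHk]; first by rewrite addn0.
rewrite addnS => -[h1 h2]; apply: IHk; congr (_, _); exact: dyadic_floorS.
Qed.

Lemma dyadic_set0 : dyadic_set set0.
Proof. by split=> //; exists 0%N. Qed.

Lemma dyadic_setC B : dyadic_set B -> dyadic_set (~` B).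
Proof.
move=> [mB [l Bl]]; split; first exact: measurableC.
by exists l => z z' zz' nB Bz'; apply: nB; apply: Bl Bz'.
Qed.

Lemma dyadic_setU A B : dyadic_set A -> dyadic_set B -> dyadic_set (A `|` B).
Proof.
move=> [mA [l Al]] [mB [m Bm]]; split; first exact: measurableU.
exists (maxn l m) => z z' zz' [Az|Bz]; [left|right].
  by apply: Al Az; apply: dyadic_index_le zz'; exact: leq_maxl.
by apply: Bm Bz; apply: dyadic_index_le zz'; exact: leq_maxr.
Qed.

Lemma measurable_dyadic_floor l :
  measurable_fun setT (fun x : R => (dyadic_floor l x)%:~R : R).
Proof.
apply: nondecreasing_measurable => // x y xy.
by rewrite ler_int le_floor// ler_pM2l// exprn_gt0.
Qed.

Lemma cvg_dyadic_floor (x : R) :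
  (fun l => (dyadic_floor l x)%:~R / 2 ^+ l) @ \oo --> x.
Proof.
apply/cvgrPdist_le => e e0.
have [n _ nP] : \forall n \near \oo, (2^-1 : R) ^+ n <= e.
  have := @cvg_expr R 2^-1; rewrite ger0_norm// invf_lt1// ltr1n => /(_ isT).
  move=> /cvgrPdist_le /(_ _ e0); apply: filterS => n.
  by rewrite sub0r normrN; apply: le_trans; rewrite ler_norm.
exists n => // l /nP; apply: le_trans.
have l0 : 0 < 2 ^+ l :> R by rewrite exprn_gt0.
have /andP[f1 f2] := floor_itv (2 ^+ l * x).
have -> : x - (dyadic_floor l x)%:~R / 2 ^+ l = (2 ^+ l * x - (dyadic_floor l x)%:~R) / 2 ^+ l.
  by rewrite mulrBl mulrAC mulfV ?mul1r// gt_eqF.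
rewrite normrM exprVn [X in _ * X]ger0_norm ?invr_ge0 ?(ltW l0)// ler_piMl ?invr_ge0 ?(ltW l0)//.
rewrite ger0_norm ?subr_ge0// lerBlDr addrC ltW// (lt_le_trans f2)// intrD.
by rewrite lerD2l.
Qed.

(** The coordinates are limits of functions of the dyadic index. *)
Lemma measurable_generated_dyadic (A : set R[i]) : measurable A -> <<s dyadic_set >> A.
Proof.
pose D : measurableType _ := g_sigma_algebraType dyadic_set.
have mfl (f : R[i] -> R) l : measurable_fun setT f ->
    (forall z z', dyadic_index l z = dyadic_index l z' -> dyadic_floor l (f z) = dyadic_floor l (f z')) ->
    measurable_fun setT (fun z : D => (dyadic_floor l (f z))%:~R / 2 ^+ l : R).
  move=> mf fl _ B mB; apply: sub_sigma_algebra; rewrite setTI; split.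
    have mg : measurable_fun setT (fun z => (dyadic_floor l (f z))%:~R / 2 ^+ l : R).
      by apply: measurable_funM => //; exact: (measurableT_comp (measurable_dyadic_floor l) mf).
    by have := mg measurableT _ mB; rewrite setTI.
  by exists l => z z' /fl; rewrite /= => ->.
have mid : measurable_fun setT (id : D -> R[i]).
  apply: measurable_fun_ReIm.
    apply: (@measurable_fun_cvg _ _ _ _ (fun l (z : D) => (dyadic_floor l (complex.Re z))%:~R / 2 ^+ l : R)) => //.
      by move=> l; apply: mfl; [exact: measurable_Re|move=> z z' [-> _]].
    by move=> z _; exact: cvg_dyadic_floor.
  apply: (@measurable_fun_cvg _ _ _ _ (fun l (z : D) => (dyadic_floor l (complex.Im z))%:~R / 2 ^+ l : R)) => //.
    by move=> l; apply: mfl; [exact: measurable_Im|move=> z z' [_ ->]].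
  by move=> z _; exact: cvg_dyadic_floor.
by move=> mA; have := mid measurableT A mA; rewrite setTI.
Qed.

End dyadic.

Section absolute_continuity.
Context (R : realType) (mu : probability R[i] R).
Local Notation lambda := (complex_lebesgue R).

Definition box (k : nat) : set R[i] :=
  [set z | (- k%:R <= complex.Re z < k%:R) /\ (- k%:R <= complex.Im z < k%:R)].

Definition cell (l : nat) (c : int * int) : set R[i] := [set z | dyadic_index l z = c].

Definition corner (l : nat) (i : int) : R := i%:~R / 2 ^+ l.

Lemma dyadic_floorP l x i : dyadic_floor l x = i <-> corner l i <= x < corner l (i + 1).
Proof.
have l0 : 0 < 2 ^+ l :> R by rewrite exprn_gt0.
rewrite /corner ler_pdivrMr// ltr_pdivlMr// mulrC; split.
  by rewrite /dyadic_floor => <-; exact: floor_itv.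
by move=> h; apply/eqP; rewrite /dyadic_floor floor_eq.
Qed.

Lemma rectangle_lebesgue (I J : set R) : measurable I -> measurable J ->
  measurable [set z : R[i] | I (complex.Re z) /\ J (complex.Im z)] /\
  lambda [set z | I (complex.Re z) /\ J (complex.Im z)] =
    (lebesgue_measure I * lebesgue_measure J)%E.
Proof.
move=> mI mJ; split.
  apply: measurableI.
    by have := @measurable_Re R measurableT I mI; rewrite setTI.
  by have := @measurable_Im R measurableT J mJ; rewrite setTI.
rewrite /complex_lebesgue /pushforward.
rewrite (_ : _ @^-1` _ = I `*` J); first exact: product_measure1E.
by apply/seteqP; split => -[].
Qed.

Lemma itv_set a b : `[a, b[%classic = [set x : R | a <= x < b].
Proof. by apply/seteqP; split => x /=; rewrite in_itv. Qed.

Lemma cellE l i j : cell l (i, j) =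
  [set z | `[corner l i, corner l (i + 1)[%classic (complex.Re z) /\
           `[corner l j, corner l (j + 1)[%classic (complex.Im z)].
Proof.
apply/seteqP; split => z; rewrite /cell /dyadic_index /= !in_itv/=.
  by move=> [hi hj]; split; apply/dyadic_floorP.
by move=> [hi hj]; congr (_, _); apply/dyadic_floorP.
Qed.

Lemma cell_lebesgue l c : measurable (cell l c) /\ lambda (cell l c) = ((2 ^+ l) ^- 2)%:E.
Proof.
case: c => i j; rewrite cellE.
have [mc ->] := rectangle_lebesgue (@measurable_itv R `[corner l i, corner l (i + 1)[)
  (@measurable_itv R `[corner l j, corner l (j + 1)[).
split=> //; rewrite !lebesgue_measure_itv/= !lte_fin.
have l0 : 0 < 2 ^+ l :> R by rewrite exprn_gt0.
have lt k : corner l k < corner l (k + 1).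
  by rewrite /corner ltr_pM2r ?invr_gt0// ltr_int ltzD1.
have d1 k : corner l (k + 1) - corner l k = (2 ^+ l)^-1.
  by rewrite /corner -mulrBl intrD addrAC subrr add0r mul1r.
by rewrite !lt -!EFinB !d1 -EFinM -expr2 exprVn.
Qed.

Lemma measurable_box k : measurable (box k).
Proof.
have [+ _] := rectangle_lebesgue (@measurable_itv R `[- k%:R, k%:R[)
  (@measurable_itv R `[- k%:R, k%:R[).
by rewrite !itv_set.
Qed.

Lemma box_lebesgue_fin k : (lambda (box k) < +oo)%E.
Proof.
have [_] := rectangle_lebesgue (@measurable_itv R `[- k%:R, k%:R[)
  (@measurable_itv R `[- k%:R, k%:R[).
rewrite !itv_set => ->; rewrite -!itv_set !lebesgue_measure_itv /=.
by case: ifP => _; rewrite -?EFinB -?EFinM ?mule0 ?ltry.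
Qed.

Lemma cell_sub_square l c : exists z0, cell l c `<=` square (2 ^ l) z0.
Proof.
case: c => i j; pose mid k : R := corner l k + (2 * 2 ^+ l)^-1.
exists (Complex (mid i) (mid j)); rewrite cellE => z [/=]; rewrite !in_itv/= => zi zj.
have l0 : 0 < 2 ^+ l :> R by rewrite exprn_gt0.
have near k x : corner l k <= x < corner l (k + 1) -> `|x - mid k| <= (2 * (2 ^ l)%:R)^-1.
  have ck : corner l (k + 1) = corner l k + (2 * 2 ^+ l)^-1 + (2 * 2 ^+ l)^-1.
    by rewrite /corner intrD; field; rewrite gt_eqF.
  rewrite ck natrX /mid; set c := corner l k; set u := (2 * _)^-1 => /andP[x1 x2].
  by rewrite ler_norml; apply/andP; split; lra.
by split; exact: near.
Qed.

Section cover.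
Variables (B : set R[i]) (l k : nat).
Hypotheses (mB : measurable B)
  (Bl : forall z z', dyadic_index l z = dyadic_index l z' -> B z -> B z').

Let K := (2 * (k * 2 ^ l))%N.
Let shift (a : 'I_K) : int := a%:Z - (k * 2 ^ l)%N%:Z.
Let acell (a : 'I_K * 'I_K) := cell l (shift a.1, shift a.2).
Let J (a : 'I_K * 'I_K) : bool := `[< exists2 z, B z & acell a z >].

Let shift_inj : injective shift.
Proof. by move=> a b /addIr => -[] /val_inj. Qed.

Let floor_range (x : R) : (- k%:R <= x < k%:R) <-> exists a : 'I_K, dyadic_floor l x = shift a.
Proof.
have l0 : 0 < 2 ^+ l :> R by rewrite exprn_gt0.
have kE : (k * 2 ^ l)%N%:R = k%:R * 2 ^+ l :> R by rewrite natrM natrX.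
split=> [/andP[x1 x2]|[a /dyadic_floorP /andP[x1 x2]]].
  have f1 : - (k * 2 ^ l)%N%:Z <= dyadic_floor l x.
    by rewrite /dyadic_floor floor_ge_int mulrNz -pmulrn kE [2 ^+ l * x]mulrC -mulNr ler_pM2r.
  have f2 : dyadic_floor l x < (k * 2 ^ l)%N%:Z.
    by rewrite /dyadic_floor floor_lt_int -pmulrn kE [2 ^+ l * x]mulrC ltr_pM2r.
  have aK : (`|(dyadic_floor l x + (k * 2 ^ l)%N%:Z)%R|%N < K)%N.
    rewrite -ltz_nat gez0_abs; first by rewrite /K mul2n -addnn PoszD ltrD2r.
    by rewrite -lerBlDr sub0r.
  exists (Ordinal aK); rewrite /shift /= gez0_abs ?addrK//.
  by rewrite -lerBlDr sub0r.
apply/andP; split.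
  apply: le_trans x1; rewrite /corner ler_pdivlMr// /shift intrD mulrNz -!pmulrn kE mulNr.
  by rewrite lerDr.
apply: (lt_le_trans x2); rewrite /corner ler_pdivrMr// -kE pmulrn ler_int /shift.
have := ltn_ord a; rewrite {2}/K mul2n -addnn -ltz_nat PoszD => h.
by rewrite addrAC lerBlDr lezD1.
Qed.

(** Cells of one level that meet [B] lie in [B]. *)
Lemma indic_cover z :
  \1_(B `&` box k) z = \sum_(a : 'I_K * 'I_K | J a) \1_(acell a) z :> R.
Proof.
rewrite indicE; have [|] := boolP (z \in B `&` box k).
  rewrite inE => -[Bz [/floor_range[a ra] /floor_range[b rb]]].
  have zab : acell (a, b) z by rewrite /acell /cell /= /dyadic_index ra rb.
  rewrite (bigD1 (a, b)) /=; last by apply/asboolP; exists z.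
  rewrite indicE mem_set// big1 ?addr0// => -[a' b'] /andP[_ ab].
  rewrite indicE memNset// => -[]; rewrite ra rb => /shift_inj ea /shift_inj eb.
  by rewrite ea eb eqxx in ab.
move=> nz; rewrite big1// => -[a b] /asboolP[z' Bz' z'ab].
rewrite indicE memNset// => zab; move: nz => /negP; apply; rewrite inE; split.
  by apply: Bl Bz'; rewrite z'ab zab.
by move: zab => []; rewrite /= => ra rb; split; apply/floor_range; [exists a|exists b].
Qed.

Lemma cover_lebesgue : lambda (B `&` box k) = (#|J|%:R / (2 ^+ l) ^+ 2)%:E.
Proof.
have mBk : measurable (B `&` box k) by apply: measurableI => //; exact: measurable_box.
have := @integral_indic _ _ R lambda setT measurableT _ mBk; rewrite setIT => <-.
under eq_integral do rewrite indic_cover -big_filter -sumEFin.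
rewrite ge0_integral_sum//; last first.
- by move=> a; apply/measurable_EFinP; apply: measurable_indic; have [] := cell_lebesgue l (shift a.1, shift a.2).
rewrite big_filter (eq_bigr (fun=> ((2 ^+ l) ^- 2)%:E)); last first.
  move=> a _; have [mc cE] := cell_lebesgue l (shift a.1, shift a.2).
  by rewrite integral_indic// setIT.
by rewrite sumEFin sumr_const mulr_natl.
Qed.

Lemma cover_mass (h : R[i] -> R) (C kappa : R) : weight h -> 1 <= C -> 0 <= kappa ->
  (forall t, t != 0 -> normc (ft mu h t) <= C / normc t ^+ 4 + kappa) ->
  Ex mu (fun z => \1_(B `&` box k) z * h z) <=
  #|J|%:R * (576 * C / (2 ^+ l) ^+ 2 + 4 * kappa).
Proof.
move=> wh C1 kappa0 decay; have bh := weight_bounded wh.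
have mc a : measurable (acell a) by have [] := cell_lebesgue l (shift a.1, shift a.2).
have bc a : bounded_mf (fun z => \1_(acell a) z * h z).
  by apply: bounded_mfM => //; exact: bounded_mf_indic.
under eq_Ex do rewrite indic_cover mulr_suml -big_filter.
rewrite Ex_sum// big_filter mulr_natl -sumr_const.
apply: ler_sum => a _.
have [z0 cz0] := cell_sub_square l (shift a.1, shift a.2).
have l0 : (0 < 2 ^ l)%N by rewrite expn_gt0.
have := square_mass wh C1 kappa0 decay l0 z0; rewrite natrX.
apply: le_trans; apply: le_Ex => //.
  by apply: bounded_mfM => //; exact/bounded_mf_indic/measurable_square.
move=> z; have [_ h01] := wh; have /andP[h0 _] := h01 z.
rewrite ler_wpM2r// !indicE.
have [/set_mem za|_] := boolP (z \in acell a); last by [].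
by rewrite mem_set//; exact: cz0.
Qed.

End cover.

(** The error [kappa] of the Fourier bound is paid once per cell; for a fixed [B]
    there are finitely many cells and it can be sent to 0. *)
Lemma dyadic_mass_le m : quartic_decay mu m -> exists2 c, 0 <= c &
  forall B k, dyadic_set B ->
  fine (mu (B `&` box k)) <= 1 - m + c * fine (lambda (B `&` box k)).
Proof.
move=> [C C1 Ch]; exists (576 * C); first by rewrite mulr_ge0// (le_trans ler01).
move=> B k [mB [l Bl]]; rewrite (cover_lebesgue k mB Bl) /=.
set J := #|_|%:R.
have J0 : 0 <= J by [].
apply/ler_addgt0Pr => e e0.
have k0 : 0 < e / (4 * J + 1) by rewrite divr_gt0// ltr_wpDl// mulr_ge0.
have [h [wh hm ht]] := Ch _ k0; have bh := weight_bounded wh.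
have mBk : measurable (B `&` box k) by apply: measurableI => //; exact: measurable_box.
have bI : bounded_mf (\1_(B `&` box k) : R[i] -> R) by exact: bounded_mf_indic.
have bk := weight_bounded (weight_compl wh).
rewrite -Ex_indic//.
have -> : Ex mu \1_(B `&` box k) = Ex mu (fun z => \1_(B `&` box k) z * h z) +
    Ex mu (fun z => \1_(B `&` box k) z * (1 - h z)).
  rewrite -ExD; [|exact: bounded_mfM..].
  by apply: eq_Ex => z; rewrite -mulrDr addrC subrK mulr1.
have le1 : Ex mu (fun z => \1_(B `&` box k) z * (1 - h z)) <= 1 - m.
  apply: (@le_trans _ _ (Ex mu (fun z => 1 - h z))).
    apply: le_Ex => //; first exact: bounded_mfM.
    move=> z; have [_ h01] := weight_compl wh; have /andP[h0 _] := h01 z.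
    by rewrite ler_piMl// indicE; case: (_ \in _).
  by rewrite ExB//; [rewrite Ex_cst lerD2l lerN2|exact: bounded_mf_cst].
have le2 := cover_mass k Bl wh C1 (ltW k0) ht; rewrite -/J in le2.
have le3 : J * (4 * (e / (4 * J + 1))) <= e.
  have d0 : 0 < 4 * J + 1 by rewrite ltr_wpDl// mulr_ge0.
  rewrite mulrCA mulrA mulrA ler_pdivrMr//; nra.
rewrite mulrDr in le2.
have -> : 576 * C * (J / (2 ^+ l) ^+ 2) = J * (576 * C / (2 ^+ l) ^+ 2) by ring.
lra.
Qed.

(** A null set is approximated by dyadic sets of small area, hence of mass little
    more than [1 - m], and [m] can be taken close to 1. *)
Lemma quartic_decay_absolutely_continuous :
  (forall m, 0 <= m < 1 -> quartic_decay mu m) -> mu `<< lambda.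
Proof.
move=> qd; apply/null_content_dominatesP => A mA A0.
have box0 k : mu (A `&` box k) = 0%E.
  have mbox := measurable_box k.
  have mAk : measurable (A `&` box k) by exact: measurableI.
  have lAk : lambda (A `&` box k) = 0%E.
    by apply/eqP; rewrite eq_le measure_ge0 andbT -A0 le_measure ?inE.
  have fmu D : measurable D -> mu D = (fine (mu D))%:E.
    by move=> mD; rewrite fineK// fin_num_measure.
  rewrite fmu//; congr EFin; apply/eqP; rewrite eq_le fine_ge0// andbT.
  apply/ler_addgt0Pr => e e0; rewrite add0r.
  pose m := Num.max 0 (1 - e / 2).
  have m01 : 0 <= m < 1 by rewrite le_max lexx gt_max ltr01 gtrBl divr_gt0.
  have me : 1 - m <= e / 2 by rewrite lerBlDr -lerBlDl le_max lexx orbT.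
  have [c c0 cB] := dyadic_mass_le (qd _ m01).
  pose rho : {measure set R[i] -> \bar R} := measure_add mu (mrestr lambda mbox).
  have rhoE D : rho D = (mu D + lambda (D `&` box k))%E by exact: measure_addE.
  have rho_fin : (rho setT < +oo)%E.
    rewrite rhoE setTI lte_add_pinfty//; last exact: box_lebesgue_fin.
    by rewrite ltey_eq fin_num_measure.
  have [_ ap] := generated_approximable rho_fin (fun B (dB : dyadic_set B) => dB.1)
    (@dyadic_set0 R) (@dyadic_setC R) (@dyadic_setU R) (measurable_generated_dyadic mAk).
  have d0 : 0 < e / (2 * (1 + c)) by rewrite divr_gt0// mulr_gt0// ltr_wpDr.
  have [B dB AB] := ap _ d0.
  have mB := dB.1; have mBk : measurable (B `&` box k) by exact: measurableI.
  have mAB := measurable_symdiff mAk mB.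
  have muAB : (mu (symdiff (A `&` box k) B) <= (e / (2 * (1 + c)))%:E)%E.
    by apply: le_trans AB; rewrite rhoE leeDl.
  have laB : (lambda (B `&` box k) <= (e / (2 * (1 + c)))%:E)%E.
    apply: (@le_trans _ _ (lambda (symdiff (A `&` box k) B `&` box k))); last first.
      by apply: le_trans AB; rewrite rhoE leeDr.
    rewrite -[leRHS]adde0 -lAk.
    apply: (@le_trans _ _ (lambda ((symdiff (A `&` box k) B `&` box k) `|` (A `&` box k)))).
      apply: le_measure; rewrite ?inE//; first by apply: measurableU => //; exact: measurableI.
      move=> x [Bx kx]; have [Ax|nA] := pselect ((A `&` box k) x); first by right.
      by left; split=> //; right.
    by apply: measureU2 => //; exact: measurableI.
  have laB' : fine (lambda (B `&` box k)) <= e / (2 * (1 + c)).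
    rewrite -lee_fin fineK// ge0_fin_numE//.
    by rewrite (le_lt_trans laB)// ltry.
  have muA : fine (mu (A `&` box k)) <= fine (mu (B `&` box k)) + e / (2 * (1 + c)).
    rewrite -lee_fin EFinD -!fmu//.
    apply: (@le_trans _ _ (mu ((B `&` box k) `|` symdiff (A `&` box k) B))).
      apply: le_measure; rewrite ?inE//; first exact: measurableU.
      move=> x Ax; have [Bx|nB] := pselect (B x); last by right; left.
      by left; split=> //; case: Ax.
    by rewrite (le_trans (measureU2 _ mBk mAB))// leeD2l.
  have := cB B k dB; have cl := ler_wpM2l c0 laB'.
  have : e / (2 * (1 + c)) + c * (e / (2 * (1 + c))) = e / 2.
    by field; rewrite gt_eqF// ltr_wpDr.
  lra.
have -> : A = \bigcup_k (A `&` box k).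
  rewrite -setI_bigcupr; apply/esym/setIidl => z _.
  exists (maxn (Num.bound `|complex.Re z|) (Num.bound `|complex.Im z|)) => //.
  have bd (x : R) n : (Num.bound `|x| <= n)%N -> - n%:R <= x < n%:R.
    move=> xn; have : `|x| < n%:R.
      by apply: (lt_le_trans (archi_boundP (normr_ge0 x))); rewrite ler_nat.
    by rewrite ltr_norml => /andP[/ltW-> ->].
  by split; apply: bd; rewrite ?leq_maxl ?leq_maxr.
apply/eqP; rewrite eq_le measure_ge0 andbT.
have mk k : measurable (A `&` box k) by apply: measurableI => //; exact: measurable_box.
have mU : measurable (\bigcup_k (A `&` box k)) by exact: bigcupT_measurable.
apply: (le_trans (@generalized_Boole_inequality _ _ _ mu _ mk mU)).
by rewrite eseries0// => i _ _; exact: box0.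
Qed.

End absolute_continuity.

(** * The fixed point equation as a branching model *)

Section random_length.
Context (R : realType) (d : measure_display) (Omega : measurableType d).
Variables (P : probability Omega R) (T : nat -> {RV P >-> R[i]}).

Local Notation N := (num_terms T).

Lemma measurable_neq0 j : measurable [set w | T j w != 0].
Proof.
have := measurable_normc (measurable_funP (T j)).
move=> /(_ measurableT _ (@measurable_itv R `]0, +oo[)).
congr measurable; apply/seteqP; split => w /=; rewrite in_itv/= andbT.
  by move=> [_]; rewrite lt_def normc_eq0 => /andP[].
by move=> Tw; split=> //; rewrite lt_def normc_eq0 Tw normc_ge0.
Qed.

(** The set of indices of nonzero weights takes countably many finite values, and
    the cardinality is 0 when it is infinite. *)
Lemma measurable_num_terms_gt n : measurable [set w | (n < N w)%N].
Proof.
have -> : [set w | (n < N w)%N] = \bigcup_(J : {fset nat})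
    (if (n < #|` J|)%N then [set w | nonzero_indices T w = [set` J]] else set0).
  apply/seteqP; split => w /=.
    move=> nN; exists (fset_set (nonzero_indices T w)) => //; rewrite -/(N w) nN /=.
    have [fin|inf] := pselect (finite_set (nonzero_indices T w)); first by rewrite fset_setK.
    by move: nN; rewrite /num_terms /fset_set; case: pselect => // _; rewrite cardfs0.
  move=> [J _]; case: ifP => // nJ /= wJ.
  by rewrite /num_terms wJ set_fsetK.
apply: countable_bigcupT_measurable; first exact: countableP.
move=> J; case: ifP => // _.
rewrite (_ : [set w | _] = \bigcap_j (if j \in J then [set w | T j w != 0]
  else ~` [set w | T j w != 0])).
  by apply: bigcapT_measurable => j; case: ifP => _; [|apply: measurableC]; exact: measurable_neq0.
apply/seteqP; split => w /=.
  by move=> /seteqP[s1 s2] j _; case: ifPn => [/s2//|/negP jJ] /= Tj; apply: jJ; exact: s1.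
by move=> h; apply/seteqP; split => j /=; have := h j I; case: ifPn.
Qed.

Lemma measurable_random_length d' (S' : measurableType d') (F : nat -> Omega -> S') :
  (forall n, measurable_fun setT (F n)) -> measurable_fun setT (fun w => F (N w) w).
Proof.
move=> mF _ A mA; rewrite setTI.
have mge n : measurable [set w | (n <= N w)%N].
  case: n => [|n]; last exact: measurable_num_terms_gt.
  by rewrite (_ : [set w | _] = setT)//; apply/seteqP; split.
rewrite (_ : _ @^-1` _ = \bigcup_n (([set w | (n <= N w)%N] `\` [set w | (n < N w)%N]) `&` F n @^-1` A)).
  apply: bigcupT_measurable => n; apply: measurableI.
    by apply: measurableD => //; exact: measurable_num_terms_gt.
  by have := mF n measurableT A mA; rewrite setTI.
apply/seteqP; split => w /=.
  by move=> Aw; exists (N w) => //; split=> //; split=> //=; rewrite ltnn.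
move=> [n _ [[/= nN /negP]]]; rewrite -leqNgt => Nn.
by have -> : n = N w by apply/eqP; rewrite eqn_leq nN.
Qed.

(** A finite set of naturals with as many elements as its largest successor is an
    initial segment. *)
Lemma finite_initialP : finite_initial T ->
  {ae P, forall w, forall k, (T k w != 0) = (k < N w)%N}.
Proof.
apply: filterS => w [fin Nmax].
set J := fset_set (nonzero_indices T w) in Nmax.
have JE k : (k \in J) = (T k w != 0).
  by rewrite in_fset_set//; apply/idP/idP; rewrite inE.
have Jlt k : k \in J -> (k < N w)%N.
  by move=> kJ; rewrite Nmax; apply: (@leq_bigmax_seq _ (enum_fset J) xpredT (fun j => j.+1) k).
have sub : {subset (J : seq nat) <= iota 0 (N w)} by move=> k /Jlt; rewrite mem_iota.
have [_ JN] := uniq_min_size (fset_uniq J) sub (eq_leq (size_iota 0 (N w))).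
by move=> k; rewrite -JE; have := JN k; rewrite mem_iota add0n.
Qed.

End random_length.

Section independence_of_copies.
Context (R : realType) (d : measure_display) (Omega : measurableType d).
Variables (P : probability Omega R) (T X : nat -> {RV P >-> R[i]}).
Variable mu : probability R[i] R.
Hypothesis X_law : forall j A, measurable A -> P (X j @^-1` A) = mu A.
Hypothesis X_indep : mutually_independent X.
Hypothesis TX_indep : independent_seqs T X.

Let mpre (V : {RV P >-> R[i]}) A : measurable A -> measurable (V @^-1` A).
Proof. by move=> mA; rewrite -[X in measurable X]setTI; exact: measurable_funP. Qed.

Let sigma_measurable (V : nat -> {RV P >-> R[i]}) E : sigma_seq V E -> measurable E.
Proof.
apply: smallest_sub; first exact: sigma_algebra_measurable.
by move=> _ [k _ [A mA <-]]; rewrite setTI; exact: mpre.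
Qed.

Let cylinder (J : {fset nat}) (A : nat -> set R[i]) : set Omega :=
  \bigcap_(k in [set` J]) (X k @^-1` A k).

Let cylinder_sigma J A : (forall k, measurable (A k)) -> sigma_seq X (cylinder J A).
Proof.
move=> mA.
apply: (@fin_bigcap_measurable _ (g_sigma_algebraType (\bigcup_j preimage_set_system setT (X j) measurable))).
  exact: finite_fset.
move=> k _; apply: sub_sigma_algebra; exists k => //; exists (A k) => //.
by rewrite setTI.
Qed.

Variable j : nat.

Let pi_system : set (set Omega) := [set E | exists F J A,
  [/\ sigma_seq T F, j \notin J, forall k, measurable (A k) & E = F `&` cylinder J A]].

Let sigmaI (V : nat -> {RV P >-> R[i]}) E F : sigma_seq V E -> sigma_seq V F -> sigma_seq V (E `&` F).
Proof.
exact: (@measurableI _ (g_sigma_algebraType (\bigcup_j preimage_set_system setT (V j) measurable))).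
Qed.

Let sigmaT (V : nat -> {RV P >-> R[i]}) : sigma_seq V setT.
Proof.
exact: (@measurableT _ (g_sigma_algebraType (\bigcup_j preimage_set_system setT (V j) measurable))).
Qed.

Let pi_systemI : setI_closed pi_system.
Proof.
move=> _ _ [F [J [A [sF jJ mA ->]]]] [F' [J' [A' [sF' jJ' mA' ->]]]].
exists (F `&` F'), (J `|` J')%fset, (fun k => (if k \in J then A k else setT) `&`
  (if k \in J' then A' k else setT)); split.
- exact: sigmaI.
- by rewrite inE negb_or jJ.
- by move=> k; apply: measurableI; case: ifP.
apply/seteqP; split => w /=.
  move=> [[Fw Jw] [F'w J'w]]; split=> // k /=; rewrite inE => _.
  by split; case: ifP => // kJ; [exact: Jw|exact: J'w].
move=> [[Fw F'w] h]; split; split=> // k /= kJ.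
  by have := h k; rewrite /= inE kJ => /(_ isT) [].
by have := h k; rewrite /= inE kJ orbT => /(_ isT) [].
Qed.

Let pi_systemT : pi_system setT.
Proof.
exists setT, fset0, (fun=> setT); split=> //.
by rewrite setTI; apply/seteqP; split => // w _ k.
Qed.

Let others_pi E : <<s others (fun k => T k : Omega -> R[i]) (fun k => X k : Omega -> R[i]) j >> E ->
  <<s pi_system >> E.
Proof.
apply: smallest_sub; first exact: smallest_sigma_algebra.
move=> _ [[k [A [mA ->]]]|[k [A [kj mA ->]]]]; apply: sub_sigma_algebra.
  exists (T k @^-1` A), fset0, (fun=> setT); split=> //.
    by apply: sub_sigma_algebra; exists k => //; exists A => //; rewrite setTI.
  by apply/seteqP; split => w // [].
exists setT, [fset k]%fset, (fun=> A); split=> //.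
  by rewrite inE eq_sym.
rewrite setTI; apply/seteqP; split => w /=.
  by move=> Aw l /=; rewrite inE => /eqP ->.
by move=> h; apply: h; rewrite /= inE.
Qed.

(** The intersections of an event of the weights with cylinders of the other copies
    form a pi-system on which the product rule is the hypothesis. *)
Lemma copy_independent E B :
  <<s others (fun k => T k : Omega -> R[i]) (fun k => X k : Omega -> R[i]) j >> E ->
  measurable B -> P (E `&` X j @^-1` B) = (P E * mu B)%E.
Proof.
move=> /others_pi sE mB; have mXB := mpre (X j) mB.
have muB0 : (0 <= mu B)%E by exact: measure_ge0.
have muBfin : mu B = (fine (mu B))%:E by rewrite fineK// fin_num_measure.
have c0 : 0 <= fine (mu B) by exact: fine_ge0.
pose m1 : {measure set Omega -> \bar R} := mrestr P mXB.
pose m2 : {measure set Omega -> \bar R} := mscale (NngNum c0) P.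
have m2E D : m2 D = (P D * mu B)%E by rewrite /m2 /= /mscale /= muBfin muleC.
rewrite -m2E -[LHS]/(m1 E).
have piP D : pi_system D -> measurable D.
  move=> [F [J [A [sF _ mA ->]]]]; apply: measurableI; first exact: sigma_measurable sF.
  exact: sigma_measurable (cylinder_sigma J mA).
have cover : \bigcup_(k : nat) [set: Omega] = setT.
  by apply/seteqP; split => // w _; exists 0%N.
apply: (@g_sigma_algebra_measure_unique _ _ _ pi_system piP (fun=> setT)
  (fun=> pi_systemT) cover m1 m2 pi_systemI _ _ E sE).
- move=> _ [F [J [A [sF jJ mA ->]]]]; rewrite m2E /m1 /= /mrestr.
  have sC := cylinder_sigma J mA.
  pose A' k := if k == j then B else A k.
  have mA' k : measurable (A' k) by rewrite /A'; case: ifP.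
  have CE : cylinder J A `&` X j @^-1` B = cylinder (j |` J)%fset A'.
    apply/seteqP; split => w /=.
      move=> [Cw Bw] k /=; rewrite !inE /A' => /orP[/eqP->|kJ]; first by rewrite eqxx.
      by case: eqP => [->//|_]; exact: Cw.
    move=> h; split; last by have := h j; rewrite /= !inE eqxx /A' eqxx; apply.
    move=> k /= kJ; have := h k; rewrite /= !inE kJ orbT /A' => /(_ isT).
    by case: eqP => // kj; rewrite kj (negbTE jJ) in kJ.
  rewrite -setIA CE (TX_indep sF (cylinder_sigma _ mA')) (TX_indep sF sC) -muleA; congr (_ * _)%E.
  rewrite /cylinder !X_indep// big_fsetU1//= muleC /A' eqxx X_law//; congr (_ * _)%E.
  apply: eq_big_seq => k kJ; case: eqP => // kj.
  by rewrite kj (negbTE jJ) in kJ.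
- move=> _; rewrite /m1 /= /mrestr setTI ltey_eq fin_num_measure//.
Qed.

End independence_of_copies.

Section weights_of_the_equation.
Context (R : realType) (d : measure_display) (Omega : measurableType d).
Variables (P : probability Omega R) (T : nat -> {RV P >-> R[i]}).

Local Notation N := (num_terms T).

Lemma sum_beyond_length (X : nat -> Omega -> R[i]) w n :
  (forall k, (T k w != 0) = (k < N w)%N) -> (N w <= n)%N ->
  \sum_(k < N w) T k w * X k w = \sum_(k < n) T k w * X k w.
Proof.
move=> TN Nn; rewrite -!(big_mkord xpredT (fun k => T k w * X k w)).
rewrite (big_cat_nat _ (n := N w) (p := n))//= [X in _ = _ + X]big_nat_cond.
rewrite [X in _ = _ + X]big1 ?addr0// => k /andP[/andP[Nk _] _].
by have := TN k; rewrite ltnNge Nk /= => /negbFE/eqP->; rewrite mul0r.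
Qed.

Hypothesis TN : {ae P, forall w, forall k, (T k w != 0) = (k < N w)%N}.

(** Otherwise there would be at most one term almost surely. *)
Lemma second_weight_charged : (1 < 'E_P[fun w => (N w)%:R])%E ->
  0 < fine (P [set w | T 1%N w != 0]).
Proof.
move=> EN; have m1 := measurable_neq0 T 1.
rewrite lt_def fine_ge0// andbT; apply/negP => /eqP P1.
have {}P1 : P [set w | T 1%N w != 0] = 0%E.
  by rewrite -[LHS]fineK ?P1// fin_num_measure.
have mN : measurable_fun setT (fun w => (N w)%:R : R).
  apply: (@measurable_random_length R d Omega P T _ _ (fun n _ => n%:R : R)) => n.
  exact: measurable_cst.
move: EN; apply/negP; rewrite -leNgt unlock.
apply: (@le_trans _ _ (\int[P]_w 1)%E); last by rewrite integral_cst// mul1e probability_le1.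
apply: ae_ge0_le_integral => //.
- exact/measurable_EFinP.
have T1 : {ae P, forall w, T 1%N w = 0}.
  exists [set w | T 1%N w != 0]; split=> // w /= h.
  by apply/eqP => T1; apply: h.
apply: filterS2 TN T1 => w Tw T1w _; rewrite lee_fin lern1.
by have := Tw 1%N; rewrite T1w eqxx /= => /esym/negbT; rewrite -leqNgt.
Qed.

Lemma two_weights_moment_le (alpha : R) : 0 < alpha ->
  {ae P, forall w, (0 < N w)%N} -> moment T alpha = 1%E ->
  (\int[P]_w (normc (T 0%N w) `^ alpha + normc (T 1%N w) `^ alpha)%:E <= 1)%E.
Proof.
move=> a0 N0 <-; rewrite /moment unlock.
have mpow k : measurable_fun setT (fun w => normc (T k w) `^ alpha).
  apply: (measurableT_comp (measurable_powR _)); apply: measurable_normc.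
  exact: measurable_funP.
apply: ae_ge0_le_integral => //.
- by move=> w _; rewrite lee_fin addr_ge0 ?powR_ge0.
- by apply/measurable_EFinP; exact: measurable_funD.
- by move=> w _; rewrite lee_fin sumr_ge0// => k _; rewrite powR_ge0.
- apply/measurable_EFinP.
  apply: (@measurable_random_length R d Omega P T _ _ (fun n w => \sum_(j < n) normc (T j w) `^ alpha)).
  by move=> n; apply: measurable_sum => k; exact: mpow.
apply: filterS2 TN N0 => w Tw N0w _; rewrite lee_fin /power_sum.
rewrite -(big_mkord xpredT (fun j => normc (T j w) `^ alpha)).
rewrite big_ltn// lerD2l.
have [N1|N1] := ltnP 1 (N w).
  by rewrite big_ltn// lerDl sumr_ge0// => k _; rewrite powR_ge0.
have := Tw 1%N; rewrite ltnNge N1 /= => /negbFE/eqP->.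
rewrite normc0 powR0 ?gt_eqF// sumr_ge0// => k _; exact: powR_ge0.
Qed.

(** If all weights were real, so would be the closed group that they generate, and
    the real line would be an invariant subspace. *)
Lemma not_all_weights_real :
  (forall V : set R[i], real_subspace V -> invariant_under (support_group T) V ->
    V = [set 0] \/ V = setT) ->
  exists j, ~ {ae P, forall w, complex.Im (T j w) = 0}.
Proof.
move=> irr; apply: contrapT => /forallNP real.
have {}real j : {ae P, forall w, complex.Im (T j w) = 0} by apply: contrapT; exact: real.
pose F : set R[i]^o := [set z : R[i] | complex.Im z = 0].
pose H : set R[i] := F `\ 0.
have ImM0 (x y : R[i]) : complex.Im x = 0 -> complex.Im y = 0 -> complex.Im (x * y) = 0.
  by move=> x0 y0; rewrite complexImM x0 y0 mulr0 mul0r addr0.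
have ImV0 (x : R[i]) : complex.Im x = 0 -> complex.Im x^-1 = 0.
  by case: x => a b /= ->; rewrite mul0r oppr0.
have Fclosed : closed F.
  move=> z Fz; apply: contrapT => /eqP z0.
  have r0 : 0 < Complex `|complex.Im z| 0 :> R[i].
    by rewrite ltcE /= eqxx normr_gt0.
  have [w [/= w0]] := Fz _ (@nbhsx_ballx _ R[i]^o z _ r0).
  move=> zw; have : `|(z : R[i]) - w| < Complex `|complex.Im z| 0 by exact: zw.
  rewrite ltcE /= => /andP[_].
  have imE : complex.Im ((z : R[i]) - w) = complex.Im z.
    have ImN (u : R[i]) : complex.Im (- u) = - complex.Im u by case: u.
    by rewrite complexImD ImN w0 oppr0 addr0.
  by have := normr_Im_le ((z : R[i]) - w); rewrite imE ltNge => ->.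
have subH : closed_mul_subgroup H.
  split; last by exists F.
  split.
    by rewrite mem_set//; split=> //=; apply/eqP; exact: oner_neq0.
  move=> x y; rewrite !inE => -[/= x0 /eqP xn0] [/= y0 /eqP yn0]; split=> /=.
    by apply: ImM0 => //; exact: ImV0.
  by apply/eqP; rewrite mulf_neq0// invr_neq0.
have sgH : support_group T `<=` H.
  apply: bigcap_inf; split=> //.
  apply: filterS2 TN (ae_foralln real) => w Tw Rw j jN; split; first exact: Rw.
  by apply/eqP; rewrite Tw.
pose V : set R[i] := [set z | complex.Im z = 0].
have VE : V = [set 0] \/ V = setT.
  apply: irr.
    split; first by rewrite mem_set.
    move=> a x y; rewrite !inE /V /= => x0 y0.
    have -> : complex.Im (a *: x + y) = a * complex.Im x + complex.Im y.
      by case: x {x0} => xr xi; case: y {y0} => yr yi.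
    by rewrite x0 y0 mulr0 addr0.
  move=> u v /sgH[u0 _] v0; exact: ImM0.
case: VE => [V0|VT].
  have : V 1 by [].
  by rewrite V0 => /= /eqP; rewrite oner_eq0.
have : V (Complex 0 1) by rewrite VT.
by rewrite /V /= => /eqP; rewrite oner_eq0.
Qed.

End weights_of_the_equation.

Lemma measurable_set1_complex (R : realType) (c : R[i]) : measurable [set c].
Proof.
rewrite (_ : [set c] = (@complex.Re R) @^-1` [set complex.Re c] `&`
    (@complex.Im R) @^-1` [set complex.Im c]); last first.
  by apply/seteqP; split => z /=; [move=> ->|move=> [re im]; exact: eq_complexP].
apply: measurableI.
  by have := @measurable_Re R measurableT _ (measurable_set1 (complex.Re c)); rewrite setTI.
by have := @measurable_Im R measurableT _ (measurable_set1 (complex.Im c)); rewrite setTI.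
Qed.

Local Open Scope ereal_scope.

Theorem corollary2p3 (R : realType)
    (d : measure_display) (Omega : measurableType d) (P : probability Omega R)
    (T : nat -> {RV P >-> R[i]})
    (hN : finite_initial T)
    (hN0 : {ae P, forall w, (0 < num_terms T w)%N})
    (h1 : 1 < 'E_P[fun w => (num_terms T w)%:R])
    (alpha : R) (halpha : (1 < alpha < 2)%R)
    (h2 : moment T alpha = 1)
    (h3 : -oo < log_moment T alpha < 0)
    (h3' : 'E_P[fun w => (power_sum T alpha w * log_plus (power_sum T alpha w))%R] < +oo)
    (h4 : exists2 eps : R, (0 < eps)%R &
      'E_P[fun w => (normc (term_sum T w) `^ alpha *
                     log_plus (normc (term_sum T w)) `^ (2 + eps))%R] < +oo)
    (h5 : 'E_P[fun w => ((num_terms T w)%:R ^+ 2)%R] < +oo)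
    (h5' : 'E_P[fun w => ((num_terms T w)%:R *
                \sum_(j < num_terms T w) log_plus (normc (T j w)))%R] < +oo)
    (h6 : forall V : set R[i], real_subspace V -> invariant_under (support_group T) V ->
      V = [set 0%R] \/ V = setT)
    (d' : measure_display) (Omega' : measurableType d')
    (Q : probability Omega' R) (X : {RV Q >-> R[i]})
    (Xs : nat -> {RV P >-> R[i]})
    (hX : nontrivial X)
    (hXs : smoothing_solution T Xs X) :
  distribution Q X `<< complex_lebesgue R.
Proof.
have [X_law X_indep TX_indep Y_law] := hXs.
pose mu : probability R[i] R := distribution P (Xs 0%N).
have muE A : measurable A -> mu A = distribution Q X A by exact: X_law.
pose Y w : R[i] := (\sum_(j < num_terms T w) T j w * Xs j w)%R.
have alpha0 : (0 < alpha)%R by case/andP: halpha => /(lt_trans _)->.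
have TN := finite_initialP hN.
have M : branching_model P mu alpha (fun k => T k : Omega -> R[i])
    (fun k => Xs k : Omega -> R[i]) Y (num_terms T).
  split.
  - by move=> k; exact: measurable_funP.
  - by move=> k; exact: measurable_funP.
  - apply: (@measurable_random_length R d Omega P T _ _
      (fun n w => \sum_(j < n) T j w * Xs j w : R[i])%R) => n.
    by apply: measurable_complex_sum => k; apply: measurable_complexM; exact: measurable_funP.
  - by move=> n; exact: measurable_num_terms_gt.
  - by apply: filterS TN => w Tw n Nn;
    exact: (sum_beyond_length (fun k => Xs k : Omega -> R[i]) Tw Nn).
  - move=> j E B; apply: copy_independent => // i A mA.
    by rewrite muE// -(X_law i A mA).
  - by move=> A mA; rewrite muE// Y_law.
  - by apply: filterS2 TN hN0 => w Tw N0; rewrite Tw.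
  - exact: second_weight_charged.
  - exact: alpha0.
  - exact: two_weights_moment_le.
  - exact: not_all_weights_real.
  - move=> [c muc]; apply: hX; exists c.
    have mc : measurable (~` [set c]) by apply: measurableC; exact: measurable_set1_complex.
    exists (X @^-1` (~` [set c])); split.
    + by rewrite -[X in measurable X]setTI; exact: measurable_funP.
    + have : mu (~` [set c]) = 0.
        by apply/negligibleP => //; exact: muc.
      by rewrite muE.
    + by move=> w /= Xw.
have := quartic_decay_absolutely_continuous (quartic_decay_full M).
move/null_content_dominatesP => dom; apply/null_content_dominatesP => A mA A0.
by rewrite -muE// dom.
Qed.
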